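(* Let $\mathcal{K}=(K,\Gamma;v,s,c)$ be a model of $\mathrm{Mo}(\ell,s,c)$, with distinguished lift $\boldsymbol{k}\subseteq K$, such that $\mathcal{K}$ is $\mathrm{d}$-henselian. Then the $L_2$-theory $\mathrm{Th}(\mathcal{K})$ is axiomatized by: (1) $\mathrm{Mo}(\ell,s,c)$; (2) the axioms for $\mathrm{d}$-henselianity; (3) $\mathrm{Th}(\boldsymbol{k},\Gamma;c)$, with $\boldsymbol{k}$ as differential field and $\Gamma$ as ordered abelian group.
   Context: All differential fields have characteristic $0$ and a single distinguished derivation, written $f\mapsto f'$; $f^\dagger=f'/f$ for $f\ne0$. A valued differential field is a differential field $K$ together with a (Krull) valuation $v:K^\times\to\Gamma=v(K^\times)$ whose residue field has characteristic $0$; $\mathcal{O}$ is its valuation ring and $\mathfrak{m}$ the maximal ideal of $\mathcal{O}$. $K$ is monotone if $v(f')\ge v(f)$ for all $f\in K$. If $K$ is monotone, then its derivation is small, i.e. $\mathfrak{m}'\subseteq\mathfrak{m}$, and also $\mathcal{O}'\subseteq\mathcal{O}$, so the residue field $\mathcal{O}/\mathfrak{m}$ becomes a differential field with the induced derivation (the differential residue field). A valued differential field with small derivation is $\mathrm{d}$-henselian if every differential polynomial $P\in\mathcal{O}\{Y\}=\mathcal{O}[Y,Y',Y'',\dots]$ whose reduction $\overline{P}\in(\mathcal{O}/\mathfrak{m})\{Y\}$ has total degree $1$ has a zero in $\mathcal{O}$; this is expressed by a set of first-order sentences. A lift of the differential residue field is a differential subfield of $K$ contained in $\mathcal{O}$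 that maps isomorphically onto the differential residue field under the canonical map $\mathcal{O}\to\mathcal{O}/\mathfrak{m}$. $L_2$ is the natural $2$-sorted language for structures $\mathcal{K}=(K,\Gamma;v,s,c)$, with the language of differential fields and a unary predicate for $\boldsymbol{k}$ on the first sort, the language of ordered abelian groups on the second sort, and unary function symbols for $v,s,c$. $\mathrm{Mo}(\ell,s,c)$ is the set of $L_2$-sentences whose models are exactly the $\mathcal{K}=(K,\Gamma;v,s,c)$ where $K$ is a differential field equipped with a differential subfield $\boldsymbol{k}$ (singled out by the predicate), $\Gamma$ is an ordered abelian group, $v:K^\times\to\Gamma=v(K^\times)$ is a valuation making $K$ a monotone valued differential field such that $\boldsymbol{k}\subseteq K$ is a lift of the differential residue field, $s:\Gamma\to K^\times$ is a cross-section of $v$ (a group morphism with $v\circ s=\mathrm{id}_\Gamma$), and $c:\Gamma\to\boldsymbol{k}$ satisfies $c(\gamma)=s(\gamma)^\dagger$ for all $\gamma\in\Gamma$. $\mathcal{K}$ is called $\mathrm{d}$-henselian if the valued differential field $K$ is. $\mathrm{Th}(\boldsymbol{k},\Gamma;c)$ is the theory of the $2$-sorted structure consisting of the differential field $\boldsymbol{k}$, the ordered abelian group $\Gamma$ and the map $c:\Gamma\to\boldsymbol{k}$, viewed as a set of statements about the corresponding parts of an $L_2$-structure. *)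

(* Defs.v *)
From HB Require Import structures.
From mathcomp Require Import all_boot all_order all_algebra.
From mathcomp Require Import ring_quotient mpoly.

Set Implicit Arguments.
Unset Strict Implicit.
Unset Printing Implicit Defensive.

Import Order.TTheory GRing.Theory Num.Theory.
Local Open Scope ring_scope.

(** * Two-sorted first-order logic *)

(* The sorts are the field sort and the group sort.  A formula of type
   [formula atom m n] has its free variables among m field variables and
   n group variables; the variable bound by a quantifier has index [ord0].
   The other connectives are definable classically from these. *)
Inductive formula (atom : nat -> nat -> Type) : nat -> nat -> Type :=
| Atom m n of atom m n : formula atom m n
| Bot m n : formula atom m n
| Imp m n of formula atom m n & formula atom m n : formula atom m n
| AllK m n of formula atom m.+1 n : formula atom m n
| AllG m n of formula atom m n.+1 : formula atom m n.

Definition scons (A : Type) n (a : A) (e : 'I_n -> A) : 'I_n.+1 -> A :=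
  fun i => if unlift ord0 i is Some j then e j else a.

Fixpoint holds (A B : Type) (atom : nat -> nat -> Type)
    (I : forall m n, ('I_m -> A) -> ('I_n -> B) -> atom m n -> Prop)
    m n (p : formula atom m n) : ('I_m -> A) -> ('I_n -> B) -> Prop :=
  match p in formula _ m n return ('I_m -> A) -> ('I_n -> B) -> Prop with
  | Atom _ _ a => fun e f => I _ _ e f a
  | Bot _ _ => fun _ _ => False
  | Imp _ _ p q => fun e f => holds I p e f -> holds I q e f
  | AllK _ _ p => fun e f => forall a : A, holds I p (scons a e) f
  | AllG _ _ p => fun e f => forall b : B, holds I p e (scons b f)
  end.

(** ** The language of the structures (K, Gamma; v, s, c) *)

Inductive L2_kterm (m n : nat) : Type :=
| Kvar of 'I_m
| Kzero
| Kone
| Kadd of L2_kterm m n & L2_kterm m n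
| Kopp of L2_kterm m n
| Kmul of L2_kterm m n & L2_kterm m n
| Kder of L2_kterm m n
| Ks of L2_gterm m n
| Kc of L2_gterm m n
with L2_gterm (m n : nat) : Type :=
| Gvar of 'I_n
| Gzero
| Gadd of L2_gterm m n & L2_gterm m n
| Gopp of L2_gterm m n
| Gv of L2_kterm m n.

Inductive L2_atom (m n : nat) : Type :=
| Keq of L2_kterm m n & L2_kterm m n
| Kpred of L2_kterm m n
| Geq of L2_gterm m n & L2_gterm m n
| Gle of L2_gterm m n & L2_gterm m n.

Definition L2_sentence : Type := formula L2_atom 0 0.
Definition L2_theory : Type := L2_sentence -> Prop.

(* An arbitrary structure for the language: no axioms are imposed here.
   Relation symbols are interpreted by boolean relations, which is no
   restriction in classical logic. *)
Record L2_structure : Type := L2Structure {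
  s2_K : Type;
  s2_G : Type;
  s2_zero : s2_K;
  s2_one : s2_K;
  s2_add : s2_K -> s2_K -> s2_K;
  s2_opp : s2_K -> s2_K;
  s2_mul : s2_K -> s2_K -> s2_K;
  s2_der : s2_K -> s2_K;
  s2_k : pred s2_K;
  s2_gzero : s2_G;
  s2_gadd : s2_G -> s2_G -> s2_G;
  s2_gopp : s2_G -> s2_G;
  s2_gle : rel s2_G;
  s2_v : s2_K -> s2_G;
  s2_s : s2_G -> s2_K;
  s2_c : s2_G -> s2_K }.

Section L2Semantics.
Variables (M : L2_structure) (m n : nat).
Variables (e : 'I_m -> s2_K M) (f : 'I_n -> s2_G M).

Fixpoint L2_keval (t : L2_kterm m n) : s2_K M :=
  match t with
  | Kvar i => e i
  | Kzero => s2_zero M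
  | Kone => s2_one M
  | Kadd t u => s2_add (L2_keval t) (L2_keval u)
  | Kopp t => s2_opp (L2_keval t)
  | Kmul t u => s2_mul (L2_keval t) (L2_keval u)
  | Kder t => s2_der (L2_keval t)
  | Ks g => s2_s (L2_geval g)
  | Kc g => s2_c (L2_geval g)
  end
with L2_geval (t : L2_gterm m n) : s2_G M :=
  match t with
  | Gvar i => f i
  | Gzero => s2_gzero M
  | Gadd t u => s2_gadd (L2_geval t) (L2_geval u)
  | Gopp t => s2_gopp (L2_geval t)
  | Gv x => s2_v (L2_keval x)
  end.

Definition L2_atom_holds (a : L2_atom m n) : Prop :=
  match a with
  | Keq t u => L2_keval t = L2_keval u
  | Kpred t => s2_k (L2_keval t)
  | Geq t u => L2_geval t = L2_geval u
  | Gle t u => s2_gle (L2_geval t) (L2_geval u)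
  end.

End L2Semantics.

Definition L2_true (M : L2_structure) (p : L2_sentence) : Prop :=
  holds (@L2_atom_holds M) p (fun=> s2_zero M) (fun=> s2_gzero M).

Definition L2_Th (M : L2_structure) : L2_theory := L2_true M.

Definition L2_models (M : L2_structure) (T : L2_theory) : Prop :=
  forall p, T p -> L2_true M p.

(** ** The language of the structures (k, Gamma; c) *)

Inductive Lc_gterm (n : nat) : Type :=
| cGvar of 'I_n
| cGzero
| cGadd of Lc_gterm n & Lc_gterm n
| cGopp of Lc_gterm n.

Inductive Lc_kterm (m n : nat) : Type :=
| cKvar of 'I_m
| cKzero
| cKone
| cKadd of Lc_kterm m n & Lc_kterm m n
| cKopp of Lc_kterm m n
| cKmul of Lc_kterm m n & Lc_kterm m n
| cKder of Lc_kterm m n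
| cKc of Lc_gterm n.

Inductive Lc_atom (m n : nat) : Type :=
| cKeq of Lc_kterm m n & Lc_kterm m n
| cGeq of Lc_gterm n & Lc_gterm n
| cGle of Lc_gterm n & Lc_gterm n.

Definition Lc_sentence : Type := formula Lc_atom 0 0.
Definition Lc_theory : Type := Lc_sentence -> Prop.

Record Lc_structure : Type := LcStructure {
  sc_k : Type;
  sc_G : Type;
  sc_zero : sc_k;
  sc_one : sc_k;
  sc_add : sc_k -> sc_k -> sc_k;
  sc_opp : sc_k -> sc_k;
  sc_mul : sc_k -> sc_k -> sc_k;
  sc_der : sc_k -> sc_k;
  sc_gzero : sc_G;
  sc_gadd : sc_G -> sc_G -> sc_G;
  sc_gopp : sc_G -> sc_G;
  sc_gle : rel sc_G;
  sc_c : sc_G -> sc_k }.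

Section LcSemantics.
Variables (M : Lc_structure) (m n : nat).
Variables (e : 'I_m -> sc_k M) (f : 'I_n -> sc_G M).

Fixpoint Lc_geval (t : Lc_gterm n) : sc_G M :=
  match t with
  | cGvar i => f i
  | cGzero => sc_gzero M
  | cGadd t u => sc_gadd (Lc_geval t) (Lc_geval u)
  | cGopp t => sc_gopp (Lc_geval t)
  end.

Fixpoint Lc_keval (t : Lc_kterm m n) : sc_k M :=
  match t with
  | cKvar i => e i
  | cKzero => sc_zero M
  | cKone => sc_one M
  | cKadd t u => sc_add (Lc_keval t) (Lc_keval u)
  | cKopp t => sc_opp (Lc_keval t)
  | cKmul t u => sc_mul (Lc_keval t) (Lc_keval u)
  | cKder t => sc_der (Lc_keval t)
  | cKc g => sc_c (Lc_geval g)
  end.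

Definition Lc_atom_holds (a : Lc_atom m n) : Prop :=
  match a with
  | cKeq t u => Lc_keval t = Lc_keval u
  | cGeq t u => Lc_geval t = Lc_geval u
  | cGle t u => sc_gle (Lc_geval t) (Lc_geval u)
  end.

End LcSemantics.

Definition Lc_true (M : Lc_structure) (p : Lc_sentence) : Prop :=
  holds (@Lc_atom_holds M) p (fun=> sc_zero M) (fun=> sc_gzero M).

Definition Lc_Th (M : Lc_structure) : Lc_theory := Lc_true M.

Definition Lc_models (M : Lc_structure) (T : Lc_theory) : Prop :=
  forall p, T p -> Lc_true M p.

(** * Valued differential fields *)

Record diffField : Type := DiffField {
  df_field :> fieldType;
  der : df_field -> df_field;
  df_char0 : [pchar df_field] =i pred0;
  derD : forall x y, der (x + y) = der x + der y;
  derM : forall x y, der (x * y) = der x * y + x * der y }.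

Record ordGroup : Type := OrdGroup {
  og_group :> porderZmodType;
  og_total : total (<=%R : rel og_group);
  og_leD : forall x y z : og_group, x <= y -> x + z <= y + z }.

(* A differential field with a valuation onto an ordered abelian group.  The
   valuation lives on K^*; the function [val0] is its extension to K by the
   arbitrary convention v(0) = 0, so v(0) must be read as infinity whenever
   [val0] is used below.  The condition that the residue field has
   characteristic 0 is imposed later, once the residue field is defined. *)
Record valDiffField : Type := ValDiffField {
  vdf_field :> diffField;
  vgroup : ordGroup;
  val0 : vdf_field -> vgroup;
  val00 : val0 0 = 0;
  val0M : forall x y, x != 0 -> y != 0 -> val0 (x * y) = val0 x + val0 y;
  val0D : forall x y, x != 0 -> y != 0 -> x + y != 0 ->
    Num.min (val0 x) (val0 y) <= val0 (x + y);
  val0_surj : forall g : vgroup, exists2 x, x != 0 & val0 x = g }.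

Section ValuationRing.
Variable V : valDiffField.

Definition vring_pred : {pred V} := fun x => (x == 0) || (0 <= val0 x).

Lemma val01 : val0 (1 : V) = 0.
Proof.
have := val0M (oner_neq0 V) (oner_neq0 V).
by rewrite mulr1 -[LHS]addr0 => /addrI.
Qed.

Lemma val0N (x : V) : val0 (- x) = val0 x.
Proof.
have h2 (g : vgroup V) : g + g = 0 -> g = 0.
  move=> gg; apply/eqP; rewrite eq_le.
  case/orP: (og_total g 0) => hg; rewrite hg ?andbT /=.
    by have := og_leD g hg; rewrite gg add0r.
  by have := og_leD g hg; rewrite gg add0r => ->.
have N1 : -1 != 0 :> V by rewrite oppr_eq0 oner_eq0.
have vN1 : val0 (-1 : V) = 0.
  by apply: h2; rewrite -val0M // mulrNN mulr1 val01.
have [->|x0] := eqVneq x 0; first by rewrite oppr0.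
by rewrite -mulN1r val0M // vN1 add0r.
Qed.

Lemma og_add_ge0 (g h : vgroup V) : 0 <= g -> 0 <= h -> 0 <= g + h.
Proof.
by move=> g0 h0; apply: (le_trans h0); have := og_leD h g0; rewrite add0r.
Qed.

Lemma og_add_gt0 (g h : vgroup V) : 0 <= g -> 0 < h -> 0 < g + h.
Proof.
by move=> g0 h0; apply: (lt_le_trans h0); have := og_leD h g0; rewrite add0r.
Qed.

Fact vring_subring : subring_closed vring_pred.
Proof.
split; rewrite /vring_pred.
- by rewrite unfold_in val01 lexx orbT.
- move=> x y; rewrite !unfold_in.
  have [->|x0] := eqVneq x 0.
    by rewrite sub0r oppr_eq0 val0N.
  have [->|y0] := eqVneq y 0.
    by rewrite subr0 (negPf x0).
  have [//|xy0] := eqVneq (x - y) 0 => /= hx hy.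
  apply: le_trans (val0D x0 _ xy0); last by rewrite oppr_eq0.
  by rewrite val0N minElt; case: ifP.
- move=> x y; rewrite !unfold_in mulf_eq0.
  have [//|x0] := eqVneq x 0.
  have [//|y0] := eqVneq y 0 => /= hx hy.
  by rewrite val0M // og_add_ge0.
Qed.

HB.instance Definition _ :=
  GRing.isSubringClosed.Build V vring_pred vring_subring.

Record vring : Type := VRing { vr_val : V; _ : vr_val \in vring_pred }.

HB.instance Definition _ := [isSub for vr_val].
HB.instance Definition _ := [Choice of vring by <:].
HB.instance Definition _ := [SubChoice_isSubComNzRing of vring by <:].

Definition vmax : {pred vring} :=
  fun x => (val x == 0) || (0 < val0 (val x)).

Fact vmax_ideal : idealr_closed vmax.
Proof.
split; rewrite /vmax.
- by rewrite unfold_in rmorph0 eqxx.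
- by rewrite unfold_in rmorph1 oner_eq0 val01 ltxx.
- move=> a x y; rewrite !unfold_in rmorphD rmorphM /=.
  have := valP a; rewrite unfold_in /=.
  set a' := vr_val a; set x' := vr_val x; set y' := vr_val y => ha hx hy.
  have hax : (a' * x' == 0) || (0 < val0 (a' * x')).
    rewrite mulf_eq0.
    have [//|a0] := eqVneq a' 0; have [//|x0] := eqVneq x' 0.
    rewrite (negPf a0) (negPf x0) /= in ha hx.
    by rewrite val0M // og_add_gt0.
  move: (a' * x') hax => z hz.
  have [z0|z0] := eqVneq z 0; first by rewrite z0 add0r.
  have [y0|y0] := eqVneq y' 0; first by rewrite y0 addr0.
  have [//|zy0] := eqVneq (z + y') 0 => /=.
  rewrite (negPf z0) (negPf y0) /= in hz hy.
  apply: lt_le_trans (val0D z0 y0 zy0).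
  by rewrite minElt; case: ifP.
Qed.

HB.instance Definition _ := isIdealr.Build vring vmax vmax_ideal.

Definition residue : comNzRingType := {ideal_quot vmax}.

Definition res (x : vring) : residue := \pi_({ideal_quot vmax})%qT x.

Definition monotone : Prop :=
  forall f : V, der f != 0 -> val0 f <= val0 (der f).

(* Only used when the derivation is small.  An element of O{Y} of order at
   most n is a polynomial over O in n.+1 variables, the i-th of which stands
   for the i-th derivative of Y; [msize] is the total degree plus one. *)
Definition d_henselian : Prop :=
  forall (n : nat) (P : {mpoly vring[n.+1]}),
    msize (map_mpoly res P) = 2%N ->
    exists y : vring,
      (map_mpoly val P).@[fun i : 'I_n.+1 => iter i (@der V) (val y)] = 0.

(* The restriction to k of the canonical map O -> O/m is a morphism of
   differential rings, so it is an isomorphism as soon as it is bijective. *)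
Definition is_lift (k : {pred V}) : Prop :=
  [/\ divring_closed k,
      forall x, x \in k -> der x \in k,
      {subset k <= vring_pred},
      {in [pred x : vring | val x \in k] &, injective res} &
      forall a : residue, exists2 x : vring, val x \in k & res x = a].

End ValuationRing.

(** * The models of Mo(l, s, c) *)

Record Mo_model : Type := MoModel {
  mo_V :> valDiffField;
  mo_char0 : [pchar residue mo_V] =i pred0;
  mo_monotone : monotone mo_V;
  mo_k : {pred mo_V};
  mo_lift : is_lift mo_k;
  mo_s : vgroup mo_V -> mo_V;
  mo_s_neq0 : forall g, mo_s g != 0;
  mo_sD : forall g h, mo_s (g + h) = mo_s g * mo_s h;
  mo_sK : forall g, val0 (mo_s g) = g;
  mo_c : vgroup mo_V -> mo_V;
  mo_c_in : forall g, mo_c g \in mo_k;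
  mo_cE : forall g, mo_c g = der (mo_s g) / mo_s g }.

Arguments mo_k : clear implicits.

Definition L2_of (K : Mo_model) : L2_structure :=
  @L2Structure K (vgroup K) 0 1 +%R -%R *%R (@der K) (mo_k K)
    0 +%R -%R <=%R (@val0 K) (@mo_s K) (@mo_c K).

Section LiftStructure.
Variable K : Mo_model.

Definition mo_ktype : Type := {x : K | x \in mo_k K}.

Let kC : divring_closed (mo_k K).
Proof. by case: (mo_lift K). Qed.

Fact mo_k1 : 1 \in mo_k K.
Proof. by case: kC. Qed.

Fact mo_kB x y : x \in mo_k K -> y \in mo_k K ->
  x - y \in mo_k K.
Proof. by case: kC => _ + _; apply. Qed.

Fact mo_k0 : 0 \in mo_k K.
Proof. by rewrite -(subrr 1) mo_kB ?mo_k1. Qed.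

Fact mo_kN x : x \in mo_k K -> - x \in mo_k K.
Proof. by move=> kx; rewrite -sub0r mo_kB ?mo_k0. Qed.

Fact mo_kD x y : x \in mo_k K -> y \in mo_k K ->
  x + y \in mo_k K.
Proof. by move=> kx ky; rewrite -[y]opprK mo_kB ?mo_kN. Qed.

Fact mo_kM x y : x \in mo_k K -> y \in mo_k K ->
  x * y \in mo_k K.
Proof.
move=> kx ky; case: kC => k1 _ kdiv; rewrite -[y]invrK.
by apply: (kdiv) => //; rewrite -div1r; apply: kdiv.
Qed.

Fact mo_kder x : x \in mo_k K -> der x \in mo_k K.
Proof. by case: (mo_lift K) => _ + _ _ _; apply. Qed.

Definition kGc_of : Lc_structure :=
  @LcStructure mo_ktype (vgroup K)
    (exist _ 0 mo_k0) (exist _ 1 mo_k1)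
    (fun x y => exist _ (sval x + sval y) (mo_kD (svalP x) (svalP y)))
    (fun x => exist _ (- sval x) (mo_kN (svalP x)))
    (fun x y => exist _ (sval x * sval y) (mo_kM (svalP x) (svalP y)))
    (fun x => exist _ (der (sval x)) (mo_kder (svalP x)))
    0 +%R -%R <=%R
    (fun g => exist _ (mo_c g) (mo_c_in g)).

End LiftStructure.

(* A theory is axiomatized by a list of axioms when its models are exactly
   the structures satisfying these axioms; [C] is the class of the latter. *)
Definition axiomatized_by (T : L2_theory) (C : L2_structure -> Prop) : Prop :=
  forall M : L2_structure, L2_models M T <-> C M.

(* Main.v *)
(* By Los's theorem and the axioms being first order, everything reduces to an
   Ax-Kochen-Ershov principle: two d-henselian models with elementarily
   equivalent (k, Gamma; c) are elementarily equivalent.  Passing to countable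
   ultrapowers, both models are aleph_1-saturated, and one plays a back-and-forth
   with countable differential subfields that are closed under taking leading
   terms u s(g), with u in k, and whose (k, Gamma)-part is partially elementary.
   To add an element, take a countable elementary submodel F of the first model
   containing it, extend the partial elementary map to the lift and value group
   of F by saturation, and then embed F.  For the last step the isomorphism
   extends to the field generated by the lift and the cross-section, where a sum
   of terms is compared through its leading coefficients; what remains is an
   immediate extension, and it is exhausted by adjoining pseudolimits one at a
   time.  If all differential polynomials over the base are stable near the
   pseudolimit, any pseudolimit in the target works; otherwise an unstable one of
   minimal complexity has, in both fields, a zero pseudolimit by d-henselianity. *)

(* Monotonicity enters twice. The whole jet of an element lies in the same ball as the element, so
   stability of differential polynomials is a matter of ordinary ultrametric estimates. And g'/g
   lies in the valuation ring, so the substitution of g u for y stays integral and d-henselianity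
   applies at every scale. Characteristic 0 lets each nonlinear monomial be seen in a partial
   derivative.

   Closure under leading terms is imposed because, when leading coefficients of a sum cancel,
   absorbing a term changes the other coefficients by ratios of leading terms, which must again
   belong to the base field. Stability is phrased with centres and radii from the base field, shared
   by both sides, so one minimal polynomial serves for both. Partial isomorphisms are relations,
   that is, subfields of a product: unions of chains and inverse maps need no transport of domains,
   and functionality and injectivity both follow from the correspondence of leading terms. The value
   group has no relation of its own in the game; it is read through s. *)
From HB Require Import structures.
From mathcomp Require Import all_boot all_order all_algebra.
From mathcomp Require Import ring_quotient mpoly.
From mathcomp Require Import boolp classical_sets filter.
From mathcomp Require Import ring.
Require Import Defs.

Set Implicit Arguments.
Unset Strict Implicit.
Unset Printing Implicit Defensive.

Import Order.TTheory GRing.Theory.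
Local Open Scope ring_scope.

(** * The dominance relation of a valuation *)

(* [dom x y] and [sdom x y] are the relations x ≼ y and x ≺ y, that is
   v(x) >= v(y) and v(x) > v(y) with v(0) = oo; [sdom (x - y) y] is x ~ y. *)
Section Dominance.
Variable V : valDiffField.
Implicit Types x y z t : V.

Definition dom x y := (x == 0) || ((y != 0) && (val0 y <= val0 x)).
Definition sdom x y := ~~ dom y x.

Lemma og_leDr (g h k : vgroup V) : (g + k <= h + k) = (g <= h).
Proof.
apply/idP/idP; last exact: og_leD.
by move=> /(og_leD (- k)); rewrite !addrK.
Qed.

Lemma og_nleE (g h : vgroup V) : (~~ (g <= h)) = (h < g).
Proof.
rewrite lt_neqAle; case: (boolP (g <= h)) => gh /=.
  by case: (boolP (h <= g)) => hg; rewrite ?andbF // andbT eq_le hg gh.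
have := og_total g h; rewrite (negPf gh) /= => hg; rewrite hg andbT.
by apply/esym; apply: contraNneq gh => ->.
Qed.

Lemma dom_refl x : dom x x.
Proof. by rewrite /dom lexx andbT orbN. Qed.

Lemma dom0 y : dom 0 y.
Proof. by rewrite /dom eqxx. Qed.

Lemma domx0 x : dom x 0 = (x == 0).
Proof. by rewrite /dom eqxx orbF. Qed.

Lemma dom_neq0 x y : x != 0 -> dom x y -> y != 0.
Proof. by move=> x0; rewrite /dom (negPf x0) /= => /andP[]. Qed.

Lemma domE x y : x != 0 -> y != 0 -> dom x y = (val0 y <= val0 x).
Proof. by move=> x0 y0; rewrite /dom (negPf x0) y0. Qed.

Lemma sdomE x y : x != 0 -> y != 0 -> sdom x y = (val0 y < val0 x).
Proof. by move=> x0 y0; rewrite /sdom domE // og_nleE. Qed.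

Lemma dom_total x y : dom x y || dom y x.
Proof.
have [->|x0] := eqVneq x 0; first by rewrite dom0.
have [->|y0] := eqVneq y 0; first by rewrite dom0 orbT.
by rewrite !domE // og_total.
Qed.

Lemma sdomW x y : sdom x y -> dom x y.
Proof. by rewrite /sdom; have := dom_total x y; case: (dom y x); rewrite ?orbF. Qed.

Lemma sdomx0 x : sdom x 0 = false.
Proof. by rewrite /sdom dom0. Qed.

Lemma sdom0 y : sdom 0 y = (y != 0).
Proof. by rewrite /sdom domx0. Qed.

Lemma sdom_neq0 x y : sdom x y -> y != 0.
Proof. by apply: contraTneq => ->; rewrite sdomx0. Qed.

Lemma sdomxx x : sdom x x = false.
Proof. by rewrite /sdom dom_refl. Qed.

Lemma dom_trans y x z : dom x y -> dom y z -> dom x z.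
Proof.
have [->|x0] := eqVneq x 0; first by move=> *; rewrite dom0.
move=> xy yz; have y0 := dom_neq0 x0 xy; have z0 := dom_neq0 y0 yz.
move: xy yz; rewrite (domE x0 y0) (domE y0 z0) (domE x0 z0) => yx zy.
exact: le_trans zy yx.
Qed.

Lemma sdom_dom_trans y x z : sdom x y -> dom y z -> sdom x z.
Proof. by rewrite /sdom => + yz; apply: contra => zx; exact: dom_trans yz zx. Qed.

Lemma dom_sdom_trans y x z : dom x y -> sdom y z -> sdom x z.
Proof. by rewrite /sdom => xy; apply: contra => zx; exact: dom_trans zx xy. Qed.

Lemma sdom_trans y x z : sdom x y -> sdom y z -> sdom x z.
Proof. by move=> /sdomW xy; exact: dom_sdom_trans. Qed.

Lemma domNl x y : dom (- x) y = dom x y.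
Proof. by rewrite /dom oppr_eq0 val0N. Qed.

Lemma domNr x y : dom x (- y) = dom x y.
Proof. by rewrite /dom oppr_eq0 val0N. Qed.

Lemma sdomNl x y : sdom (- x) y = sdom x y.
Proof. by rewrite /sdom domNr. Qed.

Lemma domBC x y z : dom (x - y) z = dom (y - x) z.
Proof. by rewrite -domNl opprB. Qed.

Lemma domD x y z : dom x z -> dom y z -> dom (x + y) z.
Proof.
have [->|x0] := eqVneq x 0; first by rewrite add0r.
have [->|y0] := eqVneq y 0; first by rewrite addr0.
have [->|xy0] := eqVneq (x + y) 0; first by rewrite dom0.
move=> xz yz; have z0 := dom_neq0 x0 xz; move: xz yz; rewrite !domE // => xz yz.
by apply: le_trans (val0D x0 y0 xy0); rewrite minElt; case: ifP.
Qed.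

Lemma domB x y z : dom x z -> dom y z -> dom (x - y) z.
Proof. by move=> xz yz; rewrite domD // domNl. Qed.

Lemma sdomD x y z : sdom x z -> sdom y z -> sdom (x + y) z.
Proof.
move=> xz yz; case/orP: (dom_total x y) => xy.
  by apply: dom_sdom_trans yz; apply: domD => //; apply: dom_refl.
by apply: dom_sdom_trans xz; apply: domD => //; apply: dom_refl.
Qed.

Lemma sdomB x y z : sdom x z -> sdom y z -> sdom (x - y) z.
Proof. by move=> xz yz; rewrite sdomD // sdomNl. Qed.

Lemma sdom_sum (I : Type) (r : seq I) (P : pred I) (F : I -> V) z :
  z != 0 -> (forall i, P i -> sdom (F i) z) -> sdom (\sum_(i <- r | P i) F i) z.
Proof.
move=> z0 h; elim/big_rec: _ => [|i x Pi xz]; first by rewrite sdom0.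
by apply: sdomD => //; apply: h.
Qed.

Lemma dom_sum (I : Type) (r : seq I) (P : pred I) (F : I -> V) z :
  (forall i, P i -> dom (F i) z) -> dom (\sum_(i <- r | P i) F i) z.
Proof.
move=> h; elim/big_rec: _ => [|i x Pi xz]; first by rewrite dom0.
by apply: domD => //; apply: h.
Qed.

Lemma domMr z x y : z != 0 -> dom (x * z) (y * z) = dom x y.
Proof.
move=> z0; rewrite /dom !mulf_eq0 (negPf z0) !orbF.
have [//|x0] := eqVneq x 0; have [//|y0] := eqVneq y 0.
by rewrite !val0M // og_leDr.
Qed.

Lemma domMl z x y : z != 0 -> dom (z * x) (z * y) = dom x y.
Proof. by move=> z0; rewrite ![z * _]mulrC domMr. Qed.

Lemma sdomMr z x y : z != 0 -> sdom (x * z) (y * z) = sdom x y.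
Proof. by move=> z0; rewrite /sdom domMr. Qed.

Lemma sdomMl z x y : z != 0 -> sdom (z * x) (z * y) = sdom x y.
Proof. by move=> z0; rewrite /sdom domMl. Qed.

Lemma domM x y x' y' : dom x y -> dom x' y' -> dom (x * x') (y * y').
Proof.
have [->|x0] := eqVneq x 0; first by move=> *; rewrite mul0r dom0.
have [->|x0'] := eqVneq x' 0; first by move=> *; rewrite mulr0 dom0.
move=> xy xy'; have y0 := dom_neq0 x0 xy.
apply: (@dom_trans (y * x')); first by rewrite domMr.
by rewrite domMl.
Qed.

Lemma sdomM x y x' y' : sdom x y -> dom x' y' -> y' != 0 -> sdom (x * x') (y * y').
Proof.
move=> xy xy' y0'; have y0 := sdom_neq0 xy.
apply: (@dom_sdom_trans (x * y')); last by rewrite sdomMr.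
by apply: domM => //; apply: dom_refl.
Qed.

Lemma domX n x y : dom x y -> dom (x ^+ n) (y ^+ n).
Proof.
move=> xy; elim: n => [|n IH]; first by rewrite dom_refl.
by rewrite !exprS; apply: domM.
Qed.

Lemma dom1E x : dom x 1 = (x \in @vring_pred V).
Proof. by rewrite /dom oner_eq0 val01. Qed.

Lemma sdom_sub x y : sdom (x - y) y -> dom x y /\ dom y x.
Proof.
move=> h; have xy : dom x y.
  by rewrite -[x](subrK y); apply: domD (dom_refl _); apply: sdomW.
split=> //; apply/negPn/negP => yx.
have : sdom (x - (x - y)) y by apply: sdomB.
by rewrite opprB addrC subrK sdomxx.
Qed.

(** Nothing is strictly dominated by 0, so [sdom (x - y) y] already carries y != 0. With the lemmas
    below it is an equivalence relation on nonzero elements: equality of leading terms. *)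
Lemma sim_neq0 x y : sdom (x - y) y -> x != 0.
Proof.
by move=> h; apply: contraTneq h => ->; rewrite sub0r sdomNl sdomxx.
Qed.

Lemma sim_refl x : x != 0 -> sdom (x - x) x.
Proof. by move=> x0; rewrite subrr sdom0. Qed.

Lemma sim_sym x y : sdom (x - y) y -> sdom (y - x) x.
Proof.
by move=> h; rewrite -sdomNl opprB; apply: sdom_dom_trans h (sdom_sub h).2.
Qed.

Lemma sim_trans y x z : sdom (x - y) y -> sdom (y - z) z -> sdom (x - z) z.
Proof.
move=> xy yz; rewrite -[x - z](subrKA y); apply: sdomD => //.
exact: sdom_dom_trans xy (sdom_sub yz).1.
Qed.

Lemma sim_mul x y x' y' : sdom (x - y) y -> sdom (x' - y') y' ->
  sdom (x * x' - y * y') (y * y').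
Proof.
move=> xy xy'; have y0 := sdom_neq0 xy; have y0' := sdom_neq0 xy'.
apply: (@sim_trans (y * x')).
  by rewrite -mulrBl sdomMr // (sim_neq0 xy').
by rewrite -mulrBr sdomMl.
Qed.

Lemma sim_inv x y : sdom (x - y) y -> sdom (x^-1 - y^-1) y^-1.
Proof.
move=> xy; have y0 := sdom_neq0 xy; have x0 := sim_neq0 xy.
rewrite -(sdomMr _ _ (mulf_neq0 x0 y0)) mulrBl mulKf // [x * y]mulrC mulKf //.
exact: sim_sym.
Qed.

Hypothesis mono : monotone V.

Lemma der0 : der (0 : V) = 0.
Proof. by have := derD (0 : V) 0; rewrite addr0 -[LHS]addr0 => /addrI. Qed.

Lemma der1 : der (1 : V) = 0.
Proof.
have := derM (1 : V) 1; rewrite mulr1 mul1r -[LHS]addr0 mulr1.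
by move/addrI.
Qed.

Lemma derV x : x != 0 -> der x^-1 = - der x / x ^+ 2.
Proof.
move=> x0; have := derM x x^-1; rewrite divff // der1 => /esym/eqP.
rewrite addrC addr_eq0 => /eqP h.
by apply: (mulfI x0); rewrite h expr2 invfM mulNr mulrN [der x * (_ * _)]mulrA mulrCA divff // mulr1.
Qed.

Lemma der_div x y : y != 0 ->
  der (x / y) = der x * y^-1 + x * (-1 * (der y * (y^-1 * y^-1))).
Proof. by move=> y0; rewrite derM derV // expr2 invfM mulN1r mulNr. Qed.

Lemma dom_der x : dom (der x) x.
Proof.
have [->|dx] := eqVneq (der x) 0; first by rewrite dom0.
have x0 : x != 0 by apply: contraNneq dx => ->; rewrite der0.
by rewrite domE // mono.
Qed.

Lemma iterderD i x y : iter i (@der V) (x + y) = iter i (@der V) x + iter i (@der V) y.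
Proof. by elim: i => //= i ->; rewrite derD. Qed.

Lemma dom_iterder i x : dom (iter i (@der V) x) x.
Proof.
elim: i => [|i IH]; first exact: dom_refl.
by rewrite iterS; apply: dom_trans IH; apply: dom_der.
Qed.

End Dominance.

HB.instance Definition _ (V : valDiffField) :=
  GRing.RMorphism.copy (@res V) \pi_({ideal_quot (@vmax V)})%qT.

HB.instance Definition _ (V : valDiffField) :=
  GRing.RMorphism.copy (@vr_val V) (\val : {rmorphism vring V -> V}).

Lemma res_eq0 (V : valDiffField) (x : vring V) : (res x == 0) = sdom (val x) 1.
Proof.
rewrite -(rmorph0 \pi_({ideal_quot (@vmax V)})%qT) -ring_quotient.Quotient.idealrBE subr0.
rewrite /sdom /dom oner_eq0 /= val01 unfold_in /vmax /=.
by rewrite negb_and negbK og_nleE.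
Qed.

(** * Leading terms in models of Mo(l, s, c) *)

Section MoModel.
Variable K : Mo_model.
Implicit Types x y z : K.

Lemma mo_kV x : x \in mo_k K -> x^-1 \in mo_k K.
Proof.
by case: (mo_lift K) => -[k1 _ kd] _ _ _ _ kx; rewrite -div1r; apply: kd.
Qed.

Lemma mo_kdiv x y : x \in mo_k K -> y \in mo_k K -> x / y \in mo_k K.
Proof. by move=> kx ky; rewrite mo_kM // mo_kV. Qed.

Lemma mo_k_dom1 x : x \in mo_k K -> dom x 1.
Proof. by case: (mo_lift K) => _ _ h _ _ /h; rewrite dom1E. Qed.

(** As [mo_k] is a field inside the valuation ring, its nonzero elements are units: apply the bound
    to the inverse. *)
Lemma mo_k_1dom x : x \in mo_k K -> x != 0 -> dom 1 x.
Proof.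
move=> kx x0; have := mo_k_dom1 (mo_kV kx).
by rewrite -(domMr _ _ x0) mulVf // mul1r.
Qed.

Lemma mo_k_val0 x : x \in mo_k K -> val0 x = 0.
Proof.
have [->|x0] := eqVneq x 0; first by rewrite val00.
move=> kx; have := mo_k_dom1 kx; have := mo_k_1dom kx x0.
rewrite !domE ?oner_eq0 // val01 => h1 h2.
by apply/eqP; rewrite eq_le h1 h2.
Qed.

Lemma mo_k_sdom x y : x \in mo_k K -> y \in mo_k K -> sdom (x - y) 1 -> x = y.
Proof.
move=> kx ky h; apply/eqP; rewrite -subr_eq0; apply: contraTT h => xy0.
by rewrite /sdom negbK mo_k_1dom // mo_kB.
Qed.

Lemma mo_s0 : mo_s (0 : vgroup K) = 1.
Proof.
have := mo_sD (0 : vgroup K) 0; rewrite addr0 -{1}[mo_s 0]mulr1.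
by move/(mulfI (mo_s_neq0 0)) => <-.
Qed.

Lemma mo_sN (g : vgroup K) : mo_s (- g) = (mo_s g)^-1.
Proof.
by apply: (mulfI (mo_s_neq0 g)); rewrite -mo_sD subrr mo_s0 divff // mo_s_neq0.
Qed.

Lemma mo_ders (g : vgroup K) : der (mo_s g) = mo_c g * mo_s g.
Proof. by rewrite mo_cE divfK // mo_s_neq0. Qed.

Lemma asymp_s x : x != 0 -> dom x (mo_s (val0 x)) /\ dom (mo_s (val0 x)) x.
Proof. by move=> x0; rewrite !domE ?mo_s_neq0 // mo_sK. Qed.

(** The quotient of x by the cross-section of its value is a unit of the valuation ring, and u
    represents its residue in the lift. *)
Lemma leading_coef x : x != 0 ->
  exists2 u, u \in mo_k K & u != 0 /\ sdom (x - u * mo_s (val0 x)) x.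
Proof.
move=> x0; have [xs sx] := asymp_s x0; have s0 := mo_s_neq0 (val0 x).
have yO : x / mo_s (val0 x) \in @vring_pred K.
  by rewrite -dom1E -(domMr _ _ s0) divfK // mul1r.
have [_ _ _ _ /(_ (res (VRing yO)))[u ku /eqP]] := mo_lift K.
rewrite -subr_eq0 -rmorphB /= => h.
have {h}: sdom (val u - x / mo_s (val0 x)) 1.
  by have := res_eq0 (u - VRing yO); rewrite /res h => /esym.
rewrite -(sdomMr _ _ s0) mulrBl divfK // mul1r => h.
have h2 : sdom (x - val u * mo_s (val0 x)) x.
  by rewrite -sdomNl opprB; apply: sdom_dom_trans h sx.
exists (val u) => //; split=> //; apply: contraTneq h2 => ->.
by rewrite mul0r subr0 sdomxx.
Qed.

(** Integers lie in the lift, and the characteristic is 0; so the positive integer factors that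
    differentiation puts on monomials do not change valuations. *)
Lemma dom_nat n : dom (n%:R : K) 1 /\ dom (1 : K) n.+1%:R.
Proof.
have kn m : (m%:R : K) \in mo_k K.
  elim: m => [|m IH]; first exact: mo_k0.
  by rewrite -natr1 mo_kD // mo_k1.
split; first exact: mo_k_dom1.
by apply: mo_k_1dom => //; rewrite (iffLR (pcharf0P _) (@df_char0 K)).
Qed.

End MoModel.

(** * Translates of multivariate polynomials *)

Section MPolyRing.
Variables (n : nat) (R : comNzRingType).
Implicit Types P Q : {mpoly R[n]}.

(** Identities between ring morphisms or derivations on polynomials need only be checked on
    constants and variables. *)
Lemma mpoly_ring_ind (A : {mpoly R[n]} -> Prop) :
  (forall c, A c%:MP) -> (forall i, A 'X_i) ->
  (forall P Q, A P -> A Q -> A (P + Q)) ->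
  (forall P Q, A P -> A Q -> A (P * Q)) -> forall P, A P.
Proof.
move=> AC AX AD AM; elim/mpolyind => [|c m P _ _ AP].
  by have := AC 0; rewrite mpolyC0.
apply: AD => //; rewrite -mul_mpolyC; apply: (AM) => //.
have A1 : A 1 by have := AC 1; rewrite mpolyC1.
rewrite mpolyXE_id; apply: (big_ind A) => [|P1 P2|i _] //; first exact: AM.
elim: (m i) => [|k IH]; first by rewrite expr0.
by rewrite exprS; apply: AM.
Qed.

(** The Taylor expansion of P at y: its constant term is P(y), and taking it commutes with partial
    derivatives. *)
Definition mshift (y : 'I_n -> R) P : {mpoly R[n]} :=
  mmap (@mpolyC n R) (fun i => 'X_i + (y i)%:MP) P.

HB.instance Definition _ y := GRing.RMorphism.copy (mshift y)
  (mmap (@mpolyC n R) (fun i => 'X_i + (y i)%:MP)).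

Lemma mshiftC y c : mshift y c%:MP = c%:MP.
Proof. exact: mmapC. Qed.

Lemma mshiftX y i : mshift y 'X_i = 'X_i + (y i)%:MP.
Proof. by rewrite /mshift mmapX mmap1U. Qed.

Lemma mshift_mshift x y P : mshift y (mshift x P) = mshift (fun i => x i + y i) P.
Proof.
elim/mpoly_ring_ind: P => [c|i|P Q hP hQ|P Q hP hQ].
- by rewrite !mshiftC.
- by rewrite !mshiftX rmorphD /= mshiftX mshiftC -addrA -mpolyCD [y i + _]addrC.
- by rewrite !rmorphD /= hP hQ.
- by rewrite !rmorphM /= hP hQ.
Qed.

Lemma mcoeff0_mshift y P : (mshift y P)@_0 = P.@[y].
Proof.
elim/mpoly_ring_ind: P => [c|i|P Q hP hQ|P Q hP hQ].
- by rewrite mshiftC mcoeffC eqxx mulr1 mevalC.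
- by rewrite mshiftX mevalXU mcoeffD mcoeffC eqxx mulr1 mcoeffX mnm1_eq0 add0r.
- by rewrite rmorphD /= mcoeffD hP hQ mevalD.
- by rewrite rmorphM /= rmorphM /= hP hQ mevalM.
Qed.

Lemma mderiv_mshift y i P : (mshift y P)^`M(i) = mshift y P^`M(i).
Proof.
elim/mpoly_ring_ind: P => [c|j|P Q hP hQ|P Q hP hQ].
- by rewrite mshiftC !mderivC rmorph0.
- rewrite mshiftX mderivD mderivC addr0 !mderivX mnm1E.
  case: eqP => [->|_]; last by rewrite !scale0r rmorph0.
  have -> : (U_(i) - U_(i) = 0)%MM by apply/mnmP => l; rewrite mnmBE subnn mnm0E.
  by rewrite mpolyX0 !scale1r rmorph1.
- by rewrite rmorphD /= !mderivD hP hQ rmorphD.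
- by rewrite rmorphM /= !mderivM hP hQ rmorphD /= !rmorphM.
Qed.

End MPolyRing.

Lemma map_mpoly_mshift n (R S : comNzRingType) (f : {rmorphism R -> S}) y
    (P : {mpoly R[n]}) :
  map_mpoly f (mshift y P) = mshift (fun i => f (y i)) (map_mpoly f P).
Proof.
elim/mpoly_ring_ind: P => [c|i|P Q hP hQ|P Q hP hQ].
- by rewrite mshiftC !map_mpolyC mshiftC.
- by rewrite mshiftX rmorphD /= map_mpolyC !map_mpolyX mshiftX.
- by rewrite !rmorphD /= hP hQ.
- by rewrite !rmorphM /= hP hQ.
Qed.

Lemma mderiv_map_mpoly n (R S : comNzRingType) (f : {rmorphism R -> S}) i
    (P : {mpoly R[n]}) :
  (map_mpoly f P)^`M(i) = map_mpoly f P^`M(i).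
Proof.
by apply/mpolyP => m; rewrite mcoeff_deriv !mcoeff_map_mpoly mcoeff_deriv raddfMn.
Qed.

Lemma mwiden_mshift n (R : comNzRingType) (y : 'I_n.+1 -> R) (P : {mpoly R[n]}) :
  mshift y (mwiden P) = mwiden (mshift (fun i => y (widen_ord (leqnSn n) i)) P).
Proof.
elim/mpoly_ring_ind: P => [c|i|P Q hP hQ|P Q hP hQ].
- by rewrite mshiftC !mwidenC mshiftC.
- by rewrite mshiftX mwidenD mwidenC !mwidenX mnmwiden1 mshiftX.
- by rewrite !(mwidenD, rmorphD) /= ?mwidenD hP hQ.
- by rewrite !(mwidenM, rmorphM) /= ?mwidenM hP hQ.
Qed.

(* [Stab g Q]: on the ball v(y) >= v(g), the constant term of Q strictly
   dominates all other monomials of Q. *)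
Section Stability.
Variables (V : valDiffField) (n : nat).
Implicit Types (P Q : {mpoly V[n]}) (g h : V) (y : 'I_n -> V).

Definition Bd g h Q := forall m, dom (Q@_m * g ^+ mdeg m) h.
Definition sBd g h Q := forall m, sdom (Q@_m * g ^+ mdeg m) h.
Definition Stab g Q :=
  Q@_0 != 0 /\ forall m, m != 0%MM -> sdom (Q@_m * g ^+ mdeg m) Q@_0.

(** [Bd g h Q] bounds the Gauss norm of Q on the polydisc of radius v(g), and Gauss norms are
    submultiplicative. *)
Lemma Bd_mul g h h' P Q : Bd g h P -> Bd g h' Q -> Bd g (h * h') (P * Q).
Proof.
move=> bP bQ m; rewrite mcoeffM mulr_suml; apply: dom_sum => k /eqP mE.
have -> : g ^+ mdeg m = g ^+ mdeg k.1 * g ^+ mdeg k.2 by rewrite -exprD -mdegD -mE.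
by rewrite mulrACA; apply: domM.
Qed.

Lemma Bd_mshiftX g y m : (forall i, dom (y i) g) ->
  Bd g (g ^+ mdeg m) (mshift y 'X_[m]).
Proof.
move=> yg; rewrite mpolyXE_id rmorph_prod /= mdegE -prodrXr.
pose A h P := Bd g h P.
have A1 : A 1 1.
  by move=> k; rewrite mcoeff1; case: eqP => [->|_];
    rewrite ?mdeg0 ?mul0r ?mul1r ?dom0 ?dom_refl.
apply: (big_ind2 (fun P h => A h P)) => // [*|i _]; first exact: Bd_mul.
rewrite rmorphXn /= mshiftX; elim: (m i) => [|k IH]; first exact: A1.
rewrite !exprS; apply: Bd_mul => // l.
rewrite mcoeffD mcoeffC mcoeffX; have [->|l0] := eqVneq l 0%MM.
  by rewrite mnm1_eq0 mdeg0 expr0 !mulr1 add0r.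
rewrite mulr0 addr0; case: eqP => [<-|_]; last by rewrite mul0r dom0.
by rewrite mdeg1 expr1 mul1r dom_refl.
Qed.

(** Translating within the polydisc does not increase the Gauss norm, since this is so for each
    monomial. *)
Lemma sBd_mshift g h y Q : h != 0 -> (forall i, dom (y i) g) ->
  sBd g h Q -> sBd g h (mshift y Q).
Proof.
move=> h0 yg bQ m; rewrite [in mshift _ _](mpolyE Q) rmorph_sum /= raddf_sum /= mulr_suml.
apply: sdom_sum => // k _; rewrite -mul_mpolyC rmorphM /= mshiftC mcoeffCM -mulrA.
apply: dom_sdom_trans (bQ k); apply: domM (dom_refl _) _.
exact: Bd_mshiftX.
Qed.

Lemma Stab_sBd g Q : Stab g Q <-> Q@_0 != 0 /\ sBd g Q@_0 (Q - (Q@_0)%:MP).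
Proof.
split=> -[Q0 h]; split=> // m.
  rewrite mcoeffB mcoeffC; have [->|m0] := eqVneq m 0%MM.
    by rewrite mulr1 subrr mul0r sdom0.
  by rewrite mulr0 subr0; apply: h.
by move=> m0; have := h m; rewrite mcoeffB mcoeffC (negPf m0) mulr0 subr0.
Qed.

(** Applied to the part without constant term, [sBd_mshift] shows that a translation within the ball
    moves the constant term by a strictly smaller amount. Hence stability belongs to the ball and
    not to its centre. *)
Lemma Stab_mshift g y Q : (forall i, dom (y i) g) -> Stab g Q ->
  Stab g (mshift y Q) /\ sdom ((mshift y Q)@_0 - Q@_0) Q@_0.
Proof.
move=> yg /Stab_sBd[Q0 bQ].
have := sBd_mshift Q0 yg bQ; rewrite raddfB /= mshiftC => b.
have s0 : sdom ((mshift y Q)@_0 - Q@_0) Q@_0.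
  by have := b 0%MM; rewrite mcoeffB mcoeffC eqxx mdeg0 expr0 !mulr1.
split=> //; split; first exact: sim_neq0 s0.
move=> m m0; apply: sdom_dom_trans (sdom_sub s0).2.
by have := b m; rewrite mcoeffB mcoeffC (negPf m0) mulr0 subr0.
Qed.

End Stability.

(** * Zeros of differential polynomials near a pseudolimit *)

Definition jet (A : Type) (D : A -> A) n (x : A) : 'I_n -> A := fun j => iter j D x.

Section CompMpoly.
Variables (n k : nat) (R S : comNzRingType) (f : {rmorphism R -> S}).
Variable W : 'I_n -> {mpoly R[k]}.

Lemma map_mpoly_mmap (Q : {mpoly R[n]}) :
  map_mpoly f (mmap (@mpolyC k R) W Q) =
  mmap (@mpolyC k S) (fun i => map_mpoly f (W i)) (map_mpoly f Q).
Proof.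
elim/mpoly_ring_ind: Q => [c|i|P Q hP hQ|P Q hP hQ].
- by rewrite mmapC !map_mpolyC mmapC.
- by rewrite map_mpolyX !mmapX !mmap1U.
- by rewrite !rmorphD /= hP hQ.
- by rewrite !rmorphM /= hP hQ.
Qed.

Lemma meval_mmap (v : 'I_k -> R) (Q : {mpoly R[n]}) :
  (mmap (@mpolyC k R) W Q).@[v] = Q.@[fun i => (W i).@[v]].
Proof.
elim/mpoly_ring_ind: Q => [c|i|P Q hP hQ|P Q hP hQ].
- by rewrite mmapC !mevalC.
- by rewrite mmapX mmap1U mevalXU.
- by rewrite rmorphD /= !mevalD hP hQ.
- by rewrite rmorphM /= !mevalM hP hQ.
Qed.

End CompMpoly.

Lemma meval_mshift n (R : comNzRingType) (x y : 'I_n -> R) (P : {mpoly R[n]}) :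
  (mshift x P).@[y] = P.@[fun i => x i + y i].
Proof. by rewrite -!mcoeff0_mshift mshift_mshift. Qed.

Lemma meval_scale_var n (R : comNzRingType) (g c : R) (x : 'I_n -> R)
    (H Q : {mpoly R[n]}) :
  (forall m, Q@_m = H@_m * g ^+ mdeg m * c) ->
  Q.@[x] = H.@[fun i => g * x i] * c.
Proof.
move=> QE; pose k := maxn (msize H) (msize Q).
rewrite (mpolywE (k := k) (p := Q)) ?leq_maxr // (mpolywE (k := k) (p := H)) ?leq_maxl //.
rewrite !raddf_sum /= mulr_suml; apply: eq_bigr => m _.
rewrite !mevalZ !mevalX QE -!mulrA; congr (_ * _); rewrite [c * _]mulrC mulrA.
congr (_ * _); rewrite mdegE -prodrXr -big_split /=.
by apply: eq_bigr => i _; rewrite exprMn.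
Qed.

Lemma dom_max (V : valDiffField) (I : eqType) (s : seq I) (f : I -> V) i :
  i \in s -> exists2 j, j \in s & forall k, k \in s -> dom (f k) (f j).
Proof.
elim: s i => // j s IH i _; case: s IH => [_|j' s IH].
  by exists j; rewrite ?mem_head // => k; rewrite inE => /eqP ->; apply: dom_refl.
have [l ls lmax] := IH j' (mem_head _ _).
case/orP: (dom_total (f l) (f j)) => h.
  exists j; rewrite ?mem_head // => k; rewrite inE => /orP[/eqP->|/lmax kl].
    exact: dom_refl.
  exact: dom_trans kl h.
exists l; first by rewrite inE ls orbT.
by move=> k; rewrite inE => /orP[/eqP->|/lmax].
Qed.

(** * d-henselianity at an arbitrary scale *)

Section DHensel.
Variables (L : Mo_model) (hL : d_henselian L).

(** The operator g^-1 d^i g is monic of order i, and its coefficients are integral because g'/g is,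
    by monotonicity. Substituting g u for y therefore stays inside O{Y} and is triangular in the
    jet. *)
Lemma iter_derM (g : L) i : g != 0 ->
  exists w : nat -> L, [/\ forall j, dom (w j) 1, w i = 1,
    forall j, (i < j)%N -> w j = 0 &
    forall u, iter i (@der L) (g * u) = g * \sum_(j < i.+1) w j * iter j (@der L) u].
Proof.
move=> g0; elim: i => [|i [w [wO w1 w0 wE]]].
  exists (fun j => (j == 0%N)%:R); split=> // [j|[]//|v].
    by case: eqP => _; rewrite ?dom0 ?dom_refl.
  by rewrite big_ord1 mul1r.
(* Differentiating g times the sum gives three contributions: g'/g from g, the derivative of [w j],
   and a shift in the order of the derivative of u. *)
pose w' j := der g / g * w j + der (w j) + (if j is j'.+1 then w j' else 0).
have mono := @mo_monotone L.
exists w'; split=> [j|||v].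
- apply: domD; last by case: j => [|j]; rewrite ?dom0.
  apply: domD; last by apply: dom_trans (wO j); apply: dom_der.
  rewrite -[1]mulr1; apply: domM => //.
  by rewrite -(domMr _ _ g0) divfK // mul1r dom_der.
- by rewrite /w' w0 // der0 mulr0 !add0r.
- by case=> // j; rewrite /w' ltnS => ij; rewrite !w0 // ?der0 ?mulr0 ?add0r // (ltn_trans ij).
- rewrite iterS wE derM.
  have derS (F : nat -> L) k : der (\sum_(j < k) F j) = \sum_(j < k) der (F j).
    by apply: (big_morph _ _ (der0 L)); apply: derD.
  rewrite (derS (fun j => w j * iter j (@der L) v)) /=.
  have -> : \sum_(j < i.+2) w' j * iter j (@der L) v =
    \sum_(j < i.+1) (der g / g * w j + der (w j)) * iter j (@der L) v
    + \sum_(j < i.+1) w j * iter j.+1 (@der L) v.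
    rewrite big_ord_recl [in X in _ = _ + X](eq_bigr
      (fun j : 'I_i.+1 => w j * iter j.+1 (@der L) v)) //.
    rewrite (eq_bigr (fun j : 'I_i.+1 =>
      (der g / g * w j.+1 + der (w j.+1)) * iter j.+1 (@der L) v
       + w j * iter j.+1 (@der L) v)); last by move=> j _; rewrite -mulrDl.
    rewrite big_split /= addrA; congr (_ + _).
    rewrite [in RHS]big_ord_recl /w' addr0; congr (_ + _).
    rewrite big_ord_recr /= (w0 i.+1) // der0 mulr0 addr0 mul0r addr0.
    by apply: eq_bigr.
  rewrite mulrDr [der g * _]mulr_sumr !mulr_sumr -!big_split /=.
  apply: eq_bigr => j _; rewrite derM.
  rewrite !(mulrDl, mulrDr) -!addrA; congr (_ + _).
  by rewrite !mulrA [g * der g]mulrC mulfK.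
Qed.

(* Substituting g u for y and dividing by the constant term of H gives a
   polynomial over O in the jet of u whose reduction has degree 1. *)
Lemma d_hensel_scaled n (H : {mpoly L[n.+1]}) (g : L) (j0 : 'I_n.+1) :
  g != 0 -> H@_0 != 0 ->
  (forall j, dom (H@_U_(j) * g) H@_0) -> dom H@_0 (H@_U_(j0) * g) ->
  (forall m, (1 < mdeg m)%N -> sdom (H@_m * g ^+ mdeg m) H@_0) ->
  exists2 y, dom y g & H.@[jet (@der L) y] = 0.
Proof.
move=> g0 H0 Hlin Hj0 Hhigh.
(* The coefficients of H after scaling by g, divided by the constant term so that the reduction has
   constant term 1. *)
pose q m := H@_m * g ^+ mdeg m * (H@_0)^-1.
have q_m m : q m * H@_0 = H@_m * g ^+ mdeg m by rewrite divfK.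
have qO m : q m \in @vring_pred L.
  rewrite -dom1E -(domMr _ _ H0) mul1r q_m.
  have [m2|] := ltnP 1 (mdeg m); first exact/sdomW/Hhigh.
  rewrite leq_eqVlt ltnS leqn0 mdeg_eq0 => /orP[/mdeg1P[j /eqP ->]|/eqP ->].
    by rewrite mdeg1 expr1.
  by rewrite mdeg0 mulr1 dom_refl.
pose qv m : vring L := VRing (qO m).
pose k := msize H.
pose Q : {mpoly (vring L)[n.+1]} := \sum_(m : 'X_{1..n.+1 < k}) qv m *: 'X_[m].
have QE m : Q@_m = qv m.
  have [mk|mk] := ltnP (mdeg m) k; first by rewrite (mcoeff_mpoly (fun m => qv m)).
  rewrite [LHS]memN_msupp_eq0.
    apply: val_inj; rewrite rmorph0 /= /q memN_msupp_eq0 ?mul0r //.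
    exact: msize_mdeg_ge.
  apply: msize_mdeg_ge; apply: leq_trans mk; apply: leq_trans (msize_sum _ _ _) _.
  apply/bigmax_leqP => m' _; apply: leq_trans (msizeZ_le _ _) _.
  by rewrite msizeX bmdeg.
pose PW (i : 'I_n.+1) (w : nat -> L) := [/\ forall j, dom (w j) 1, w i = 1,
  forall j, (i < j)%N -> w j = 0 &
  forall u, iter i (@der L) (g * u) = g * \sum_(j < i.+1) w j * iter j (@der L) u].
have [w wP] := boolp.choice (P := PW) (fun i => iter_derM i g0).
have wO i j : w i j \in @vring_pred L by case: (wP i) => h _ _ _; rewrite -dom1E.
(* The i-th derivative of g u, divided by g, as an integral linear form in the jet of u. *)
pose W i : {mpoly (vring L)[n.+1]} := \sum_(j < n.+1) VRing (wO i j) *: 'X_j.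
pose P := mmap (@mpolyC n.+1 (vring L)) W Q.
have resQ : map_mpoly (@res L) Q = 1 + \sum_j (res (qv U_(j)%MM))%:MP * 'X_j.
  apply/mpolyP => m; rewrite mcoeff_map_mpoly QE mcoeffD mcoeff1 raddf_sum /=.
  rewrite (eq_bigr (fun j => res (qv U_(j)%MM) * (U_(j)%MM == m)%:R)); last first.
    by move=> j _; rewrite mcoeffCM mcoeffX.
  have [->|m0] := eqVneq m 0%MM.
    rewrite big1 => [|j _]; last by rewrite mnm1_eq0 mulr0.
    rewrite addr0 -(rmorph1 (@res L)); congr (res _); apply: val_inj.
    by rewrite rmorph1 /= /q mdeg0 expr0 mulr1 divff.
  rewrite add0r; have [/mdeg1P[j /eqP jm]|m1] := boolP (mdeg m == 1%N).
    rewrite (bigD1 j) //= jm eqxx mulr1 big1 ?addr0 // => l lj.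
    by rewrite eq_mnm1 (negPf lj) mulr0.
  rewrite big1 => [|j _]; last first.
    by case: eqP => [jm|_]; rewrite ?mulr0 //; move: m1; rewrite -jm mdeg1.
  apply/eqP; rewrite res_eq0 /= -(sdomMr _ _ H0) q_m mul1r; apply: Hhigh.
  by rewrite ltn_neqAle eq_sym m1 lt0n mdeg_eq0.
have resP : map_mpoly (@res L) P =
    1 + \sum_j (res (qv U_(j)%MM)) *: \sum_(l < n.+1) res (VRing (wO j l)) *: 'X_l.
  rewrite /P map_mpoly_mmap resQ rmorphD rmorph1 /= rmorph_sum /=; congr (_ + _).
  apply: eq_bigr => j _; rewrite rmorphM /= mmapC mmapX mmap1U mul_mpolyC.
  congr (_ *: _); rewrite /W rmorph_sum /=; apply: eq_bigr => l _.
  by rewrite map_mpolyZ map_mpolyX.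
have coefP m : (map_mpoly (@res L) P)@_m = (m == 0%MM)%:R +
    \sum_j res (qv U_(j)%MM) * \sum_(l < n.+1) res (VRing (wO j l)) * (U_(l)%MM == m)%:R.
  rewrite resP mcoeffD mcoeff1 raddf_sum /=; congr (_ + _); apply: eq_bigr => j _.
  rewrite mcoeffZ raddf_sum /=; congr (_ * _); apply: eq_bigr => l _.
  by rewrite mcoeffZ mcoeffX.
(* The substitution [W] is unitriangular; so at the largest index l whose linear coefficient has
   nonzero residue, nothing else contributes to the coefficient of the l-th variable, and it
   survives reduction. *)
have [l ql lmax] : exists2 l, res (qv U_(l)%MM) != 0 &
    forall l' : 'I_n.+1, (l < l')%N -> res (qv U_(l')%MM) = 0.
  have q0 : res (qv U_(j0)%MM) != 0.
    rewrite res_eq0 /sdom negbK /= -(domMr _ _ H0) q_m mul1r mdeg1 expr1.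
    exact: Hj0.
  have [l ql lmax] := @arg_maxnP _ j0 (fun l : 'I_n.+1 => res (qv U_(l)%MM) != 0) (fun l : 'I_n.+1 => val l) q0.
  exists l => // l' ll'; apply/eqP/negPn/negP => /lmax /=.
  by rewrite leqNgt ll'.
have szP : msize (map_mpoly (@res L) P) = 2%N.
  apply/eqP; rewrite eqn_leq; apply/andP; split.
    rewrite msizeE; apply/bigmax_leqP_seq => m; rewrite mcoeff_msupp coefP => h _.
    rewrite ltnS leqNgt; apply: contraNN h => m2.
    have /negPf -> : m != 0%MM by rewrite -mdeg_eq0 -lt0n ltnW.
    rewrite add0r big1 // => j _; rewrite big1 ?mulr0 // => l' _.
    by case: eqP => [e|]; rewrite ?mulr0 //; move: m2; rewrite -e mdeg1.
  suff : U_(l)%MM \in msupp (map_mpoly (@res L) P) by move/msize_mdeg_lt; rewrite mdeg1.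
  rewrite mcoeff_msupp coefP mnm1_eq0 add0r (bigD1 l) //= [X in _ + X]big1; last first.
    move=> j jl; rewrite (bigD1 l) //= eqxx mulr1 [X in _ + X]big1; last first.
      by move=> l' l'l; rewrite eq_mnm1 (negPf l'l) mulr0.
    rewrite addr0; have [lj|jl'] := ltnP l j; first by rewrite lmax ?mul0r.
    have {}jl' : (j < l)%N by rewrite ltn_neqAle jl' andbT.
    have -> : VRing (wO j l) = 0.
      by apply: val_inj; rewrite rmorph0 /=; case: (wP j) => _ _ -> .
    by rewrite rmorph0 mulr0.
  rewrite addr0 (bigD1 l) //= eqxx mulr1 [X in _ + X]big1; last first.
    by move=> l' l'l; rewrite eq_mnm1 (negPf l'l) mulr0.
  have -> : VRing (wO l l) = 1.
    by apply: val_inj; rewrite rmorph1 /=; case: (wP l) => _ -> .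
  by rewrite rmorph1 addr0 mulr1.
have [u Pu] := hL szP.
exists (g * val u).
  rewrite -{2}[g]mulr1 domMl // dom1E; exact: valP.
move: Pu; rewrite /P map_mpoly_mmap meval_mmap.
rewrite (@meval_scale_var _ _ g (H@_0)^-1 _ H); last first.
  by move=> m; rewrite mcoeff_map_mpoly QE.
move/eqP; rewrite mulf_eq0 invr_eq0 (negPf H0) orbF => /eqP.
move=> <-; apply: meval_eq => i; rewrite /jet; case: (wP i) => _ _ w0 ->.
congr (_ * _); have -> : map_mpoly val (W i) = \sum_(j < n.+1) w i j *: 'X_j.
  by rewrite /W raddf_sum /=; apply: eq_bigr => j _; rewrite map_mpolyZ map_mpolyX.
rewrite raddf_sum /=.
rewrite (big_ord_widen n.+1 (fun j => w i j * iter j (@der L) (val u))) //.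
rewrite big_mkcond /=; apply: eq_bigr => j _.
rewrite mevalZ mevalXU.
by case: ifP => // /negbT; rewrite -leqNgt => ij; rewrite w0 ?mul0r.
Qed.

End DHensel.

(** * Stability near a pseudolimit *)

Section Pseudolimit.
Variables (L : Mo_model) (E : fieldType) (dE : E -> E) (f : {rmorphism E -> L}).
Hypothesis f_der : forall x, f (dE x) = der (f x).
Variable a : L.

Let mono := @mo_monotone L.

(** The element g of E records the valuation of a - f e inside E, so that it can be compared in two
    different extensions of E. *)
Definition near e g := dom (a - f e) (f g) /\ dom (f g) (a - f e).

Definition translate e n (P : {mpoly E[n]}) : {mpoly E[n]} := mshift (jet dE e) P.

(** The ball is the smallest one with centre f e containing a; on it P keeps the leading term that
    it has at e. *)
Definition stable n (P : {mpoly E[n]}) :=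
  exists e g, near e g /\ Stab (f g) (map_mpoly f (translate e P)).

Lemma f_jet n e (j : 'I_n) : f (jet dE e j) = jet (@der L) (f e) j.
Proof. by rewrite /jet; elim: (j : nat) => //= k <-; rewrite f_der. Qed.

Lemma jet_dom n (x g : L) (j : 'I_n) : dom x g -> dom (jet (@der L) x j) g.
Proof. by apply: dom_trans; apply: dom_iterder. Qed.

Lemma jetD n (x y : L) (j : 'I_n) :
  jet (@der L) x j + jet (@der L) y j = jet (@der L) (x + y) j.
Proof. by rewrite /jet iterderD. Qed.

Lemma translate_shift n (P : {mpoly E[n]}) e z :
  mshift (jet (@der L) z) (map_mpoly f P) =
  mshift (jet (@der L) (z - f e)) (map_mpoly f (translate e P)).
Proof.
rewrite map_mpoly_mshift mshift_mshift; congr (mshift _ _); apply/funext => j.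
by rewrite f_jet jetD addrC subrK.
Qed.

Lemma stab_at n (P : {mpoly E[n]}) e g z :
  Stab (f g) (map_mpoly f (translate e P)) -> dom (z - f e) (f g) ->
  Stab (f g) (mshift (jet (@der L) z) (map_mpoly f P)) /\
  sdom ((map_mpoly f P).@[jet (@der L) z] - f (P.@[jet dE e])) (f (P.@[jet dE e])).
Proof.
move=> st zg; rewrite (translate_shift P e).
have [] := Stab_mshift (y := jet (@der L) (z - f e)) _ st.
  by move=> j; apply: jet_dom.
by rewrite -translate_shift mcoeff0_mshift mcoeff_map_mpoly mcoeff0_mshift.
Qed.

(** Contrapositive of recentring: a stable expansion at a could be translated to the centre f e of
    the same ball. *)
Lemma unstable_at n (P : {mpoly E[n]}) e g : ~ stable P -> near e g ->
  ~ Stab (f g) (mshift (jet (@der L) a) (map_mpoly f P)).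
Proof.
move=> nst eg st; apply: nst; exists e, g; split; first exact: eg.
have -> : map_mpoly f (translate e P) =
    mshift (jet (@der L) (f e - a)) (mshift (jet (@der L) a) (map_mpoly f P)).
  rewrite mshift_mshift map_mpoly_mshift; congr (mshift _ _); apply/funext => j.
  by rewrite f_jet jetD addrC subrK.
apply: (Stab_mshift _ st).1 => j; apply: jet_dom.
by rewrite domBC; case: eg.
Qed.

(** With the next hypothesis: the values v(a - f e) come from E and have no maximum, so a is a
    pseudolimit of elements of E, none of which is closest to it. *)
Hypothesis near_ex : forall e, exists g, near e g.
Hypothesis nomax : forall e, exists e', sdom (a - f e') (a - f e).

Lemma sub_neq0 e : a - f e != 0.
Proof. by have [e' /sdom_neq0] := nomax e. Qed.

Lemma near_neq0 e g : near e g -> f g != 0.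
Proof. by case=> /(dom_neq0 (sub_neq0 e)). Qed.

(* The linear part of [P] at [a] dominates the higher terms, because a term of
   degree at least 2 survives in some partial derivative of [P]. *)
Lemma linear_dominates n (P : {mpoly E[n]}) :
  (forall j, P^`M(j) != 0 -> stable P^`M(j)) ->
  let H := mshift (jet (@der L) a) (map_mpoly f P) in
  exists e0, forall e g, near e g -> dom (a - f e) (a - f e0) ->
  forall m, (1 < mdeg m)%N -> H@_m != 0 ->
  exists j, sdom (H@_m * f g ^+ mdeg m) (H@_U_(j) * f g).
Proof.
move=> dst H.
(* One monomial at a time suffices: H has finitely many, and the closest of the corresponding e0
   serves for all. *)
suff st1 m : (1 < mdeg m)%N -> H@_m != 0 -> exists e0, forall e g, near e g ->
    dom (a - f e) (a - f e0) -> exists j, sdom (H@_m * f g ^+ mdeg m) (H@_U_(j) * f g).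
  have [e0 he0] : exists e0, forall e g, near e g -> dom (a - f e) (a - f e0) ->
      forall m, m \in msupp H -> (1 < mdeg m)%N ->
      exists j, sdom (H@_m * f g ^+ mdeg m) (H@_U_(j) * f g).
    have : forall m, m \in msupp H -> H@_m != 0 by move=> m; rewrite mcoeff_msupp.
    elim: (msupp H) => [|m s IH] sH; first by exists 0.
    have {}IH : exists e0, forall e g, near e g -> dom (a - f e) (a - f e0) ->
        forall m, m \in s -> (1 < mdeg m)%N ->
        exists j, sdom (H@_m * f g ^+ mdeg m) (H@_U_(j) * f g).
      by apply: IH => m' m's; apply: sH; rewrite inE m's orbT.
    have [e1 he1] := IH.
    have [m2|m2] := ltnP 1 (mdeg m); last first.
      exists e1 => e g eg ee1 m'; rewrite inE => /orP[/eqP->|]; last exact: (he1 _ _ eg ee1).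
      by rewrite ltnNge m2.
    have [e2 he2] := st1 m m2 (sH m (mem_head _ _)).
    case/orP: (dom_total (a - f e1) (a - f e2)) => e12.
      exists e1 => e g eg ee1 m'; rewrite inE => /orP[/eqP->|]; last exact: (he1 _ _ eg ee1).
      by move=> _; apply: (he2 _ _ eg); apply: dom_trans ee1 e12.
    exists e2 => e g eg ee2 m'; rewrite inE => /orP[/eqP->|]; first by move=> _; apply: he2 eg ee2.
    by apply: (he1 _ _ eg); apply: dom_trans ee2 e12.
  by exists e0 => e g eg ee0 m m2 Hm; apply: he0 eg ee0 _ _ m2; rewrite mcoeff_msupp.
move=> m2 Hm.
(* Some variable j occurs in m, and as m has degree at least 2 it stays nonconstant after
   differentiation in j. *)
have [j mj] : exists j, m j != 0%N.
  apply/existsP; apply: contraTT m2 => /existsPn h; rewrite mdegE big1 // => j _.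
  by apply/eqP; have := h j; rewrite negbK.
have mE : (m - U_(j) + U_(j))%MM = m by apply: submK; rewrite lep1mP.
have mdE : mdeg m = (mdeg (m - U_(j))%MM).+1 by rewrite -{1}mE mdegD mdeg1 addn1.
pose Q := P^`M(j).
have HQ : H^`M(j) = mshift (jet (@der L) a) (map_mpoly f Q).
  by rewrite mderiv_mshift mderiv_map_mpoly.
have HQm : (H^`M(j))@_(m - U_(j)) = H@_m *+ (m j).
  rewrite mcoeff_deriv mE; congr (_ *+ _).
  by rewrite mnmBE mnm1E eqxx subn1 prednK // lt0n.
have nat1 k : k != 0%N -> (k%:R : L) != 0 /\ dom (1 : L) k%:R.
  move=> k0; split; first by rewrite (iffLR (pcharf0P _) (@df_char0 L)).
  by have := (dom_nat L k.-1).2; rewrite prednK // lt0n.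
have Q0 : Q != 0.
  apply: contraTneq Hm => Q0; move: HQm; rewrite HQ Q0 !rmorph0 mcoeff0.
  move=> /esym/eqP; rewrite -mulr_natr mulf_eq0 (negPf (nat1 _ mj).1) orbF => ->.
  by [].
(* Stability of the derivative compares its coefficient at m - U_j, which is m_j times that of H at
   m, with its constant term, which is the linear coefficient of H at j. *)
have [e0 [g0 [eg0 st0]]] := dst j Q0.
have [[_ st] _] := stab_at (z := a) st0 eg0.1.
have mU : (m - U_(j))%MM != 0%MM by rewrite -mdeg_eq0; move: m2; rewrite mdE; case: mdeg.
have {st} := st _ mU; rewrite -HQ HQm mcoeff_deriv add0m mnm0E mulr1n => st.
exists e0 => e g eg ee0; exists j; rewrite mdE exprSr mulrA sdomMr ?near_neq0 //.
  apply: dom_sdom_trans st; apply: domM.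
    by rewrite -mulr_natr -{1}[H@_m]mulr1 domMl // (nat1 _ mj).2.
  by apply: domX; apply: dom_trans eg.2 (dom_trans ee0 eg0.1).
exact: near_neq0 eg.
Qed.

Hypothesis hL : d_henselian L.

(** Newton's argument. Instability keeps the constant term of P at a below the linear part on small
    balls around a that reach E. As there is no smallest such ball, the two balance only at a radius
    below every a - f e, and there d-henselianity solves the equation. *)
Lemma unstable_zero n (P : {mpoly E[n.+1]}) : ~ stable P ->
  (forall j, P^`M(j) != 0 -> stable P^`M(j)) ->
  exists b, (map_mpoly f P).@[jet (@der L) b] = 0 /\
            forall e, sdom (b - a) (a - f e).
Proof.
move=> unst dst; set H := mshift (jet (@der L) a) (map_mpoly f P).
have [H0|H0] := eqVneq H@_0 0.
  exists a; split=> [|e]; first by rewrite -mcoeff0_mshift.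
  by rewrite subrr sdom0 sub_neq0.
have [e0 he0] := linear_dominates dst; rewrite -/H in he0.
have [j0 _ j0max] : exists2 j0, j0 \in enum 'I_n.+1 &
    forall j, j \in enum 'I_n.+1 -> dom H@_U_(j) H@_U_(j0).
  by apply: (@dom_max _ _ _ (fun j => H@_U_(j)) ord0); rewrite mem_enum.
have {}j0max j : dom H@_U_(j) H@_U_(j0) by apply: j0max; rewrite mem_enum.
set t := H@_U_(j0) in j0max.
(* Otherwise the constant term would strictly dominate the linear part, hence also the higher terms,
   and P would be stable. *)
have H0t e g : near e g -> dom (a - f e) (a - f e0) -> dom H@_0 (t * f g).
  move=> eg ee0; apply/negPn/negP => nd; apply: (unstable_at unst eg).
  split=> // m m0; rewrite -/H; have [-> //|Hm] := eqVneq H@_m 0.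
    by rewrite mul0r sdom0.
  have {}nd : sdom (t * f g) H@_0 by [].
  have [m2|] := ltnP 1 (mdeg m).
    have [j hj] := he0 e g eg ee0 m m2 Hm; apply: sdom_trans hj _.
    by apply: dom_sdom_trans nd; apply: domM => //; apply: dom_refl.
  rewrite leq_eqVlt ltnS leqn0 mdeg_eq0 (negPf m0) orbF => /mdeg1P[j /eqP ->].
  rewrite mdeg1 expr1; apply: dom_sdom_trans nd; apply: domM => //.
  exact: dom_refl.
have t0 : t != 0.
  have [g0 eg0] := near_ex e0; apply: contraNneq H0 => t0.
  by have := H0t e0 g0 eg0 (dom_refl _); rewrite t0 mul0r domx0.
(* The bound becomes strict because [nomax] provides a strictly smaller ball on which it holds as
   well. *)
have H0lt e : sdom H@_0 (t * (a - f e)).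
  have [e1 ee1] : exists e1, sdom (a - f e1) (a - f e) /\ dom (a - f e1) (a - f e0).
    case/orP: (dom_total (a - f e) (a - f e0)) => ee0.
      by have [e1 h] := nomax e; exists e1; split; [exact: h | apply: dom_trans (sdomW h) ee0].
    by have [e1 h] := nomax e0; exists e1; split; [apply: sdom_dom_trans h ee0 | apply: sdomW].
  have [g eg] := near_ex e1; apply: dom_sdom_trans (H0t _ _ eg ee1.2) _.
  by rewrite sdomMl //; apply: dom_sdom_trans eg.2 ee1.1.
(* The Newton radius: at this scale the constant term and the linear part have the same
   valuation. *)
pose g := mo_s (val0 (H@_0 / t)); have g0 : g != 0 := mo_s_neq0 _.
have [hg gh] := asymp_s (mulf_neq0 H0 (invr_neq0 t0)); rewrite -/g in hg gh.
have {}hg : dom H@_0 (t * g) by rewrite -[H@_0](divfK t0) mulrC domMl.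
have {}gh : dom (t * g) H@_0 by rewrite -[H@_0](divfK t0) [X in dom _ X]mulrC domMl.
have ga e : sdom g (a - f e).
  by rewrite -(sdomMl _ _ t0); apply: dom_sdom_trans gh (H0lt e).
have [|||y yg Hy] := d_hensel_scaled hL (j0 := j0) g0 H0.
- by move=> j; apply: dom_trans gh; rewrite domMr.
- by rewrite -/t.
- move=> m m2; have [->|Hm] := eqVneq H@_m 0; first by rewrite mul0r sdom0.
  have [gg eg] := near_ex e0; have gg0 := near_neq0 eg.
  have [j hj] := he0 e0 gg eg (dom_refl _) m m2 Hm.
  have {hj} hj : sdom (H@_m * f gg ^+ mdeg m) (t * f gg).
    by apply: sdom_dom_trans hj _; rewrite domMr.
  have gge : dom g (f gg) by apply: dom_trans (sdomW (ga e0)) eg.1.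
  apply: sdom_dom_trans gh.
  (* Passing from the radius gg to g multiplies a linear term by q and a term of higher degree by a
     power of q of exponent at least 2, so the domination persists. *)
  have [q gq [q0 q1]] : exists2 q, g = f gg * q & q != 0 /\ dom q 1.
    exists (g / f gg); first by rewrite mulrC divfK.
    split; first by rewrite mulf_neq0 // invr_eq0.
    by rewrite -(domMr _ _ gg0) divfK // mul1r.
  rewrite gq exprMn !mulrA; apply: sdomM => //.
  case: (mdeg m) m2 => // k _; rewrite exprS -{3}[q]mulr1 domMl //.
  by rewrite -(expr1n _ k); apply: domX.
exists (a + y); split=> [|e]; last first.
  by rewrite addrC addKr; apply: dom_sdom_trans yg (ga e).
rewrite -Hy meval_mshift; apply: meval_eq => j.
by rewrite jetD.
Qed.

End Pseudolimit.

(** * Polynomials in their last variable, and pseudo-division *)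

Section LastVariable.
Variables (n : nat) (R : comNzRingType).
Implicit Types (P Q : {mpoly R[n.+1]}) (m : 'X_{1..n.+1}).

Definition mext (m : 'X_{1..n}) j : 'X_{1..n.+1} := (mnmwiden m + U_(ord_max) *+ j)%MM.

Definition mrestr m : 'X_{1..n} := [multinom m (widen_ord (leqnSn n) i) | i < n].

Lemma mext_max (m' : 'X_{1..n}) j : mext m' j ord_max = j.
Proof. by rewrite /mext mnmDE mulmnE mnm1E eqxx mul1n mnmwiden_ordmax. Qed.

Lemma mrestrK m : mext (mrestr m) (m ord_max) = m.
Proof.
apply/mnmP => i; case: (unliftP ord_max i) => [j|] ->; last by rewrite mext_max.
have -> : lift ord_max j = widen_ord (leqnSn n) j.
  by apply: val_inj => /=; rewrite /bump leqNgt ltn_ord.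
rewrite /mext mnmDE mnmwiden_widen mulmnE mnm1E mnmE.
by rewrite -val_eqE /= gtn_eqF // mul0n addn0.
Qed.

Lemma mextK (m' : 'X_{1..n}) j : mrestr (mext m' j) = m'.
Proof.
apply/mnmP => i; rewrite mnmE /mext mnmDE mnmwiden_widen mulmnE mnm1E.
by rewrite -val_eqE /= gtn_eqF // mul0n addn0.
Qed.

Lemma mcoeff_muni P (m' : 'X_{1..n}) j : ((muni P)`_j)@_m' = P@_(mext m' j).
Proof.
rewrite muniE coef_sum raddf_sum /= [in RHS](mpolyE P) raddf_sum /=.
apply: eq_bigr => m _; rewrite coefZ coefXn mulr_natr mcoeffMn !mcoeffZ !mcoeffX.
rewrite -/(mrestr m) -[LHS]mulr_natr -mulrA; congr (_ * _); rewrite -natrM mulnb.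
congr (_%:R); congr (nat_of_bool _); apply/andP/eqP => [[/eqP <- /eqP ->]|->].
  by rewrite mrestrK.
by rewrite mextK mext_max !eqxx.
Qed.

Lemma size_muni_le P k :
  (size (muni P) <= k)%N <-> forall m, m \in msupp P -> (m ord_max < k)%N.
Proof.
split=> [sk m mP|h].
  apply: leq_trans sk; rewrite ltnNge; apply/negP => /leq_sizeP/(_ _ (leqnn _)) h.
  have := mcoeff_muni P (mrestr m) (m ord_max).
  by rewrite mrestrK h mcoeff0 => /esym/eqP; rewrite mcoeff_eq0 mP.
apply/leq_sizeP => j kj; apply/mpolyP => m'; rewrite mcoeff_muni mcoeff0.
by apply/eqP; rewrite mcoeff_eq0; apply/negP => /h; rewrite mext_max ltnNge kj.
Qed.

Lemma muni_inj : injective (@muni n R).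
Proof. by move=> P Q h; apply/mpolyP => m; rewrite -(mrestrK m) -!mcoeff_muni h. Qed.

Lemma muni_mwiden (P : {mpoly R[n]}) : muni (mwiden P) = P%:P.
Proof.
apply/polyP => j; apply/mpolyP => m; rewrite mcoeff_muni coefC.
elim/mpolyind: P => [|c m' P _ _ IH]; first by rewrite mwiden0 if_same !mcoeff0.
rewrite mwidenD mwidenZ mwidenX mcoeffD mcoeffZ mcoeffX IH; have [->|j0] := eqVneq j 0%N.
  rewrite mcoeffD mcoeffZ mcoeffX; congr (_ * _%:R + _); congr (nat_of_bool _).
  rewrite /mext mulm0n addm0; by apply/eqP/eqP => [/inj_mnmwiden ->|->].
rewrite mcoeff0 addr0; case: eqP => [e|]; last by rewrite mulr0.
by move: j0; rewrite -(mext_max m j) -e mnmwiden_ordmax.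
Qed.

Lemma muni_Xmax : muni ('X_ord_max : {mpoly R[n.+1]}) = 'X.
Proof.
apply/polyP => j; apply/mpolyP => m; rewrite mcoeff_muni mcoeffX coefX.
have -> : (U_(ord_max) = mext 0 1)%MM by rewrite /mext mnmwiden0 add0m mulm1n.
have [->|j1] := eqVneq j 1%N.
  rewrite mcoeff1; congr (_%:R); congr (nat_of_bool _).
  by apply/eqP/eqP => [/(congr1 mrestr)|->]; rewrite ?mextK // => ->.
rewrite mcoeff0; case: eqP => // e; case/eqP: j1.
by rewrite -(mext_max m j) -e mext_max.
Qed.

Lemma mmultiK (p : {poly {mpoly R[n]}}) : muni (mmulti p) = p.
Proof.
rewrite /mmulti rmorph_sum /= -[RHS]coefK poly_def; apply: eq_bigr => i _.
by rewrite rmorphM rmorphXn /= muni_mwiden muni_Xmax mul_polyC.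
Qed.

Lemma size_muni1 P : (size (muni P) <= 1)%N -> P = mwiden (muni P)`_0.
Proof. by move=> h; apply: muni_inj; rewrite muni_mwiden {1}[muni P]size1_polyC. Qed.

Lemma size_muni_mderiv P j : (size (muni P^`M(j)) <= size (muni P))%N.
Proof.
apply/size_muni_le => m; rewrite mcoeff_msupp mcoeff_deriv => h.
have mP : (m + U_(j))%MM \in msupp P.
  by rewrite mcoeff_msupp; apply: contraNneq h => ->; rewrite mul0rn.
apply: leq_trans (iffLR (size_muni_le P _) (leqnn _) _ mP).
by rewrite ltnS mnmDE leq_addr.
Qed.

Lemma msize_mderiv P j : P != 0 -> (msize P^`M(j) < msize P)%N.
Proof.
move=> P0; rewrite msizeE (mpolySpred _ P0) ltnS; apply/bigmax_leqP_seq => m.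
rewrite mcoeff_msupp mcoeff_deriv => h _.
have mP : (m + U_(j))%MM \in msupp P.
  by rewrite mcoeff_msupp; apply: contraNneq h => ->; rewrite mul0rn.
by rewrite -ltnS -mpolySpred //; have := msize_mdeg_lt mP; rewrite mdegD mdeg1 addn1.
Qed.

End LastVariable.

(** Ritt's reduction of P by G with respect to the highest derivative: pseudo-division over the
    polynomials in the lower ones, whose multiplier is a power of the initial of G. *)
Lemma pseudo_division n (E : fieldType) (P G : {mpoly E[n.+1]}) : G != 0 ->
  exists k Q R, mwiden (lead_coef (muni G)) ^+ k * P = Q * G + R /\
                (size (muni R) < size (muni G))%N.
Proof.
move=> G0; have uG0 : muni G != 0 by apply: contraNneq G0 => h; rewrite -(inj_eq (@muni_inj _ _)) h muni0.
exists (scalp (muni P) (muni G)), (mmulti (muni P %/ muni G)), (mmulti (muni P %% muni G)).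
split; last by rewrite mmultiK ltn_modp.
apply: muni_inj; rewrite muniD !muniM !mmultiK rmorphXn /= muni_mwiden.
by rewrite -Pdiv.Idomain.divp_eq -mul_polyC rmorphXn.
Qed.

Lemma exists_min (T : Type) (mu : T -> nat) (S : T -> Prop) :
  (exists x, S x) -> exists2 x, S x & forall y, S y -> (mu x <= mu y)%N.
Proof.
case=> x0 Sx0; have ex : exists k, `[< exists2 x, S x & mu x = k >].
  by exists (mu x0); apply/asboolP; exists x0.
case: (ex_minnP ex) => k /asboolP[x Sx <-] kmin; exists x => // y Sy.
by apply: kmin; apply/asboolP; exists y.
Qed.

(** * Adjoining a pseudolimit to both fields *)

(* Locked, so that unification does not unfold the values of polynomials. *)
HB.lock Definition ev (L : Mo_model) (E : fieldType) (f : {rmorphism E -> L})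
  (b : L) n (P : {mpoly E[n]}) : L := (map_mpoly f P).@[jet (@der L) b].

Section StableEmbedding.
Variables (L : Mo_model) (E : fieldType) (dE : E -> E) (f : {rmorphism E -> L}).
Hypothesis f_der : forall x, f (dE x) = der (f x).
Variable a : L.
Hypothesis near_ex : forall e, exists g, near f a e g.
Hypothesis nomax : forall e, exists e', sdom (a - f e') (a - f e).

Lemma evE b n (P : {mpoly E[n]}) : (map_mpoly f P).@[jet (@der L) b] = ev f b P.
Proof. by rewrite ev.unlock. Qed.

Lemma evC b n c : ev f b (c%:MP_[n]) = f c.
Proof. by rewrite -!evE map_mpolyC mevalC. Qed.

Lemma evX b n (i : 'I_n) : ev f b 'X_i = iter i (@der L) b.
Proof. by rewrite -!evE map_mpolyX mevalXU. Qed.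

Lemma evD b n (P Q : {mpoly E[n]}) : ev f b (P + Q) = ev f b P + ev f b Q.
Proof. by rewrite -!evE rmorphD /= mevalD. Qed.

Lemma evM b n (P Q : {mpoly E[n]}) : ev f b (P * Q) = ev f b P * ev f b Q.
Proof. by rewrite -!evE rmorphM /= mevalM. Qed.

Lemma ev0 b n : ev f b (0 : {mpoly E[n]}) = 0.
Proof. by rewrite -mpolyC0 evC rmorph0. Qed.

Lemma ev1 b n : ev f b (1 : {mpoly E[n]}) = 1.
Proof. by rewrite -mpolyC1 evC rmorph1. Qed.

Lemma ev_exp b n (P : {mpoly E[n]}) k : ev f b (P ^+ k) = ev f b P ^+ k.
Proof. by elim: k => [|k IH]; rewrite ?expr0 ?ev1 // !exprS evM IH. Qed.

Lemma ev_mwiden b n (P : {mpoly E[n]}) : ev f b (mwiden P) = ev f b P.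
Proof.
elim/mpoly_ring_ind: P => [c|i|P Q hP hQ|P Q hP hQ].
- by rewrite mwidenC !evC.
- by rewrite mwidenX mnmwiden1 !evX.
- by rewrite mwidenD !evD hP hQ.
- by rewrite mwidenM !evM hP hQ.
Qed.

(** Differentiating P(b) brings in a single new quantity z, the next derivative of b, linearly and
    with a partial derivative of P as coefficient. Sums and products inherit this shape, so it
    follows from the generators. *)
Lemma der_evD b n i (P Q P1 Q1 : {mpoly E[n]}) z :
  der (ev f b P) = ev f b P1 + ev f b P^`M(i) * z ->
  der (ev f b Q) = ev f b Q1 + ev f b Q^`M(i) * z ->
  der (ev f b (P + Q)) = ev f b (P1 + Q1) + ev f b (P + Q)^`M(i) * z.
Proof.
move=> hP hQ; rewrite mderivD (evD _ P) (evD _ P1) (evD _ P^`M(i)) derD hP hQ.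
by rewrite mulrDl addrACA.
Qed.

Lemma der_evM b n i (P Q P1 Q1 : {mpoly E[n]}) z :
  der (ev f b P) = ev f b P1 + ev f b P^`M(i) * z ->
  der (ev f b Q) = ev f b Q1 + ev f b Q^`M(i) * z ->
  der (ev f b (P * Q)) = ev f b (P1 * Q + P * Q1) + ev f b (P * Q)^`M(i) * z.
Proof.
move=> hP hQ; rewrite mderivM (evD _ (P1 * Q)) (evD _ (P^`M(i) * Q)).
rewrite (evM _ P Q) (evM _ P1) (evM _ P Q1) (evM _ P^`M(i)) (evM _ P Q^`M(i)).
rewrite derM hP hQ.
have leibniz (p q p1 q1 p' q' : L) :
    (p1 + p' * z) * q + p * (q1 + q' * z) = p1 * q + p * q1 + (p' * q + p * q') * z.
  by ring.
exact: leibniz.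
Qed.

(** b lies closer to a than all of E does, so a and b are pseudolimits of the same elements of E. *)
Definition close b := forall e, sdom (b - a) (a - f e).

Lemma close_refl : close a.
Proof. by move=> e; have [e' h] := nomax e; rewrite subrr sdom0 (sdom_neq0 h). Qed.

Lemma close_notin b e : close b -> b != f e.
Proof.
move=> /(_ e); apply: contraTneq => ->.
by rewrite -sdomNl opprB sdomxx.
Qed.

(** This is how values at pseudolimits are controlled: their leading terms are found in E. *)
Lemma stable_value b n (P : {mpoly E[n]}) e g : close b ->
  near f a e g -> Stab (f g) (map_mpoly f (translate dE e P)) ->
  sdom (ev f b P - f (P.@[jet dE e])) (f (P.@[jet dE e])).
Proof.
move=> cb eg st; rewrite -evE; apply: (stab_at f_der st _).2.
rewrite -[b - f e](subrKA a); apply: domD; last by case: eg.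
by apply: dom_trans (sdomW (cb e)) _; case: eg.
Qed.

Lemma stableC n c : c != 0 -> stable dE f a (c%:MP_[n]).
Proof.
move=> c0; have [g eg] := near_ex 0; exists 0, g; split=> //.
rewrite /translate mshiftC map_mpolyC; split=> [|m m0].
  by rewrite mcoeffC eqxx mulr1 fmorph_eq0.
by rewrite !mcoeffC (negPf m0) eqxx mulr0 mul0r mulr1 sdom0 fmorph_eq0.
Qed.

(** Stability does not see variables that do not occur; so an unstable polynomial in the least
    number of variables involves its last one. *)
Lemma stable_mwiden n (P : {mpoly E[n]}) : stable dE f a P -> stable dE f a (mwiden P).
Proof.
case=> e [g [eg [st0 st]]]; exists e, g; split=> //; move: st0 st.
rewrite /translate mwiden_mshift -/(jet dE e).
set Q := mshift _ P.
rewrite !mcoeff_map_mpoly => st0 st.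
have Q00 : (mwiden Q)@_0 = Q@_0 by rewrite -(mnmwiden0 n) mwiden_mnmwiden.
split=> [|m m0]; rewrite ?mcoeff_map_mpoly Q00 //.
rewrite -(mrestrK m) -mcoeff_muni muni_mwiden coefC; case: eqP => [j0|_]; last first.
  by rewrite mcoeff0 raddf0 mul0r sdom0.
have -> : mdeg (mext (mrestr m) (m ord_max)) = mdeg (mrestr m).
  rewrite mrestrK !mdegE big_ord_recr /= j0 addn0; apply: eq_bigr => i _.
  by rewrite mnmE.
rewrite -mcoeff_map_mpoly; apply: st.
apply: contraNneq m0 => r0; rewrite -(mrestrK m) r0 j0.
by rewrite /mext mnmwiden0 add0m mulm0n.
Qed.

End StableEmbedding.

Lemma linear_root (K : fieldType) (s t z : K) :
  s != 0 -> 0 = t + s * z -> z = -1 * (t * s^-1).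
Proof.
move=> s0 h; apply: (mulfI s0); rewrite mulN1r mulrN mulrCA divff // mulr1.
by apply/eqP; rewrite -addr_eq0 addrC -h.
Qed.

(** * Corresponding pseudolimits in two extensions *)

Section TwoEmbeddings.
Variables (F L : Mo_model) (hF : d_henselian F) (hL : d_henselian L).
Variables (E : fieldType) (dE : E -> E).
Variables (f1 : {rmorphism E -> F}) (f2 : {rmorphism E -> L}).
Hypothesis f1_der : forall x, f1 (dE x) = der (f1 x).
Hypothesis f2_der : forall x, f2 (dE x) = der (f2 x).
Hypothesis sdom12 : forall x y, sdom (f1 x) (f1 y) = sdom (f2 x) (f2 y).
Variables (a1 : F) (a2 : L).
Hypothesis near12 : forall e g, near f1 a1 e g <-> near f2 a2 e g.
Hypothesis near_ex : forall e, exists g, near f1 a1 e g.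
Hypothesis nomax1 : forall e, exists e', sdom (a1 - f1 e') (a1 - f1 e).

Lemma near_ex2 e : exists g, near f2 a2 e g.
Proof. by have [g /near12] := near_ex e; exists g. Qed.

Lemma nomax2 e : exists e', sdom (a2 - f2 e') (a2 - f2 e).
Proof.
have [e' ee'] := nomax1 e; exists e'; have [g eg] := near_ex e.
have [g' eg'] := near_ex e'; have [/near12 eg2 /near12 eg2'] := (eg, eg').
apply: dom_sdom_trans eg2'.1 _; apply: sdom_dom_trans eg2.2.
rewrite -sdom12; apply: dom_sdom_trans eg'.2 _; exact: sdom_dom_trans ee' eg.1.
Qed.

Lemma Stab12 n (Q : {mpoly E[n]}) g :
  Stab (f1 g) (map_mpoly f1 Q) <-> Stab (f2 g) (map_mpoly f2 Q).
Proof.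
rewrite /Stab !mcoeff_map_mpoly !fmorph_eq0.
split=> -[Q0 h]; split=> // m /h; rewrite !mcoeff_map_mpoly -!rmorphXn -!rmorphM /=.
  by rewrite sdom12.
by rewrite sdom12.
Qed.

(** Centre, radius and coefficients come from E, on which both embeddings induce the same
    valuation. *)
Lemma stable12 n (P : {mpoly E[n]}) : stable dE f1 a1 P <-> stable dE f2 a2 P.
Proof.
by split=> -[e [g [/near12 eg /Stab12 st]]]; exists e, g.
Qed.

(** The common p in the last clause says both that no new leading terms arise and that those of the
    two sides correspond. *)
Definition immediate_ext (A : F -> L -> Prop) :=
  [/\ forall e, A (f1 e) (f2 e),
      forall x y x' y', A x y -> A x' y' -> A (x + x') (y + y') /\ A (x * x') (y * y'),
      forall x y, A x y -> A (der x) (der y) &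
      forall x y, A x y -> (x = 0 /\ y = 0) \/
        exists p, sdom (x - f1 p) (f1 p) /\ sdom (y - f2 p) (f2 p)].

Let lt12 (x : F) (y : L) := exists p, sdom (x - f1 p) (f1 p) /\ sdom (y - f2 p) (f2 p).

Lemma lt12_stable b1 b2 n (P : {mpoly E[n]}) : close f1 a1 b1 -> close f2 a2 b2 ->
  stable dE f1 a1 P -> lt12 (ev f1 b1 P) (ev f2 b2 P).
Proof.
move=> c1 c2 [e [g [eg st]]]; exists P.@[jet dE e].
split; first exact: (stable_value f1_der c1 eg).
by apply: (stable_value f2_der c2 (iffLR (near12 _ _) eg)); apply/Stab12.
Qed.

Lemma lt12_mul x y x' y' : lt12 x y -> lt12 x' y' -> lt12 (x * x') (y * y').
Proof.
by move=> [p [h1 h2]] [q [h1' h2']]; exists (p * q); rewrite !rmorphM; split; apply: sim_mul.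
Qed.

Lemma lt12_inv x y : lt12 x y -> lt12 x^-1 y^-1.
Proof.
by move=> [p [h1 h2]]; exists p^-1; rewrite !fmorphV; split; apply: sim_inv.
Qed.

Lemma lt12_1 : lt12 1 1.
Proof. by exists 1; rewrite !rmorph1 !subrr !sdom0 !oner_eq0. Qed.

Lemma lt12_neq0 x y : lt12 x y -> x != 0 /\ y != 0.
Proof. by move=> [p [h1 h2]]; rewrite (sim_neq0 h1) (sim_neq0 h2). Qed.

(** The transcendental and algebraic cases of adjoining a pseudolimit: either every nonzero
    polynomial is stable and polynomial values form the correspondence, or a minimal unstable G
    plays the role of a minimal polynomial and is given a zero on both sides. *)
Lemma immediate_ext_exists : exists A b1 b2,
  [/\ immediate_ext A, A b1 b2 & forall e, b1 != f1 e].
Proof.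
have [allst|] := pselect (forall n (P : {mpoly E[n]}), P != 0 -> stable dE f1 a1 P).
  pose A x y := exists n (P : {mpoly E[n]}), x = ev f1 a1 P /\ y = ev f2 a2 P.
  have c1 : close f1 a1 a1 by apply: close_refl.
  have c2 : close f2 a2 a2 by apply: close_refl; apply: nomax2.
  (* Polynomials of different orders are padded with extra variables before they are added or
     multiplied. *)
  have wid n (P : {mpoly E[n]}) k : exists P' : {mpoly E[k + n]},
      ev f1 a1 P' = ev f1 a1 P /\ ev f2 a2 P' = ev f2 a2 P.
    elim: k => [|k [P' [h1 h2]]]; first by exists P.
    by exists (mwiden P'); rewrite !ev_mwiden.
  have common x y x' y' : A x y -> A x' y' -> exists n (P P' : {mpoly E[n]}),
      [/\ x = ev f1 a1 P, y = ev f2 a2 P, x' = ev f1 a1 P' & y' = ev f2 a2 P'].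
    move=> [n [P [-> ->]]] [n' [P' [-> ->]]].
    have [Q [h1 h2]] := wid n P n'; have [Q' [h1' h2']] := wid n' P' n.
    rewrite -h1 -h2 -h1' -h2'; move: Q' {h1' h2'}; rewrite addnC => Q'.
    by exists (n' + n)%N, Q, Q'.
  exists A, a1, a2; split; last by move=> e; apply: close_notin.
    split=> [e|x y x' y' Ax Ay|x y [n [P [-> ->]]]|x y [n [P [-> ->]]]].
    - by exists 0%N, (e%:MP); rewrite !evC.
    - have [n [P [P' [-> -> -> ->]]]] := common _ _ _ _ Ax Ay.
      by split; exists n; [exists (P + P') | exists (P * P')]; rewrite ?evD ?evM.
    - exists n.+1; elim/mpoly_ring_ind: P => [c|i|P Q|P Q].
      + by exists ((dE c)%:MP); rewrite !evC f1_der f2_der.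
      + by exists 'X_(lift ord0 i); rewrite !evX.
      + by move=> [P1 [hP hP']] [Q1 [hQ hQ']]; exists (P1 + Q1); rewrite !evD !derD hP hP' hQ hQ'.
      + move=> [P1 [hP hP']] [Q1 [hQ hQ']]; exists (P1 * mwiden Q + mwiden P * Q1).
        by rewrite !evD !evM !derM hP hP' hQ hQ' !ev_mwiden.
    - have [->|P0] := eqVneq P 0; first by left; rewrite !ev0.
      by right; apply: lt12_stable c1 c2 _; apply: allst.
  by exists 1%N, 'X_ord0; rewrite !evX.
move=> nst; pose Bad n := exists P : {mpoly E[n]}, P != 0 /\ ~ stable dE f1 a1 P.
have [n [P0 [P0n0 P0unst]] nmin] : exists2 n, Bad n & forall k, Bad k -> (n <= k)%N.
  apply: (exists_min id); apply: contrapT => h; apply: nst => n P Pn0.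
  by apply: contrapT => hP; apply: h; exists n, P.
(* With no variables P0 is a nonzero constant, hence stable; otherwise the last of the r.+1
   variables stands for the derivative of order r. *)
case: n P0 P0n0 P0unst nmin => [|r] P0 P0n0 P0unst nmin.
  case: P0unst; rewrite (nvar0_mpolyC P0); apply: stableC => //.
  by apply: contraNneq P0n0 => h; rewrite (nvar0_mpolyC P0) h mpolyC0.
have low (P : {mpoly E[r]}) : P != 0 -> stable dE f1 a1 P.
  move=> Pn0; apply: contrapT => hP; have : Bad r by exists P.
  by move/nmin; rewrite ltnn.
(* Complexity is ordered lexicographically: number of variables, degree in the last one, total
   degree. *)
have [G [Gn0 Gunst] Gmin] : exists2 G : {mpoly E[r.+1]}, G != 0 /\ ~ stable dE f1 a1 G &
    forall P : {mpoly E[r.+1]}, P != 0 -> ~ stable dE f1 a1 P ->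
    (size (muni G) <= size (muni P))%N /\
    (size (muni P) = size (muni G) -> (msize G <= msize P)%N).
  have [|P1 [P1n0 P1unst] P1min] := @exists_min _ (fun P => size (muni P))
    (fun P : {mpoly E[r.+1]} => P != 0 /\ ~ stable dE f1 a1 P); first by exists P0.
  have [|G [[Gn0 Gunst] Gs] Gmin] := @exists_min _ (fun P : {mpoly E[r.+1]} => msize P)
    (fun P => (P != 0 /\ ~ stable dE f1 a1 P) /\ size (muni P) = size (muni P1)).
    by exists P1.
  exists G; first by split.
  move=> P Pn0 Punst.
  have h1 := P1min P (conj Pn0 Punst).
  split=> [|Ps].
    apply: leq_trans h1.
    exact: eq_leq.
  by have := Gmin P (conj (conj Pn0 Punst) (etrans Ps Gs)).
have stP (P : {mpoly E[r.+1]}) : P != 0 -> (size (muni P) <= size (muni G))%N ->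
    (size (muni P) = size (muni G) -> (msize P < msize G)%N) -> stable dE f1 a1 P.
  move=> Pn0; rewrite leq_eqVlt => sP mP; apply: contrapT => /(Gmin _ Pn0)[h1 h2].
  case/orP: sP => [/eqP e|]; last by rewrite ltnNge h1.
  by have := mP e; rewrite ltnNge h2.
(* A partial derivative does not raise the degree in the last variable and lowers the total degree,
   so minimality of G makes it stable. *)
have dG j : G^`M(j) != 0 -> stable dE f1 a1 G^`M(j).
  by move=> h; apply: (stP _ h (size_muni_mderiv _ _)) => _; apply: msize_mderiv.
have [b1 [Gb1 c1]] := unstable_zero f1_der near_ex nomax1 hF Gunst dG.
have Gunst2 : ~ stable dE f2 a2 G by move/stable12.
have dG2 j : G^`M(j) != 0 -> stable dE f2 a2 G^`M(j) by move=> h; apply/stable12/dG.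
have [b2 [Gb2 c2]] := unstable_zero f2_der near_ex2 nomax2 hL Gunst2 dG2.
rewrite evE in Gb1; rewrite evE in Gb2.
(* Initial and separant of G. Both are nonzero and stable, so their values at the two zeros are
   nonzero. *)
pose I := lead_coef (muni G); pose S := G^`M(ord_max).
have In0 : I != 0.
  rewrite lead_coef_eq0; apply: contraNneq Gn0 => h.
  by apply/eqP; apply: muni_inj; rewrite muni0.
(* G truly involves its last variable, as polynomials in fewer variables are stable; in
   characteristic 0 its separant is then nonzero. *)
have Sn0 : S != 0.
  have szG : (1 < size (muni G))%N.
    rewrite ltnNge; apply/negP => /size_muni1 GE; apply: Gunst; rewrite GE.
    apply: stable_mwiden; apply: low; apply: contraNneq Gn0 => h.
    by rewrite GE h mwiden0.
  have [m mG mmax] : exists2 m, m \in msupp G & (0 < m ord_max)%N.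
    apply: contrapT => h; move: szG; rewrite ltnNge => /negP; apply.
    apply/size_muni_le => m mG; rewrite ltnS leqn0 -[_ == _]negbK -lt0n.
    by apply/negP => h'; apply: h; exists m.
  have mE : (m - U_(ord_max) + U_(ord_max))%MM = m.
    by apply: submK; rewrite lep1mP -lt0n.
  apply: contraTneq mG => S0; rewrite -mcoeff_eq0.
  have : S@_(m - U_(ord_max)) = 0 by rewrite S0 mcoeff0.
  rewrite mcoeff_deriv mE -mulr_natr => /eqP; rewrite mulf_eq0 => /orP[//|].
  rewrite -(fmorph_eq0 f1) rmorph_nat.
  by rewrite (iffLR (pcharf0P _) (@df_char0 F)).
have ltI : lt12 (ev f1 b1 I) (ev f2 b2 I) by apply: lt12_stable => //; apply: low.
have ltS : lt12 (ev f1 b1 S) (ev f2 b2 S) by apply: lt12_stable => //; apply: dG.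
(* Modulo G, which vanishes at both points, P times a power of the initial is a polynomial of
   smaller degree in the last variable, and that one is 0 or stable. *)
have ltP (P : {mpoly E[r.+1]}) : (ev f1 b1 P = 0 /\ ev f2 b2 P = 0) \/
    lt12 (ev f1 b1 P) (ev f2 b2 P).
  have [k [Q [R [divE sR]]]] := pseudo_division P Gn0.
  have E1 : ev f1 b1 I ^+ k * ev f1 b1 P = ev f1 b1 R.
    by have := congr1 (@ev F E f1 b1 r.+1) divE; rewrite evD !evM Gb1 mulr0 add0r ev_exp ev_mwiden.
  have E2 : ev f2 b2 I ^+ k * ev f2 b2 P = ev f2 b2 R.
    by have := congr1 (@ev L E f2 b2 r.+1) divE; rewrite evD !evM Gb2 mulr0 add0r ev_exp ev_mwiden.
  have ltIk : lt12 (ev f1 b1 I ^+ k) (ev f2 b2 I ^+ k).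
    by elim: (k) => [|k' IH]; rewrite ?expr0 ?exprS; [apply: lt12_1 | apply: lt12_mul].
  have [Ik1 Ik2] := lt12_neq0 ltIk.
  have [R0|Rn0] := eqVneq R 0.
    left; move: E1 E2; rewrite R0 !ev0 => /eqP + /eqP.
    by rewrite !mulf_eq0 (negPf Ik1) (negPf Ik2) /= => /eqP -> /eqP ->.
  right; have ltR : lt12 (ev f1 b1 R) (ev f2 b2 R).
    apply: lt12_stable c1 c2 _; apply: (stP _ Rn0 (ltnW sR)) => e.
    by have := leq_trans sR (eq_leq (esym e)); rewrite ltnn.
  have -> : ev f1 b1 P = (ev f1 b1 I ^+ k)^-1 * ev f1 b1 R by rewrite -E1 mulKf.
  have -> : ev f2 b2 P = (ev f2 b2 I ^+ k)^-1 * ev f2 b2 R by rewrite -E2 mulKf.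
  by apply: lt12_mul => //; apply: lt12_inv.
pose A x y := exists P Q : {mpoly E[r.+1]}, [/\ ev f1 b1 Q != 0, ev f2 b2 Q != 0,
  x = ev f1 b1 P / ev f1 b1 Q & y = ev f2 b2 P / ev f2 b2 Q].
have Aev (P : {mpoly E[r.+1]}) : A (ev f1 b1 P) (ev f2 b2 P).
  by exists P, 1; rewrite !ev1 !oner_eq0 !divr1.
have AD x y x' y' : A x y -> A x' y' -> A (x + x') (y + y').
  move=> [P [Q [Q1 Q2 -> ->]]] [P' [Q' [Q1' Q2' -> ->]]].
  exists (P * Q' + P' * Q), (Q * Q').
  rewrite (evD f1 b1 (P * Q')) (evD f2 b2 (P * Q')) (evM f1 b1 Q Q') (evM f2 b2 Q Q').
  rewrite (evM f1 b1 P Q') (evM f2 b2 P Q') (evM f1 b1 P' Q) (evM f2 b2 P' Q).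
  by split; [exact: mulf_neq0 | exact: mulf_neq0 | exact: addf_div | exact: addf_div].
have AM x y x' y' : A x y -> A x' y' -> A (x * x') (y * y').
  move=> [P [Q [Q1 Q2 -> ->]]] [P' [Q' [Q1' Q2' -> ->]]].
  exists (P * P'), (Q * Q').
  rewrite (evM f1 b1 Q Q') (evM f2 b2 Q Q') (evM f1 b1 P P') (evM f2 b2 P P').
  by split; [exact: mulf_neq0 | exact: mulf_neq0 | exact: mulf_div | exact: mulf_div].
have AV x y : A x y -> y != 0 -> A x^-1 y^-1.
  move=> [P [Q [Q1 Q2 -> ->]]]; rewrite mulf_eq0 invr_eq0 (negPf Q2) orbF => P2.
  have P1 : ev f1 b1 P != 0.
    by case: (ltP P) => [[_ h]|/lt12_neq0[]//]; move/eqP: P2 => /(_ h).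
  by exists Q, P; rewrite !invf_div.
have AN1 : A (-1) (-1) by have := Aev (-1)%:MP; rewrite !evC !rmorphN1.
pose z1 := iter r.+1 (@der F) b1; pose z2 := iter r.+1 (@der L) b2.
have derev (P : {mpoly E[r.+1]}) : exists P1 : {mpoly E[r.+1]},
    der (ev f1 b1 P) = ev f1 b1 P1 + ev f1 b1 P^`M(ord_max) * z1 /\
    der (ev f2 b2 P) = ev f2 b2 P1 + ev f2 b2 P^`M(ord_max) * z2.
  elim/mpoly_ring_ind: P => [c|i|P Q|P Q].
  - by exists ((dE c)%:MP); rewrite !evC mderivC !ev0 !mul0r !addr0 f1_der f2_der.
  - rewrite mderivX mnm1E -(inj_eq val_inj) /=; have [ir|ir] := eqVneq (i : nat) r.
      have -> : i = ord_max by apply: val_inj.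
      exists 0; have -> : (U_(ord_max) - U_(ord_max) = 0 :> 'X_{1..r.+1})%MM.
        by apply/mnmP => l; rewrite mnmBE subnn mnm0E.
      by rewrite mpolyX0 scale1r !ev0 !ev1 !mul1r !add0r !evX.
    rewrite scale0r; have i1 : (i.+1 < r.+1)%N.
      by rewrite ltnS ltn_neqAle ir -ltnS ltn_ord.
    by exists 'X_(Ordinal i1); rewrite !ev0 !mul0r !addr0 !evX.
  - by move=> [P1 [hP hP']] [Q1 [hQ hQ']]; exists (P1 + Q1); split; apply: der_evD.
  - by move=> [P1 [hP hP']] [Q1 [hQ hQ']]; exists (P1 * Q + P * Q1); split; apply: der_evM.
(* Differentiating G(b) = 0 expresses the next derivative of b as a quotient with the separant as
   denominator, by the same formula on both sides. *)
have Az : A z1 z2.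
  have [T [h1 h2]] := derev G; rewrite Gb1 Gb2 !der0 -/S in h1 h2.
  have [S1 S2] := lt12_neq0 ltS.
  rewrite (linear_root S1 h1) (linear_root S2 h2).
  by apply: (AM _ _ _ _ AN1); apply: (AM _ _ _ _ (Aev _)); apply: AV (Aev _) S2.
have Ader (P : {mpoly E[r.+1]}) : A (der (ev f1 b1 P)) (der (ev f2 b2 P)).
  by have [T [-> ->]] := derev P; apply: AD (Aev _) _; apply: AM (Aev _) Az.
exists A, b1, b2; split; last by move=> e; apply: close_notin c1.
  split=> [e|x y x' y' Ax Ax'|x y [P [Q [Q1 Q2 -> ->]]]|x y [P [Q [Q1 Q2 -> ->]]]].
  - by have := Aev e%:MP; rewrite !evC.
  - by split; [apply: AD | apply: AM].
  - rewrite (der_div _ Q1) (der_div _ Q2).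
    apply: AD; first by apply: (AM _ _ _ _ (Ader _)); apply: AV (Aev _) Q2.
    apply: (AM _ _ _ _ (Aev _)); apply: (AM _ _ _ _ AN1); apply: (AM _ _ _ _ (Ader _)).
    by apply: (AM); apply: AV (Aev _) Q2.
  - case: (ltP P) => [[-> ->]|lP]; first by left; rewrite !mul0r.
    right; apply: lt12_mul lP _; apply: lt12_inv.
    by case: (ltP Q) => [[h _]|//]; move/eqP: Q1 => /(_ h).
by have := Aev 'X_ord0; rewrite !evX.
Qed.

End TwoEmbeddings.

(** * Embedding a countable model into a saturated one *)

Section Embedding.
Variables (F L : Mo_model) (Psi : F -> L -> Prop).
Variable iota : vgroup F -> vgroup L -> Prop.

(* [Psi] and [iota] are the graphs of embeddings of the lift and of the value
   group of F into those of L that commute with c. *)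
Record kG_embedding : Prop := KGEmbedding {
  Psi_k : forall x y, Psi x y -> x \in mo_k F /\ y \in mo_k L;
  Psi_total : forall x, x \in mo_k F -> exists y, Psi x y;
  Psi1 : Psi 1 1;
  PsiB : forall x y x' y', Psi x y -> Psi x' y' -> Psi (x - x') (y - y');
  PsiM : forall x y x' y', Psi x y -> Psi x' y' -> Psi (x * x') (y * y');
  PsiV : forall x y, Psi x y -> Psi x^-1 y^-1;
  Psi_der : forall x y, Psi x y -> Psi (der x) (der y);
  Psi_eq0 : forall x y, Psi x y -> (x == 0) = (y == 0);
  iota_total : forall g, exists h, iota g h;
  iota0 : iota 0 0;
  iotaD : forall g h g' h', iota g h -> iota g' h' -> iota (g + g') (h + h');
  iotaN : forall g h, iota g h -> iota (- g) (- h);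
  iota_le : forall g h g' h', iota g h -> iota g' h' -> (g <= g') = (h <= h');
  iota_c : forall g h, iota g h -> Psi (mo_c g) (mo_c h) }.

Hypothesis emb : kG_embedding.

Definition leads (x : F) (y : L) u w g h :=
  [/\ Psi u w, u != 0, iota g h, sdom (x - u * mo_s g) (u * mo_s g) &
      sdom (y - w * mo_s h) (w * mo_s h)].

Definition LT x y := exists u w g h, leads x y u w g h.

Lemma LT_neq0 x y : LT x y -> x != 0 /\ y != 0.
Proof. by move=> [u [w [g [h [_ _ _ h1 h2]]]]]; rewrite (sim_neq0 h1) (sim_neq0 h2). Qed.

Lemma LT_mul x y x' y' : LT x y -> LT x' y' -> LT (x * x') (y * y').
Proof.
move=> [u [w [g [h [uw u0 gh h1 h2]]]]] [u' [w' [g' [h' [uw' u0' gh' h1' h2']]]]].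
exists (u * u'), (w * w'), (g + g'), (h + h'); split.
- exact: PsiM.
- by rewrite mulf_neq0.
- exact: iotaD.
- by rewrite mo_sD mulrACA; apply: sim_mul.
- by rewrite mo_sD mulrACA; apply: sim_mul.
Qed.

Lemma LT_inv x y : LT x y -> LT x^-1 y^-1.
Proof.
move=> [u [w [g [h [uw u0 gh h1 h2]]]]].
exists u^-1, w^-1, (- g), (- h); split.
- exact: PsiV.
- by rewrite invr_eq0.
- exact: iotaN.
- by rewrite mo_sN -invfM; apply: sim_inv.
- by rewrite mo_sN -invfM; apply: sim_inv.
Qed.

Lemma LT_sim x y p q : LT p q -> sdom (x - p) p -> sdom (y - q) q -> LT x y.
Proof.
move=> [u [w [g [h [uw u0 gh h1 h2]]]]] xp yq; exists u, w, g, h; split=> //.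
  exact: sim_trans xp h1.
exact: sim_trans yq h2.
Qed.

Lemma k_mul_asymp (K : Mo_model) (u z : K) : u \in mo_k K -> u != 0 ->
  dom (u * z) z /\ dom z (u * z).
Proof.
move=> ku u0; have [->|z0] := eqVneq z 0; first by rewrite mulr0 dom0.
by rewrite -{2 3}[z]mul1r !domMr //; split; [apply: mo_k_dom1 | apply: mo_k_1dom].
Qed.

Lemma leads_asymp x y u w g h : leads x y u w g h ->
  [/\ dom x (mo_s g), dom (mo_s g) x, dom y (mo_s h) & dom (mo_s h) y].
Proof.
move=> [uw u0 gh h1 h2]; have [ku kw] := Psi_k emb uw.
have w0 : w != 0 by rewrite -(Psi_eq0 emb uw).
have [a1 a2] := k_mul_asymp (mo_s g) ku u0; have [b1 b2] := k_mul_asymp (mo_s h) kw w0.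
have [c1 c2] := sdom_sub h1; have [d1 d2] := sdom_sub h2.
by split; [apply: dom_trans c1 a1 | apply: dom_trans a2 c2
  | apply: dom_trans d1 b1 | apply: dom_trans b2 d2].
Qed.

Lemma dom_s (K : Mo_model) (g h : vgroup K) : dom (mo_s g) (mo_s h) = (h <= g).
Proof. by rewrite domE ?mo_s_neq0 // !mo_sK. Qed.

(** The four elements have the valuations of their [mo_s] factors, and [iota] preserves the order of
    these. *)
Lemma LT_dom x y x' y' : LT x y -> LT x' y' -> dom x x' = dom y y'.
Proof.
move=> [u [w [g [h l]]]] [u' [w' [g' [h' l']]]].
have [x1 x2 y1 y2] := leads_asymp l; have [x1' x2' y1' y2'] := leads_asymp l'.
have [_ _ gh _ _] := l; have [_ _ gh' _ _] := l'.
have -> : dom x x' = dom (mo_s g) (mo_s g').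
  by apply/idP/idP => d; [apply: dom_trans x2 (dom_trans d x1')
    | apply: dom_trans x1 (dom_trans d x2')].
have -> : dom y y' = dom (mo_s h) (mo_s h').
  by apply/idP/idP => d; [apply: dom_trans y2 (dom_trans d y1')
    | apply: dom_trans y1 (dom_trans d y2')].
by rewrite !dom_s (iota_le emb gh' gh).
Qed.

(* A partial isomorphism from F to L, as a subfield of F x L. *)
Record giso (R : F -> L -> Prop) : Prop := GIso {
  giso1 : R 1 1;
  gisoB : forall x y x' y', R x y -> R x' y' -> R (x - x') (y - y');
  gisoM : forall x y x' y', R x y -> R x' y' -> R (x * x') (y * y');
  gisoV : forall x y, R x y -> R x^-1 y^-1;
  giso_der : forall x y, R x y -> R (der x) (der y);
  giso_LT : forall x y, R x y -> (x = 0 /\ y = 0) \/ LT x y }.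

(** * Quotients of a ring of corresponding elements *)

Section Fractions.
Variable A : F -> L -> Prop.
Hypotheses (A1 : A 1 1) (AN1 : A (-1) (-1)).
Hypothesis AD : forall x y x' y', A x y -> A x' y' -> A (x + x') (y + y').
Hypothesis AM : forall x y x' y', A x y -> A x' y' -> A (x * x') (y * y').
Hypothesis Ader : forall x y, A x y -> A (der x) (der y).
Hypothesis ALT : forall x y, A x y -> (x = 0 /\ y = 0) \/ LT x y.

(** Denominators are asked to have corresponding leading terms, which makes them nonzero on both
    sides at once. *)
Definition fracR x y := exists p q p' q',
  [/\ A p q, A p' q', LT p' q', x = p / p' & y = q / q'].

Lemma sub_fracR x y : A x y -> fracR x y.
Proof.
have LT1 : LT 1 1 by case: (ALT A1) => [[/eqP]|//]; rewrite oner_eq0.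
by move=> Axy; exists x, y, 1, 1; rewrite !divr1.
Qed.

Lemma giso_fracR : giso fracR.
Proof.
have AM2 x y : A x y -> A (x ^+ 2) (y ^+ 2) by move=> h; rewrite !expr2; apply: AM.
have LT2 x y : LT x y -> LT (x ^+ 2) (y ^+ 2) by move=> h; rewrite !expr2; apply: LT_mul.
have AN x y : A x y -> A (- x) (- y) by move=> h; rewrite -mulN1r -[- y]mulN1r; apply: AM.
split.
- exact: sub_fracR.
- move=> x y x' y' [p [q [r [t [pq rt lt -> ->]]]]] [p' [q' [r' [t' [pq' rt' lt' -> ->]]]]].
  have [[r0 t0] [r0' t0']] := (LT_neq0 lt, LT_neq0 lt').
  exists (p * r' - p' * r), (q * t' - q' * t), (r * r'), (t * t').
  split; [ | by apply: AM | by apply: LT_mul | |].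
  + by apply: AD; [|apply: AN]; apply: AM.
  + by rewrite -mulNr addf_div // mulNr.
  + by rewrite -mulNr addf_div // mulNr.
- move=> x y x' y' [p [q [r [t [pq rt lt -> ->]]]]] [p' [q' [r' [t' [pq' rt' lt' -> ->]]]]].
  exists (p * p'), (q * q'), (r * r'), (t * t').
  split; [by apply: AM | by apply: AM | by apply: LT_mul | |]; by rewrite mulf_div.
- move=> x y [p [q [r [t [pq rt lt -> ->]]]]].
  (* A zero numerator is inverted by the convention 0^-1 = 0. *)
  case: (ALT pq) => [[p0 q0]|lpq]; last by exists r, t, p, q; rewrite !invf_div.
  exists p, q, 1, 1; split=> //; first by case: (ALT A1) => [[/eqP]|//]; rewrite oner_eq0.
    by rewrite p0 !mul0r invr0.
  by rewrite q0 !mul0r invr0.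
- move=> x y [p [q [r [t [pq rt lt -> ->]]]]]; have [r0 t0] := LT_neq0 lt.
  exists (der p * r - p * der r), (der q * t - q * der t), (r ^+ 2), (t ^+ 2).
  split; [ | exact: AM2 | exact: LT2 | |].
  + by apply: AD; [|apply: AN]; apply: AM => //; apply: Ader.
  + by rewrite der_div //; field.
  + by rewrite der_div //; field.
- move=> x y [p [q [r [t [pq rt lt -> ->]]]]].
  case: (ALT pq) => [[-> ->]|lpq]; first by left; rewrite !mul0r.
  by right; apply: LT_mul lpq (LT_inv lt).
Qed.

End Fractions.

(** * Adjoining the lift and the cross-section *)

Section BaseExtension.
Variable R : F -> L -> Prop.
Hypotheses (R1 : R 1 1)
  (RB : forall x y x' y', R x y -> R x' y' -> R (x - x') (y - y'))
  (RM : forall x y x' y', R x y -> R x' y' -> R (x * x') (y * y'))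
  (RV : forall x y, R x y -> R x^-1 y^-1)
  (Rder : forall x y, R x y -> R (der x) (der y)).
(** Leading terms correspond, and moreover their two factors belong to R itself; the ratios used to
    absorb a cancelling term therefore stay in R. *)
Hypothesis RLT : forall x y, R x y -> (x = 0 /\ y = 0) \/
  exists u w g h, [/\ leads x y u w g h, R u w & R (mo_s g) (mo_s h)].

Lemma iota_eq g h g' h' : iota g h -> iota g' h' -> (g == g') = (h == h').
Proof.
by move=> gh gh'; rewrite !eq_le (iota_le emb gh gh') (iota_le emb gh' gh).
Qed.

Definition valid_terms (I : finType) (e : I -> F * L) (k : I -> F * L)
    (g : I -> vgroup F * vgroup L) :=
  forall i, [/\ R (e i).1 (e i).2, Psi (k i).1 (k i).2 & iota (g i).1 (g i).2].

(* The elements e k s(g) of a sum with equal minimal valuation are compared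
   through their leading coefficients; if these cancel, one of the terms can be
   absorbed into the others. *)
Lemma sum_LT (I : finType) (S : {set I}) (e k : I -> F * L) g :
  valid_terms e k g ->
  let x := \sum_(i in S) (e i).1 * (k i).1 * mo_s (g i).1 in
  let y := \sum_(i in S) (e i).2 * (k i).2 * mo_s (g i).2 in
  (x = 0 /\ y = 0) \/ LT x y.
Proof.
have [m] := ubnP #|S|; elim: m S e => // m IH S e; rewrite ltnS => Sm val x y.
have drop i : i \in S -> (e i).1 * (k i).1 * mo_s (g i).1 = 0 ->
    (e i).2 * (k i).2 * mo_s (g i).2 = 0 -> (x = 0 /\ y = 0) \/ LT x y.
  move=> iS z1 z2.
  have -> : x = \sum_(j in S :\ i) (e j).1 * (k j).1 * mo_s (g j).1.
    by rewrite /x (big_setD1 i) //= z1 add0r.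
  have -> : y = \sum_(j in S :\ i) (e j).2 * (k j).2 * mo_s (g j).2.
    by rewrite /y (big_setD1 i) //= z2 add0r.
  by apply: IH val; apply: leq_trans Sm; rewrite [in leqRHS](cardsD1 i) iS.
have [i0 i0S|S0] := pickP (mem S); last first.
  by left; rewrite /x /y !big_pred0.
have [[i [iS]]|nz] := pselect (exists i, i \in S /\ ((e i).1 == 0) || ((k i).1 == 0)).
  have [Ri Pi gi] := val i; have kz := Psi_eq0 emb Pi.
  case/orP=> [/eqP e0|/eqP k0]; apply: (drop i iS).
  - by rewrite e0 !mul0r.
  - case: (RLT Ri) => [[_ ->]|[u [w [a [b [[_ _ _ s1 _] _ _]]]]]]; first by rewrite !mul0r.
    by have := sim_neq0 s1; rewrite e0 eqxx.
  - by rewrite k0 mulr0 mul0r.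
  - by move: kz; rewrite k0 eqxx => /esym/eqP ->; rewrite mulr0 mul0r.
have enz i : i \in S -> (e i).1 != 0.
  by move=> iS; apply/negP => h; apply: nz; exists i; rewrite iS h.
have knz i : i \in S -> (k i).1 != 0.
  by move=> iS; apply/negP => h; apply: nz; exists i; rewrite iS h orbT.
pose PL i (q : (F * L) * (vgroup F * vgroup L)) := i \in S ->
  [/\ leads (e i).1 (e i).2 q.1.1 q.1.2 q.2.1 q.2.2, R q.1.1 q.1.2 &
      R (mo_s q.2.1) (mo_s q.2.2)].
have PLex i : exists q, PL i q.
  case: (boolP (i \in S)) => iS; last by exists ((0, 0), (0, 0)); rewrite /PL (negPf iS).
  have [Ri _ _] := val i; case: (RLT Ri) => [[h _]|[u [w [a [b h]]]]].
    by have := enz i iS; rewrite h eqxx.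
  by exists ((u, w), (a, b)).
have [q qP] := boolp.choice PLex.
pose u i := (q i).1; pose a i := (q i).2.
(* The value of the i-th term on either side: [k i] is now a unit, so only [e i] and [g i]
   contribute. *)
pose d i := (a i).1 + (g i).1; pose d' i := (a i).2 + (g i).2.
have dd i : i \in S -> iota (d i) (d' i).
  by move=> iS; have [[_ _ ab _ _] _ _] := qP i iS; have [_ _ gi] := val i; apply: iotaD.
have tl1 i : i \in S -> sdom ((e i).1 * (k i).1 * mo_s (g i).1
     - (u i).1 * (k i).1 * mo_s (d i)) ((u i).1 * (k i).1 * mo_s (d i)).
  move=> iS; have [[_ _ _ s1 _] _ _] := qP i iS; rewrite -mulrA.
  have -> : (u i).1 * (k i).1 * mo_s (d i) =
     ((u i).1 * mo_s (a i).1) * ((k i).1 * mo_s (g i).1) by rewrite mo_sD mulrACA.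
  by apply: sim_mul s1 _; rewrite sim_refl // mulf_neq0 ?mo_s_neq0 ?knz.
have tl2 i : i \in S -> sdom ((e i).2 * (k i).2 * mo_s (g i).2
     - (u i).2 * (k i).2 * mo_s (d' i)) ((u i).2 * (k i).2 * mo_s (d' i)).
  move=> iS; have [[_ _ _ _ s1] _ _] := qP i iS; rewrite -mulrA.
  have -> : (u i).2 * (k i).2 * mo_s (d' i) =
     ((u i).2 * mo_s (a i).2) * ((k i).2 * mo_s (g i).2) by rewrite mo_sD mulrACA.
  apply: sim_mul s1 _; rewrite sim_refl // mulf_neq0 ?mo_s_neq0 //.
  by have [_ Pi _] := val i; rewrite -(Psi_eq0 emb Pi) knz.
have [j0 j0S jmin] : exists2 j, j \in S & forall i, i \in S -> d j <= d i.
  have [|j jS h] := @dom_max F _ (enum S) (fun i => mo_s (d i)) i0.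
    by rewrite mem_enum.
  exists j; first by rewrite -mem_enum.
  by move=> i iS; rewrite -dom_s; apply: h; rewrite mem_enum.
pose J := [set i in S | d i == d j0].
have j0J : j0 \in J by rewrite inE j0S eqxx.
have JS i : i \in J -> i \in S by rewrite inE => /andP[].
have Jd i : i \in J -> d i = d j0 by rewrite inE => /andP[_ /eqP].
have Jd' i : i \in J -> d' i = d' j0.
  by move=> iJ; apply/eqP; rewrite -(iota_eq (dd i (JS i iJ)) (dd j0 j0S)) Jd.
(* J collects the terms of minimal value; U and W are the candidate leading coefficients of the two
   sums, and [Psi] relates them. *)
pose U := \sum_(i in J) (u i).1 * (k i).1; pose W := \sum_(i in J) (u i).2 * (k i).2.
have PsiD x1 y1 x2 y2 : Psi x1 y1 -> Psi x2 y2 -> Psi (x1 + x2) (y1 + y2).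
  move=> h1 h2; have := PsiB emb h1 (PsiB emb (PsiB emb h2 h2) h2).
  by rewrite !subrr !sub0r !opprK.
have Psi0 : Psi 0 0 by have := PsiB emb (Psi1 emb) (Psi1 emb); rewrite !subrr.
have UW : Psi U W.
  apply: (big_ind2 Psi) => [//|*|i /JS iS]; first exact: PsiD.
  have [[uw _ _ _ _] _ _] := qP i iS.
  by have [_ Pi _] := val i; apply: PsiM.
have uk1 i : i \in S -> (u i).1 * (k i).1 \in mo_k F /\ (u i).1 * (k i).1 != 0.
  move=> iS; have [[uw u0 _ _ _] _ _] := qP i iS; have [_ Pi _] := val i.
  split; last by rewrite mulf_neq0 // knz.
  by rewrite mo_kM //; [have [] := Psi_k emb uw | have [] := Psi_k emb Pi].
have uk2 i : i \in S -> (u i).2 * (k i).2 \in mo_k L /\ (u i).2 * (k i).2 != 0.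
  move=> iS; have [[uw u0 _ _ _] _ _] := qP i iS; have [_ Pi _] := val i.
  split; last by rewrite mulf_neq0 // -?(Psi_eq0 emb uw) // -(Psi_eq0 emb Pi) knz.
  by rewrite mo_kM //; [have [] := Psi_k emb uw | have [] := Psi_k emb Pi].
have SJ (V : nmodType) (G : I -> V) :
    \sum_(i in S | i \in J) G i = \sum_(i in J) G i.
  by apply: eq_bigl => i; rewrite inE; case: (i \in S).
(* Without cancellation the sum has leading term U s(d j0), as the terms outside J have larger
   value. *)
have [U0|U0] := eqVneq U 0; last first.
  right; exists U, W, (d j0), (d' j0).
  have W0 : W != 0 by rewrite -(Psi_eq0 emb UW).
  have [kU kW] := Psi_k emb UW.
  split=> //; first exact: dd.
  - apply: sdom_dom_trans (k_mul_asymp (mo_s (d j0)) kU U0).2.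
    rewrite /x (bigID (mem J)) /= addrAC; apply: sdomD.
      rewrite SJ mulr_suml -sumrB; apply: sdom_sum => [|i iJ]; first exact: mo_s_neq0.
      rewrite -(Jd i iJ); apply: sdom_dom_trans (tl1 i (JS i iJ)) _.
      by have [kuk nz0] := uk1 i (JS i iJ); exact: (k_mul_asymp _ kuk nz0).1.
    apply: sdom_sum => [|i /andP[iS iJ]]; first exact: mo_s_neq0.
    apply: dom_sdom_trans (sdom_sub (tl1 i iS)).1 _.
    have [kuk nz0] := uk1 i iS; apply: dom_sdom_trans (k_mul_asymp _ kuk nz0).1 _.
    rewrite /sdom dom_s; apply: contra iJ => le; rewrite inE iS /=.
    by rewrite eq_le le jmin.
  - apply: sdom_dom_trans (k_mul_asymp (mo_s (d' j0)) kW W0).2.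
    rewrite /y (bigID (mem J)) /= addrAC; apply: sdomD.
      rewrite SJ mulr_suml -sumrB; apply: sdom_sum => [|i iJ]; first exact: mo_s_neq0.
      rewrite -(Jd' i iJ); apply: sdom_dom_trans (tl2 i (JS i iJ)) _.
      by have [kuk nz0] := uk2 i (JS i iJ); exact: (k_mul_asymp _ kuk nz0).1.
    apply: sdom_sum => [|i /andP[iS iJ]]; first exact: mo_s_neq0.
    apply: dom_sdom_trans (sdom_sub (tl2 i iS)).1 _.
    have [kuk nz0] := uk2 i iS; apply: dom_sdom_trans (k_mul_asymp _ kuk nz0).1 _.
    rewrite /sdom dom_s -(iota_le emb (dd i iS) (dd j0 j0S)).
    by apply: contra iJ => le; rewrite inE iS /= eq_le le jmin.
have W0 : W = 0 by apply/eqP; rewrite -(Psi_eq0 emb UW) U0.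
(* The relation U = 0 expresses [k j0] through the other [k i] with i in J, and equality of values
   in J rewrites s(g j0) as s(a i) s(g i) / s(a j0). The term j0 is thus spread over the others,
   whose coefficients decrease by [c1 i]. *)
pose c1 i := (e j0).1 * ((u i).1 / (u j0).1) * (mo_s (a i).1 / mo_s (a j0).1).
pose c2 i := (e j0).2 * ((u i).2 / (u j0).2) * (mo_s (a i).2 / mo_s (a j0).2).
pose e' i := if i \in J then ((e i).1 - c1 i, (e i).2 - c2 i) else e i.
have [[uwj uj0 _ _ _] Ruj Raj] := qP j0 j0S.
have wj0 : (u j0).2 != 0 by rewrite -(Psi_eq0 emb uwj).
have val' : valid_terms e' k g.
  move=> i; have [Ri Pi gi] := val i; split=> //; rewrite /e'; case: ifP => // iJ /=.
  have [_ Rui Rai] := qP i (JS i iJ); have [Rj _ _] := val j0.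
  apply: RB Ri _; apply: (RM (RM Rj (RM Rui (RV Ruj))) (RM Rai (RV Raj))).
have S'm : (#|S :\ j0| < m)%N.
  by apply: leq_trans Sm; rewrite [in leqRHS](cardsD1 j0) j0S.
(* Stated for an arbitrary model, as it is applied in F and in L. *)
have absorb (K : Mo_model) (ee kk uu : I -> K) (gg aa : I -> vgroup K) :
    uu j0 != 0 -> \sum_(i in J) uu i * kk i = 0 ->
    (forall i, i \in J -> aa i + gg i = aa j0 + gg j0) ->
    \sum_(i in S) ee i * kk i * mo_s (gg i) =
    \sum_(i in S :\ j0) (if i \in J then
      ee i - ee j0 * (uu i / uu j0) * (mo_s (aa i) / mo_s (aa j0)) else ee i)
      * kk i * mo_s (gg i).
  move=> uu0 sum0 Jagg.
  have -> : \sum_(i in S :\ j0) (if i \in J then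
      ee i - ee j0 * (uu i / uu j0) * (mo_s (aa i) / mo_s (aa j0)) else ee i)
      * kk i * mo_s (gg i) = \sum_(i in S :\ j0) ee i * kk i * mo_s (gg i) -
      \sum_(i in J :\ j0) ee j0 * (uu i / uu j0) * (mo_s (aa i) / mo_s (aa j0))
        * kk i * mo_s (gg i).
    have -> : \sum_(i in J :\ j0) ee j0 * (uu i / uu j0) * (mo_s (aa i) / mo_s (aa j0))
        * kk i * mo_s (gg i) = \sum_(i in S :\ j0) (if i \in J then
        ee j0 * (uu i / uu j0) * (mo_s (aa i) / mo_s (aa j0)) * kk i * mo_s (gg i) else 0).
      rewrite -big_mkcondr /=; apply: eq_bigl => i; rewrite !inE.
      by case: (i \in S); rewrite ?andbF // andbT.
    rewrite -sumrB; apply: eq_bigr => i _; case: ifP => _; last by rewrite subr0.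
    by rewrite !mulrBl.
  rewrite (big_setD1 j0) //= addrC; congr (_ + _).
  have -> : \sum_(i in J :\ j0) ee j0 * (uu i / uu j0) * (mo_s (aa i) / mo_s (aa j0))
        * kk i * mo_s (gg i) = ee j0 / uu j0 * mo_s (gg j0) * \sum_(i in J :\ j0) uu i * kk i.
    rewrite mulr_sumr; apply: eq_bigr => i; rewrite inE => /andP[_ iJ].
    have : mo_s (aa i) * mo_s (gg i) = mo_s (aa j0) * mo_s (gg j0).
      by rewrite -!mo_sD Jagg.
    have sa0 := mo_s_neq0 (aa j0); have su0 : uu j0 != 0 by [].
    move=> E; have -> : mo_s (gg j0) = mo_s (aa i) * mo_s (gg i) / mo_s (aa j0).
      by rewrite E mulrC mulKf.
    by field; rewrite sa0 su0.
  move/eqP: sum0; rewrite (big_setD1 j0) //= addrC addr_eq0 => /eqP ->.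
  by field.
have [] := IH (S :\ j0) e' S'm val'.
  rewrite /x /y (absorb F (fun i => (e i).1) (fun i => (k i).1) (fun i => (u i).1)
    (fun i => (g i).1) (fun i => (a i).1)) //.
  rewrite (absorb L (fun i => (e i).2) (fun i => (k i).2) (fun i => (u i).2)
    (fun i => (g i).2) (fun i => (a i).2)) //.
  move=> [h1 h2]; left; split.
    by rewrite -[RHS]h1; apply: eq_bigr => i _; rewrite /e'; case: ifP.
  by rewrite -[RHS]h2; apply: eq_bigr => i _; rewrite /e'; case: ifP.
move=> lt; right.
rewrite /x /y (absorb F (fun i => (e i).1) (fun i => (k i).1) (fun i => (u i).1)
  (fun i => (g i).1) (fun i => (a i).1)) //.
rewrite (absorb L (fun i => (e i).2) (fun i => (k i).2) (fun i => (u i).2)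
  (fun i => (g i).2) (fun i => (a i).2)) //.
move: lt; congr LT; apply: eq_bigr => i _; rewrite /e'; by case: ifP.
Qed.

(** Such sums already exhaust the ring generated by R, the lift and the cross-section, because s is
    multiplicative. *)
Definition sumsR x y := exists (I : finType) (e k : I -> F * L) g,
  [/\ valid_terms e k g, x = \sum_i (e i).1 * (k i).1 * mo_s (g i).1 &
      y = \sum_i (e i).2 * (k i).2 * mo_s (g i).2].

Lemma sums_term x y k l g h : R x y -> Psi k l -> iota g h ->
  sumsR (x * k * mo_s g) (y * l * mo_s h).
Proof.
move=> xy kl gh; exists (unit : finType), (fun=> (x, y)), (fun=> (k, l)), (fun=> (g, h)).
by split=> //; rewrite big_const card_unit /= addr0.
Qed.

Lemma sums_R x y : R x y -> sumsR x y.
Proof.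
move=> xy; have := sums_term xy (Psi1 emb) (iota0 emb).
by rewrite !mo_s0 !mulr1.
Qed.

Lemma sums_Psi x y : Psi x y -> sumsR x y.
Proof.
move=> xy; have := sums_term R1 xy (iota0 emb).
by rewrite !mo_s0 !mulr1 !mul1r.
Qed.

Lemma sums_iota g h : iota g h -> sumsR (mo_s g) (mo_s h).
Proof.
move=> gh; have := sums_term R1 (Psi1 emb) gh.
by rewrite !mul1r.
Qed.

Lemma sumsD x y x' y' : sumsR x y -> sumsR x' y' -> sumsR (x + x') (y + y').
Proof.
move=> [I [e [k [g [val -> ->]]]]] [I' [e' [k' [g' [val' -> ->]]]]].
pose glue T (s : I -> T) (s' : I' -> T) (j : I + I') :=
  match j with inl i => s i | inr i => s' i end.
exists (I + I')%type, (glue _ e e'), (glue _ k k'), (glue _ g g').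
by split; [case=> i; [have := val i | have := val' i] | rewrite big_sumType | rewrite big_sumType].
Qed.

Lemma sumsM x y x' y' : sumsR x y -> sumsR x' y' -> sumsR (x * x') (y * y').
Proof.
move=> [I [e [k [g [val -> ->]]]]] [I' [e' [k' [g' [val' -> ->]]]]].
exists (I * I')%type, (fun j => ((e j.1).1 * (e' j.2).1, (e j.1).2 * (e' j.2).2)),
  (fun j => ((k j.1).1 * (k' j.2).1, (k j.1).2 * (k' j.2).2)),
  (fun j => ((g j.1).1 + (g' j.2).1, (g j.1).2 + (g' j.2).2)).
split=> [[i i']||] /=.
- have [h1 h2 h3] := val i; have [h1' h2' h3'] := val' i'.
  by split; [apply: RM | apply: PsiM | apply: iotaD].
- rewrite big_distrlr /= pair_big /=; apply: eq_bigr => j _.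
  by rewrite mo_sD !mulrA; ring.
- rewrite big_distrlr /= pair_big /=; apply: eq_bigr => j _.
  by rewrite mo_sD !mulrA; ring.
Qed.

(** The derivative of s(g) is c(g) s(g) with c(g) in the lift, so the generated ring is
    differential; the compatibility of the embeddings with c is used here. *)
Lemma sums_der x y : sumsR x y -> sumsR (der x) (der y).
Proof.
move=> [I [e [k [g [val -> ->]]]]].
have Psi0 : Psi 0 0 by have := PsiB emb (Psi1 emb) (Psi1 emb); rewrite !subrr.
rewrite !(big_morph _ (@derD _) (der0 _)).
apply: (big_ind2 sumsR); [exact: sums_Psi | exact: sumsD | move=> i _].
have [Ri Pi gi] := val i; rewrite !derM !mo_ders.
apply: sumsD.
  apply: sumsM; last exact: sums_iota.
  apply: sumsD; apply: sumsM.
  - by apply: sums_R; apply: Rder.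
  - exact: sums_Psi.
  - exact: sums_R.
  - by apply: sums_Psi; apply: Psi_der.
apply: sumsM; first by apply: sumsM; [apply: sums_R | apply: sums_Psi].
by apply: sumsM; [apply: sums_Psi; apply: iota_c | apply: sums_iota].
Qed.

Lemma giso_base : exists R', [/\ giso R', forall x y, R x y -> R' x y,
  forall x y, Psi x y -> R' x y & forall g h, iota g h -> R' (mo_s g) (mo_s h)].
Proof.
have sN1 : sumsR (-1) (-1).
  have := PsiB emb (PsiB emb (Psi1 emb) (Psi1 emb)) (Psi1 emb).
  by rewrite !subrr !sub0r => /sums_Psi.
have sLT x y : sumsR x y -> (x = 0 /\ y = 0) \/ LT x y.
  move=> [I [e [k [g [val -> ->]]]]]; have := sum_LT [set: I] val.
  have inT (V : nmodType) (G : I -> V) : \sum_(i in [set: I]) G i = \sum_i G i.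
    by apply: eq_bigl => i; rewrite inE.
  by rewrite /= !inT.
have s1 := sums_R R1.
exists (fracR sumsR); split.
- exact: giso_fracR s1 sN1 sumsD sumsM sums_der sLT.
- by move=> x y xy; apply: sub_fracR => //; apply: sums_R.
- by move=> x y xy; apply: sub_fracR => //; apply: sums_Psi.
- by move=> g h gh; apply: sub_fracR => //; apply: sums_iota.
Qed.

End BaseExtension.

End Embedding.

(** * Extending a partial isomorphism *)

Section Domain.
Variables (F L : Mo_model) (Psi : F -> L -> Prop) (iota : vgroup F -> vgroup L -> Prop).
Hypothesis emb : kG_embedding Psi iota.
Variables (R : F -> L -> Prop) (gR : giso Psi iota R).

Definition gdom : {pred F} := fun x => `[< exists y, R x y >].

Fact gdom_divring : divring_closed gdom.
Proof.
split; first by apply/asboolP; exists 1; apply: giso1 gR.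
- move=> x y /asboolP[x' xx'] /asboolP[y' yy']; apply/asboolP.
  by exists (x' - y'); apply: (gisoB gR).
- move=> x y /asboolP[x' xx'] /asboolP[y' yy']; apply/asboolP.
  by exists (x' / y'); apply: (gisoM gR xx' (gisoV gR yy')).
Qed.

HB.instance Definition _ := GRing.isDivringClosed.Build F gdom gdom_divring.

(** The domain of R as a field of its own, with the inclusion into F and [gimage] into L as two
    embeddings that induce the same valuation. *)
Record gfield : Type := GField { gfield_val : F; _ : gfield_val \in gdom }.

HB.instance Definition _ := [isSub for gfield_val].
HB.instance Definition _ := [Choice of gfield by <:].
HB.instance Definition _ := [SubChoice_isSubIntegralDomain of gfield by <:].
HB.instance Definition _ := [SubIntegralDomain_isSubField of gfield by <:].

Lemma gdomP (x : gfield) : exists y, R (val x) y.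
Proof. exact/asboolP/(valP x). Qed.

Lemma gdom_der (x : gfield) : der (val x) \in gdom.
Proof.
by have [y xy] := gdomP x; apply/asboolP; exists (der y); apply: (giso_der gR).
Qed.

Definition gder (x : gfield) : gfield := GField (gdom_der x).

Definition gimage (x : gfield) : L := sval (cid (gdomP x)).

Lemma gimageP x : R (val x) (gimage x).
Proof. exact: svalP (cid (gdomP x)). Qed.

Lemma giso0 : R 0 0.
Proof. by have := gisoB gR (giso1 gR) (giso1 gR); rewrite !subrr. Qed.

(** R pairs 0 with the difference of two images of x, and 0 has no leading term. *)
Lemma giso_fun x y y' : R x y -> R x y' -> y = y'.
Proof.
move=> xy xy'; have := gisoB gR xy xy'; rewrite subrr => /(giso_LT gR)[[_ /eqP]|].
  by rewrite subr_eq0 => /eqP.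
by move/(LT_neq0)=> []; rewrite eqxx.
Qed.

Lemma gimage_eq x y : R (val x) y -> gimage x = y.
Proof. exact: giso_fun (gimageP x). Qed.

Fact gimage_zmod_morphism : zmod_morphism gimage.
Proof.
move=> x y; apply: gimage_eq; rewrite rmorphB.
by apply: (gisoB gR); apply: gimageP.
Qed.

Fact gimage_monoid_morphism : monoid_morphism gimage.
Proof.
split; first by apply: gimage_eq; rewrite rmorph1; apply: giso1 gR.
move=> x y; apply: gimage_eq; rewrite rmorphM.
by apply: (gisoM gR); apply: gimageP.
Qed.

HB.instance Definition _ :=
  GRing.isZmodMorphism.Build gfield L gimage gimage_zmod_morphism.
HB.instance Definition _ :=
  GRing.isMonoidMorphism.Build gfield L gimage gimage_monoid_morphism.
HB.instance Definition _ :=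
  GRing.RMorphism.copy gfield_val (\val : {rmorphism gfield -> F}).

Lemma gimage_der x : gimage (gder x) = der (gimage x).
Proof. by apply: gimage_eq; apply: (giso_der gR); apply: gimageP. Qed.

Lemma giso_dom x y x' y' : R x y -> R x' y' -> dom x x' = dom y y'.
Proof.
move=> xy xy'; case: (giso_LT gR xy) => [[-> ->]|l]; first by rewrite !dom0.
case: (giso_LT gR xy') => [[-> ->]|l']; last exact: (LT_dom emb l l').
by rewrite !domx0; case: (LT_neq0 l) => /negPf -> /negPf ->.
Qed.

Lemma gimage_dom (x y : gfield) :
  dom (gfield_val x) (gfield_val y) = dom (gimage x) (gimage y).
Proof. by apply: giso_dom; apply: gimageP. Qed.

Hypothesis R_Psi : forall x y, Psi x y -> R x y.
Hypothesis R_iota : forall g h, iota g h -> R (mo_s g) (mo_s h).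
Hypotheses (hF : d_henselian F) (hL : d_henselian L).

(** A form of spherical completeness for countable families of balls; saturation provides it, and it
    yields pseudolimits in L. *)
Definition ball_complete (K : Mo_model) := forall c r : nat -> K,
  (forall J, exists x, forall j, (j < J)%N -> dom (x - c j) (r j)) ->
  exists x, forall j, dom (x - c j) (r j).

Hypothesis balls : ball_complete L.
Variable enum_F : nat -> F.
Hypothesis enum_F_surj : forall x, exists n, enum_F n = x.

(** As the domain contains the lift and the cross-section, it contains the leading term of a - e for
    each of its elements e; so no e is closest to a. The conclusion promises some new b and not a
    itself, because the algebraic case replaces a by a zero of the minimal unstable polynomial. *)
Lemma giso_extend a : a \notin gdom -> exists R',
  [/\ giso Psi iota R', forall x y, R x y -> R' x y & exists b b', R' b b' /\ b \notin gdom].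
Proof.
move=> aE.
have sub0 (e : gfield) : a - gfield_val e != 0.
  by rewrite subr_eq0; apply: contraNneq aE => ->; apply: valP.
have sE g : mo_s g \in gdom.
  by apply/asboolP; have [h gh] := iota_total emb g; exists (mo_s h); apply: R_iota.
have kE u : u \in mo_k F -> u \in gdom.
  by move=> ku; apply/asboolP; have [w uw] := Psi_total emb ku; exists w; apply: R_Psi.
pose near1 := near gfield_val a.
pose gg e : gfield := GField (sE (val0 (a - gfield_val e))).
have ggP e : near1 e (gg e) by have [] := asymp_s (sub0 e).
(* Adding to e the leading term of a - e gives an element strictly closer to a. *)
have nomax1 e : exists e', sdom (a - gfield_val e') (a - gfield_val e).
  have [u ku [u0 h]] := leading_coef (sub0 e).
  pose d : gfield := GField (kE _ ku) * gg e.
  by exists (e + d); rewrite rmorphD rmorphM /= opprD addrA.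
have sdom12 x y : sdom (gfield_val x) (gfield_val y) = sdom (gimage x) (gimage y).
  by rewrite /sdom gimage_dom.
(* An enumeration of the domain, with 0 in place of the elements of F outside it. *)
pose c j : gfield := insubd 0 (enum_F j).
have c_surj e : exists j, c j = e.
  by have [j je] := enum_F_surj (gfield_val e); exists j; rewrite /c je valKd.
have [J|a2 a2P] := balls (c := fun j => gimage (c j)) (r := fun j => gimage (gg (c j))).
  (* An element of the domain at least as close to a as the first J centres lies in all their
     balls. *)
  have [e eP] : exists e, forall j, (j < J)%N -> dom (a - gfield_val e) (a - gfield_val (c j)).
    elim: J => [|J [e eP]]; first by exists 0.
    case/orP: (dom_total (a - gfield_val e) (a - gfield_val (c J))) => h.
      by exists e => j; rewrite ltnS leq_eqVlt => /orP[/eqP ->|/eP].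
    exists (c J) => j; rewrite ltnS leq_eqVlt => /orP[/eqP ->|/eP jP].
      exact: dom_refl.
    exact: dom_trans h jP.
  exists (gimage e) => j /eP jP; rewrite -rmorphB -gimage_dom rmorphB.
  have -> : gfield_val e - gfield_val (c j) =
      (a - gfield_val (c j)) - (a - gfield_val e) by rewrite opprB [RHS]addrC addrA subrK.
  have [h _] := ggP (c j).
  by apply: domB => //; apply: dom_trans jP h.
have {}a2P e : dom (a2 - gimage e) (gimage (gg e)) by have [j <-] := c_surj e.
(* The distance from a2 to e is exact and not merely bounded: if a2 were nearer to e, then so would
   be e', which is closer to a than e, and then a would be nearer to e than it is. *)
have a2P' e : dom (gimage (gg e)) (a2 - gimage e).
  have [e' ee'] := nomax1 e; have [h1 h2] := ggP e; have [h1' h2'] := ggP e'.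
  have d1 : sdom (a2 - gimage e') (gimage (gg e)).
    apply: dom_sdom_trans (a2P e') _; rewrite -sdom12.
    by apply: dom_sdom_trans h2' (sdom_dom_trans ee' h1).
  apply/negPn/negP => nd; have {}nd : sdom (a2 - gimage e) (gimage (gg e)) by [].
  have : sdom (gimage (e' - e)) (gimage (gg e)).
    have -> : gimage (e' - e) = (a2 - gimage e) - (a2 - gimage e').
      by rewrite rmorphB opprB [RHS]addrC addrA subrK.
    exact: sdomB.
  rewrite -sdom12 rmorphB => h.
  have : sdom (a - gfield_val e) (a - gfield_val e).
    rewrite -[X in sdom X _](subrK (a - gfield_val e')).
    apply: sdomD => //; apply: sdom_dom_trans h2.
    by rewrite opprB addrC addrA subrK.
  by rewrite sdomxx.
have near12 e g : near gfield_val a e g <-> near gimage a2 e g.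
  have [[h1 h2] [h3 h4]] := (ggP e, conj (a2P e) (a2P' e)).
  split=> -[d1 d2]; split.
  - by apply: dom_trans h3 _; rewrite -gimage_dom; apply: dom_trans h2 d1.
  - by apply: dom_trans _ h4; rewrite -gimage_dom; apply: dom_trans d2 h1.
  - by apply: dom_trans h1 _; rewrite gimage_dom; apply: dom_trans h4 d1.
  - by apply: dom_trans _ h2; rewrite gimage_dom; apply: dom_trans d2 h3.
have near_ex e : exists g, near gfield_val a e g by exists (gg e); apply: ggP.
have gval_der x : gfield_val (gder x) = der (gfield_val x) by [].
have [A [b1 [b2 [[A0 ADM Ader Alt] Ab b1E]]]] := immediate_ext_exists hF hL
  gval_der gimage_der sdom12 near12 near_ex nomax1.
have RA x y : R x y -> A x y.
  move=> xy; have xE : x \in gdom by apply/asboolP; exists y.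
  by rewrite -(gimage_eq (x := GField xE) xy); apply: (A0 (GField xE)).
have AN1 : A (-1) (-1).
  by apply: RA; have := gisoB gR giso0 (giso1 gR); rewrite !sub0r.
have ALT x y : A x y -> (x = 0 /\ y = 0) \/ LT Psi iota x y.
  move=> /Alt[|[p [h1 h2]]]; [by left | right].
  case: (giso_LT gR (gimageP p)) => [[p0 _]|lp]; last exact: LT_sim lp h1 h2.
  by case/eqP: (sdom_neq0 h1).
have A1 := RA _ _ (giso1 gR).
exists (fracR Psi iota A); split.
- apply: giso_fracR => //.
  + by move=> x y x' y' h h'; have [] := ADM _ _ _ _ h h'.
  + by move=> x y x' y' h h'; have [] := ADM _ _ _ _ h h'.
- by move=> x y /RA h; apply: sub_fracR.
- exists b1, b2; split; first exact: sub_fracR.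
  by apply/negP => bE; have := b1E (GField bE); rewrite eqxx.
Qed.

End Domain.

Section EmbeddingTheorem.
Variables (F L : Mo_model) (Psi : F -> L -> Prop) (iota : vgroup F -> vgroup L -> Prop).
Hypothesis emb : kG_embedding Psi iota.
Hypotheses (hF : d_henselian F) (hL : d_henselian L).
Hypothesis balls : ball_complete L.
Variable enum_F : nat -> F.
Hypothesis enum_F_surj : forall x, exists n, enum_F n = x.

(** Zorn's lemma: a maximal partial isomorphism is total, since [giso_extend] enlarges the domain of
    any other. *)
Lemma giso_total R1 : giso Psi iota R1 ->
  (forall x y, Psi x y -> R1 x y) -> (forall g h, iota g h -> R1 (mo_s g) (mo_s h)) ->
  exists R, [/\ giso Psi iota R, forall x y, R1 x y -> R x y & forall x, exists y, R x y].
Proof.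
move=> g1 R1Psi R1iota.
(* Joining R1 to X inside the predicate gives the empty chain an upper bound. *)
pose P (X : set (F * L)) := giso Psi iota (fun x y => X (x, y) \/ R1 x y).
have [|X [PX Xmax]] := @Zorn_bigcup _ P.
  move=> C CP Ctot; pose B x y := (\bigcup_(X in C) X)%classic (x, y) \/ R1 x y.
  have step x y : B x y -> exists2 X, (X = (fun=> False) \/ C X) & X (x, y) \/ R1 x y.
    case=> [[X CX Xxy]|h]; first by exists X; [right | left].
    by exists (fun=> False); [left | right].
  have gX X : (X = (fun=> False) \/ C X) -> giso Psi iota (fun x y => X (x, y) \/ R1 x y).
    case=> [->|/CP//]; have -> // : (fun x y => False \/ R1 x y) = R1.
    by apply/funext => x; apply/funext => y; apply/propext; split; [case | right].
  have XB X x y : (X = (fun=> False) \/ C X) -> X (x, y) \/ R1 x y -> B x y.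
    by case=> [->|CX] [//|h]; [right | left; exists X | right].
  have step2 x y x' y' : B x y -> B x' y' -> exists2 X, (X = (fun=> False) \/ C X) &
      (X (x, y) \/ R1 x y) /\ (X (x', y') \/ R1 x' y').
    move=> /step[X hX Xxy] /step[Y hY Yxy].
    case: hX Xxy => [->|CX] Xxy.
      by exists Y => //; split=> //; case: Xxy => //; right.
    case: hY Yxy => [->|CY] Yxy.
      by exists X; [right | split=> //; case: Yxy => //; right].
    case: (Ctot X Y CX CY) => XY.
      by exists Y; [right | split=> //; case: Xxy => [/XY|]; [left | right]].
    by exists X; [right | split=> //; case: Yxy => [/XY|]; [left | right]].
  split.
  - by right; apply: giso1 g1.
  - move=> x y x' y' h h'; have [X hX [h1 h2]] := step2 _ _ _ _ h h'.
    exact: XB hX (gisoB (gX X hX) h1 h2).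
  - move=> x y x' y' h h'; have [X hX [h1 h2]] := step2 _ _ _ _ h h'.
    exact: XB hX (gisoM (gX X hX) h1 h2).
  - by move=> x y /step[X hX h]; apply: XB hX (gisoV (gX X hX) h).
  - by move=> x y /step[X hX h]; apply: XB hX (giso_der (gX X hX) h).
  - by move=> x y /step[X hX h]; apply: giso_LT (gX X hX) _ _ h.
set R := fun x y => X (x, y) \/ R1 x y in PX.
exists R; split=> // [x y h|a]; first by right.
apply: contrapT => na; have aE : a \notin gdom R by apply/asboolP.
have [||R' [gR' RR' [b [b' [R'b bE]]]]] := giso_extend emb PX _ _ hF hL balls enum_F_surj aE.
- by move=> x y h; right; apply: R1Psi.
- by move=> g h gh; right; apply: R1iota.
pose Y : set (F * L) := fun p => R' p.1 p.2.
apply: (Xmax Y); last first.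
  rewrite /P; have -> // : (fun x y => Y (x, y) \/ R1 x y) = R'.
  apply/funext => x; apply/funext => y; apply/propext; split; last by left.
  by case=> // h; apply: RR'; right.
split=> [|YX]; first by move=> [x y] Xxy; apply: RR'; left.
have : X (b, b') by apply: YX.
by move=> h; move/negP: bE; apply; apply/asboolP; exists b'; left.
Qed.

End EmbeddingTheorem.

(** * Definability in the two-sorted language *)

Section Scons.
Variables (A : Type) (n : nat).

Lemma scons0 (a : A) (e : 'I_n -> A) : scons a e ord0 = a.
Proof. by rewrite /scons unlift_none. Qed.

Lemma sconsS (a : A) (e : 'I_n -> A) i : scons a e (lift ord0 i) = e i.
Proof. by rewrite /scons liftK. Qed.

Lemma scons_lift (a : A) (e : 'I_n -> A) : (fun i => scons a e (lift ord0 i)) = e.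
Proof. by apply/funext => i; rewrite sconsS. Qed.

Lemma scons_eta (e : 'I_n.+1 -> A) : scons (e ord0) (fun i => e (lift ord0 i)) = e.
Proof.
by apply/funext => i; case: (unliftP ord0 i) => [j|] ->; rewrite ?sconsS ?scons0.
Qed.

Lemma scons_comp (B : Type) (h : A -> B) a (e : 'I_n -> A) :
  (fun i => h (scons a e i)) = scons (h a) (fun i => h (e i)).
Proof. by apply/funext => i; rewrite /scons; case: unlift. Qed.

End Scons.

Lemma ord0_fun (A : Type) (e e' : 'I_0 -> A) : e = e'.
Proof. by apply/funext => -[]. Qed.

Definition fAnd atom m n (p q : formula atom m n) :=
  Imp (Imp p (Imp q (Bot atom m n))) (Bot atom m n).

Definition fExK atom m n (p : formula atom m.+1 n) :=
  Imp (AllK (Imp p (Bot atom m.+1 n))) (Bot atom m n).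

Definition fExG atom m n (p : formula atom m n.+1) :=
  Imp (AllG (Imp p (Bot atom m n.+1))) (Bot atom m n).

Section Connectives.
Variables (A B : Type) (atom : nat -> nat -> Type).
Variable I : forall m n, ('I_m -> A) -> ('I_n -> B) -> atom m n -> Prop.

Lemma holds_And m n (p q : formula atom m n) e f :
  holds I (fAnd p q) e f <-> holds I p e f /\ holds I q e f.
Proof.
split=> [h|[hp hq] h]; last exact: h hp hq.
by split; apply: contrapT => h'; apply: h => hp hq; apply: h'.
Qed.

Lemma holds_ExK m n (p : formula atom m.+1 n) e f :
  holds I (fExK p) e f <-> exists a, holds I p (scons a e) f.
Proof.
split=> [h|[a ha] h]; last exact: h a ha.
by apply: contrapT => h'; apply: h => a ha; apply: h'; exists a.
Qed.

Lemma holds_ExG m n (p : formula atom m n.+1) e f :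
  holds I (fExG p) e f <-> exists b, holds I p e (scons b f).
Proof.
split=> [h|[a ha] h]; last exact: h a ha.
by apply: contrapT => h'; apply: h => a ha; apply: h'; exists a.
Qed.

End Connectives.

Section Definable.
Implicit Types m n : nat.

(** Terms and properties are families over all structures, so one formula must serve everywhere;
    this uniformity lets properties pass between elementarily equivalent structures. *)
Definition kfun m n := forall M : L2_structure, ('I_m -> s2_K M) -> ('I_n -> s2_G M) -> s2_K M.
Definition gfun m n := forall M : L2_structure, ('I_m -> s2_K M) -> ('I_n -> s2_G M) -> s2_G M.
Definition pfun m n := forall M : L2_structure, ('I_m -> s2_K M) -> ('I_n -> s2_G M) -> Prop.

Definition kdef m n (t : kfun m n) := exists u, forall M e f, @L2_keval M m n e f u = t M e f.
Definition gdef m n (t : gfun m n) := exists u, forall M e f, @L2_geval M m n e f u = t M e f.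
Definition definable m n (P : pfun m n) :=
  exists p, forall M e f, @holds _ _ _ (@L2_atom_holds M) m n p e f <-> P M e f.

Lemma kdef_var m n i : @kdef m n (fun M e f => e i).
Proof. by exists (Kvar _ i). Qed.

Lemma kdef0 m n : @kdef m n (fun M e f => s2_zero M).
Proof. by exists (Kzero _ _). Qed.

Lemma kdef1 m n : @kdef m n (fun M e f => s2_one M).
Proof. by exists (Kone _ _). Qed.

Lemma kdef_add m n (t u : kfun m n) : kdef t -> kdef u ->
  @kdef m n (fun M e f => s2_add (t M e f) (u M e f)).
Proof. by move=> [t' ht] [u' hu]; exists (Kadd t' u') => M e f /=; rewrite ht hu. Qed.

Lemma kdef_mul m n (t u : kfun m n) : kdef t -> kdef u ->
  @kdef m n (fun M e f => s2_mul (t M e f) (u M e f)).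
Proof. by move=> [t' ht] [u' hu]; exists (Kmul t' u') => M e f /=; rewrite ht hu. Qed.

Lemma kdef_opp m n (t : kfun m n) : kdef t -> @kdef m n (fun M e f => s2_opp (t M e f)).
Proof. by move=> [t' ht]; exists (Kopp t') => M e f /=; rewrite ht. Qed.

Lemma kdef_der m n (t : kfun m n) : kdef t -> @kdef m n (fun M e f => s2_der (t M e f)).
Proof. by move=> [t' ht]; exists (Kder t') => M e f /=; rewrite ht. Qed.

Lemma kdef_s m n (t : gfun m n) : gdef t -> @kdef m n (fun M e f => s2_s (t M e f)).
Proof. by move=> [t' ht]; exists (Ks t') => M e f /=; rewrite ht. Qed.

Lemma kdef_c m n (t : gfun m n) : gdef t -> @kdef m n (fun M e f => s2_c (t M e f)).
Proof. by move=> [t' ht]; exists (Kc t') => M e f /=; rewrite ht. Qed.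

Lemma gdef_var m n i : @gdef m n (fun M e f => f i).
Proof. by exists (Gvar _ i). Qed.

Lemma gdef0 m n : @gdef m n (fun M e f => s2_gzero M).
Proof. by exists (Gzero _ _). Qed.

Lemma gdef_add m n (t u : gfun m n) : gdef t -> gdef u ->
  @gdef m n (fun M e f => s2_gadd (t M e f) (u M e f)).
Proof. by move=> [t' ht] [u' hu]; exists (Gadd t' u') => M e f /=; rewrite ht hu. Qed.

Lemma gdef_opp m n (t : gfun m n) : gdef t -> @gdef m n (fun M e f => s2_gopp (t M e f)).
Proof. by move=> [t' ht]; exists (Gopp t') => M e f /=; rewrite ht. Qed.

Lemma gdef_v m n (t : kfun m n) : kdef t -> @gdef m n (fun M e f => s2_v (t M e f)).
Proof. by move=> [t' ht]; exists (Gv t') => M e f /=; rewrite ht. Qed.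

Lemma def_eqK m n (t u : kfun m n) : kdef t -> kdef u ->
  @definable m n (fun M e f => t M e f = u M e f).
Proof. by move=> [t' ht] [u' hu]; exists (Atom (Keq t' u')) => M e f /=; rewrite ht hu. Qed.

Lemma def_eqG m n (t u : gfun m n) : gdef t -> gdef u ->
  @definable m n (fun M e f => t M e f = u M e f).
Proof. by move=> [t' ht] [u' hu]; exists (Atom (Geq t' u')) => M e f /=; rewrite ht hu. Qed.

Lemma def_le m n (t u : gfun m n) : gdef t -> gdef u ->
  @definable m n (fun M e f => s2_gle (t M e f) (u M e f)).
Proof. by move=> [t' ht] [u' hu]; exists (Atom (Gle t' u')) => M e f /=; rewrite ht hu. Qed.

Lemma def_k m n (t : kfun m n) : kdef t -> @definable m n (fun M e f => s2_k (t M e f)).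
Proof. by move=> [t' ht]; exists (Atom (Kpred t')) => M e f /=; rewrite ht. Qed.

Lemma def_False m n : @definable m n (fun M e f => False).
Proof. by exists (Bot _ _ _). Qed.

Lemma def_imp m n (P Q : pfun m n) : definable P -> definable Q ->
  @definable m n (fun M e f => P M e f -> Q M e f).
Proof. by move=> [p hp] [q hq]; exists (Imp p q) => M e f /=; rewrite hp hq. Qed.

Lemma def_iff m n (P Q : pfun m n) : (forall M e f, P M e f <-> Q M e f) ->
  definable P -> definable Q.
Proof. by move=> h [p hp]; exists p => M e f; rewrite hp h. Qed.

Lemma def_not m n (P : pfun m n) : definable P -> @definable m n (fun M e f => ~ P M e f).
Proof. by move=> dP; apply: def_imp dP (def_False _ _). Qed.

Lemma def_and m n (P Q : pfun m n) : definable P -> definable Q ->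
  @definable m n (fun M e f => P M e f /\ Q M e f).
Proof. by move=> [p hp] [q hq]; exists (fAnd p q) => M e f; rewrite holds_And hp hq. Qed.

Lemma def_or m n (P Q : pfun m n) : definable P -> definable Q ->
  @definable m n (fun M e f => P M e f \/ Q M e f).
Proof.
move=> dP dQ; apply: def_iff (def_imp (def_not dP) dQ) => M e f.
split=> [h|[hP|hQ] //]; have [hP|hP] := pselect (P M e f); first by left.
by right; apply: h.
Qed.

Lemma def_allK m n (P : forall M : L2_structure, s2_K M -> ('I_m -> s2_K M) ->
    ('I_n -> s2_G M) -> Prop) :
  @definable m.+1 n (fun M e f => P M (e ord0) (fun i => e (lift ord0 i)) f) ->
  @definable m n (fun M e f => forall a, P M a e f).
Proof.
move=> [p hp]; exists (AllK p) => M e f /=.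
by split=> h a; have := h a; rewrite hp scons0 scons_lift.
Qed.

Lemma def_allG m n (P : forall M : L2_structure, s2_G M -> ('I_m -> s2_K M) ->
    ('I_n -> s2_G M) -> Prop) :
  @definable m n.+1 (fun M e f => P M (f ord0) e (fun i => f (lift ord0 i))) ->
  @definable m n (fun M e f => forall a, P M a e f).
Proof.
move=> [p hp]; exists (AllG p) => M e f /=.
by split=> h a; have := h a; rewrite hp scons0 scons_lift.
Qed.

Lemma def_exK m n (P : forall M : L2_structure, s2_K M -> ('I_m -> s2_K M) ->
    ('I_n -> s2_G M) -> Prop) :
  @definable m.+1 n (fun M e f => P M (e ord0) (fun i => e (lift ord0 i)) f) ->
  @definable m n (fun M e f => exists a, P M a e f).
Proof.
move=> [p hp]; exists (fExK p) => M e f; rewrite holds_ExK.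
by split=> -[a ha]; exists a; move: ha; rewrite hp scons0 scons_lift.
Qed.

Lemma def_forall (T : finType) m n (P : T -> pfun m n) :
  (forall i, definable (P i)) -> @definable m n (fun M e f => forall i, P i M e f).
Proof.
move=> dP.
suff : definable (fun M e f => forall i, i \in enum T -> P i M e f).
  by apply: def_iff => M e f; split=> h i; [apply: h; rewrite mem_enum | move=> _].
elim: (enum T) => [|i s IH].
  by apply: def_iff (def_imp (def_False m n) (def_False m n)) => M e f.
apply: def_iff (def_and (dP i) IH) => M e f; split=> [[hi hs] j|h].
  by rewrite inE => /orP[/eqP ->|/hs].
by split=> [|j js]; apply: h; rewrite inE ?eqxx // js orbT.
Qed.

Lemma def_exists (T : finType) m n (P : T -> pfun m n) :
  (forall i, definable (P i)) -> @definable m n (fun M e f => exists i, P i M e f).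
Proof.
move=> dP; apply: def_iff (def_not (def_forall (fun i => def_not (dP i)))) => M e f.
split=> [h|[i hi] h]; last exact: h i hi.
by apply: contrapT => h'; apply: h => i hi; apply: h'; exists i.
Qed.

Lemma def_const m n (b : bool) : @definable m n (fun M e f => b).
Proof.
case: b; last by apply: def_iff (def_False m n) => M e f.
by apply: def_iff (def_imp (def_False m n) (def_False m n)) => M e f.
Qed.

(** Universal closure over any number of field variables, for axioms whose number of coefficients is
    a parameter. *)
Lemma def_closeK m n (P : forall M : L2_structure, ('I_m -> s2_K M) ->
    ('I_n -> s2_G M) -> Prop) :
  definable P -> @definable 0 n (fun M e f => forall x, P M x f).
Proof.
elim: m P => [|m IH] P dP.
  apply: def_iff dP => M e f; split=> [h x|h]; last exact: h.
  by rewrite (ord0_fun x e).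
have [p hp] := dP; have dA : definable (fun M e f => forall a, P M (scons a e) f).
  by exists (AllK p) => M e f /=; split=> h a; apply/hp; apply: h.
apply: def_iff (IH _ dA) => M e f; split=> [h x|h x a]; last exact: h.
by rewrite -(scons_eta x); apply: h.
Qed.

End Definable.

(** Builds the formula from the shape of a predicate, so that axioms can be stated as ordinary
    propositions. *)
Ltac def_step :=
  lazymatch goal with
  | |- definable (fun M e f => forall a : s2_K M, _) => apply: def_allK
  | |- definable (fun M e f => forall a : s2_G M, _) => apply: def_allG
  | |- definable (fun M e f => exists a : s2_K M, _) => apply: def_exK
  | |- definable (fun M e f => _ /\ _) => apply: def_and
  | |- definable (fun M e f => _ \/ _) => apply: def_or
  | |- definable (fun M e f => ~ _) => apply: def_not
  | |- definable (fun M e f => _ -> _) => apply: def_imp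
  | |- definable (fun M e f => is_true (s2_k _)) => apply: def_k
  | |- definable (fun M e f => is_true (s2_gle _ _)) => apply: def_le
  | |- definable (fun M e f => @eq (s2_K _) _ _) => apply: def_eqK
  | |- definable (fun M e f => @eq (s2_G _) _ _) => apply: def_eqG
  | |- kdef (fun M e f => s2_add _ _) => apply: kdef_add
  | |- kdef (fun M e f => s2_mul _ _) => apply: kdef_mul
  | |- kdef (fun M e f => s2_opp _) => apply: kdef_opp
  | |- kdef (fun M e f => s2_der _) => apply: kdef_der
  | |- kdef (fun M e f => s2_s _) => apply: kdef_s
  | |- kdef (fun M e f => s2_c _) => apply: kdef_c
  | |- kdef (fun M e f => s2_zero _) => apply: kdef0
  | |- kdef (fun M e f => s2_one _) => apply: kdef1
  | |- kdef (fun M e f => e _) => apply: kdef_var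
  | |- gdef (fun M e f => s2_gadd _ _) => apply: gdef_add
  | |- gdef (fun M e f => s2_gopp _) => apply: gdef_opp
  | |- gdef (fun M e f => s2_gzero _) => apply: gdef0
  | |- gdef (fun M e f => s2_v _) => apply: gdef_v
  | |- gdef (fun M e f => f _) => apply: gdef_var
  end.

Ltac define := cbv beta; repeat (def_step; cbv beta).

(** * Models of the theory of K *)

Definition elementary (P : L2_structure -> Prop) := @definable 0 0 (fun M _ _ => P M).

Lemma transfer (P : L2_structure -> Prop) A M :
  elementary P -> L2_models M (L2_Th A) -> P A -> P M.
Proof.
move=> [p hp] MA PA.
by rewrite -(hp M (fun=> s2_zero M) (fun=> s2_gzero M)); apply: MA; apply/hp.
Qed.

Section MoLaws.
Variable M : L2_structure.
Notation "0" := (s2_zero M).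
Notation "1" := (s2_one M).
Notation "x + y" := (s2_add x y).
Notation "- x" := (s2_opp x).
Notation "x * y" := (s2_mul x y).
Notation K := (s2_K M).
Notation G := (s2_G M).
Notation v := (@s2_v M).
Notation k := (@s2_k M).
Notation s := (@s2_s M).
Notation c := (@s2_c M).
Notation "g <= h" := (s2_gle g h).
Notation "g +g h" := (s2_gadd g h) (at level 50).
Notation "0g" := (s2_gzero M).

Definition in_O (x : K) := x = 0 \/ 0g <= v x.
Definition in_m (x : K) := x = 0 \/ (0g <= v x /\ v x <> 0g).

Definition field_ax :=
  (forall x y z : K, x + (y + z) = (x + y) + z) /\ (forall x y : K, x + y = y + x) /\
  (forall x : K, 0 + x = x) /\ (forall x : K, (- x) + x = 0) /\
  (forall x y z : K, x * (y * z) = (x * y) * z) /\ (forall x y : K, x * y = y * x) /\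
  (forall x : K, 1 * x = x) /\ (forall x y z : K, (x + y) * z = (x * z) + (y * z)) /\
  (1 <> 0) /\ (forall x : K, x = 0 \/ exists y : K, y * x = 1).

Definition group_ax :=
  (forall x y z : G, x +g (y +g z) = (x +g y) +g z) /\ (forall x y : G, x +g y = y +g x) /\
  (forall x : G, 0g +g x = x) /\ (forall x : G, s2_gopp x +g x = 0g) /\
  (forall x : G, x <= x) /\ (forall x y : G, x <= y -> y <= x -> x = y) /\
  (forall x y z : G, x <= y -> y <= z -> x <= z) /\ (forall x y : G, x <= y \/ y <= x) /\
  (forall x y z : G, x <= y -> x +g z <= y +g z).

Definition val_ax :=
  (forall x y : K, s2_der (x + y) = s2_der x + s2_der y) /\
  (forall x y : K, s2_der (x * y) = (s2_der x * y) + (x * s2_der y)) /\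
  v 0 = 0g /\ (forall x y : K, x <> 0 -> y <> 0 -> v (x * y) = v x +g v y) /\
  (forall x y : K, x <> 0 -> y <> 0 -> x + y <> 0 -> v x <= v (x + y) \/ v y <= v (x + y)) /\
  (forall x : K, s2_der x <> 0 -> v x <= v (s2_der x)).

Definition lift_ax :=
  k 1 /\ (forall x y : K, k x -> k y -> k (x + (- y))) /\
  (forall x y z : K, k x -> k y -> y * z = 1 -> k (x * z)) /\
  (forall x : K, k x -> k (s2_der x)) /\ (forall x : K, k x -> in_O x) /\
  (forall x : K, in_O x -> exists u : K, k u /\ in_m (x + (- u))).

Definition section_ax :=
  (forall g : G, s g <> 0) /\ (forall g h : G, s (g +g h) = s g * s h) /\
  (forall g : G, v (s g) = g) /\ (forall g : G, k (c g)) /\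
  (forall g : G, s2_der (s g) = c g * s g).

Definition char_ax := forall n, iter n.+1 (fun x => 1 + x) 0 <> 0.

(** A first-order rendering of the class of models. In the reconstruction, surjectivity of v comes
    from the cross-section; residue characteristic 0 and injectivity of the residue map on k come
    from k being a field of characteristic 0 inside the valuation ring. *)
Record Mo_ax : Prop := MoAx {
  ax_field : field_ax; ax_group : group_ax; ax_val : val_ax;
  ax_lift : lift_ax; ax_section : section_ax; ax_char : char_ax }.

End MoLaws.

Section MoLawsHold.
Variable K : Mo_model.

Lemma in_OE (x : K) : @in_O (L2_of K) x <-> dom x 1.
Proof.
rewrite /in_O /dom oner_eq0 val01 /=.
by split=> [[->|->]|/orP[/eqP|]]; rewrite ?eqxx ?orbT //; [left | right].
Qed.

Lemma in_mE (x : K) : @in_m (L2_of K) x <-> sdom x 1.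
Proof.
have [->|x0] := eqVneq x 0.
  by rewrite sdom0 oner_eq0; split=> // _; left.
rewrite sdomE ?oner_eq0 // val01 lt_neqAle /in_m /= eq_sym.
split=> [[/eqP|[-> /eqP ->]]|/andP[/eqP h1 h2]] //; first by rewrite (negPf x0).
by right.
Qed.

Lemma Mo_ax_of : Mo_ax (L2_of K).
Proof.
split.
- do !split; rewrite /=.
  + by move=> x y z; rewrite addrA.
  + by move=> x y; rewrite addrC.
  + by move=> x; rewrite add0r.
  + by move=> x; rewrite addNr.
  + by move=> x y z; rewrite mulrA.
  + by move=> x y; rewrite mulrC.
  + by move=> x; rewrite mul1r.
  + by move=> x y z; rewrite mulrDl.
  + exact/eqP/oner_neq0.
  + move=> x; have [->|x0] := eqVneq x 0; first by left.
    by right; exists x^-1; rewrite mulVf.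
- do !split; rewrite /=.
  + by move=> x y z; rewrite addrA.
  + by move=> x y; rewrite addrC.
  + by move=> x; rewrite add0r.
  + by move=> x; rewrite addNr.
  + by move=> x; rewrite lexx.
  + by move=> x y h1 h2; apply/eqP; rewrite eq_le h1 h2.
  + by move=> x y z; apply: le_trans.
  + by move=> x y; apply/orP/og_total.
  + by move=> x y z; apply: og_leD.
- do !split; rewrite /=.
  + by move=> x y; rewrite derD.
  + by move=> x y; rewrite derM.
  + exact: val00.
  + by move=> x y /eqP x0 /eqP y0; apply: val0M.
  + move=> x y /eqP x0 /eqP y0 /eqP xy0; have := val0D x0 y0 xy0.
    by rewrite minElt; case: ifP => _ h; [left | right].
  + by move=> x /eqP; apply: mo_monotone.
- do !split; rewrite /=.
  + exact: mo_k1.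
  + by move=> x y; apply: mo_kB.
  + move=> x y z kx ky yz; have y0 : y != 0.
      by apply: contra_eq_neq yz => ->; rewrite mul0r eq_sym oner_neq0.
    have -> : z = y^-1 by apply: (mulfI y0); rewrite yz divff.
    exact: mo_kdiv.
  + by move=> x; apply: mo_kder.
  + by move=> x /mo_k_dom1 kx; apply/in_OE.
  + move=> x /in_OE; rewrite dom1E => xO.
    have [_ _ _ _ /(_ (res (VRing xO)))[u ku /eqP]] := mo_lift K.
    rewrite eq_sym -subr_eq0 -rmorphB res_eq0 /= => h.
    by exists (val u); split=> //; apply/in_mE.
- do !split; rewrite /=.
  + by move=> g; apply/eqP/mo_s_neq0.
  + by move=> g h; apply: mo_sD.
  + by move=> g; apply: mo_sK.
  + by move=> g; apply: mo_c_in.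
  + by move=> g; apply: mo_ders.
- move=> n; have -> : iter n.+1 (fun x => s2_add (s2_one (L2_of K)) x) (s2_zero (L2_of K)) =
     (n.+1%:R : K).
    by elim: n.+1 => //= m ->; rewrite -nat1r.
  by apply/eqP; rewrite (iffLR (pcharf0P _) (@df_char0 K)).
Qed.

End MoLawsHold.

Lemma Mo_ax_transfer A M : L2_models M (L2_Th A) -> Mo_ax A -> Mo_ax M.
Proof.
move=> MA [h1 h2 h3 h4 h5 h6]; split.
- by apply: transfer MA h1; rewrite /elementary /field_ax; define.
- by apply: transfer MA h2; rewrite /elementary /group_ax; define.
- by apply: transfer MA h3; rewrite /elementary /val_ax; define.
- by apply: transfer MA h4; rewrite /elementary /lift_ax /in_O /in_m; define.
- by apply: transfer MA h5; rewrite /elementary /section_ax; define.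
- move=> n; apply: (@transfer (fun M => iter n.+1 (fun x => s2_add (s2_one M) x)
    (s2_zero M) <> s2_zero M) A M _ MA (h6 n)).
  rewrite /elementary /=; apply: def_not.
  apply: def_eqK; last exact: kdef0.
  apply: kdef_add; first exact: kdef1.
  by elim: n => [|n IH] /=; [apply: kdef0 | apply: kdef_add IH; apply: kdef1].
Qed.

Section Reconstruction.
Variables (M : L2_structure) (ax : Mo_ax M).

(** An alias of the carrier with the axioms as a parameter, to which algebraic structures that
    depend on these axioms can be attached. *)
Definition rK (_ : Mo_ax M) := s2_K M.
Definition rG (_ : Mo_ax M) := s2_G M.
Local Notation K := (rK ax).
Local Notation G := (rG ax).

HB.instance Definition _ := gen_eqMixin K.
HB.instance Definition _ := gen_choiceMixin K.
HB.instance Definition _ := gen_eqMixin G.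
HB.instance Definition _ := gen_choiceMixin G.

Fact r_addA : associative (@s2_add M : K -> K -> K).
Proof. by have [[h _] _ _ _ _ _] := ax. Qed.
Fact r_addC : commutative (@s2_add M : K -> K -> K).
Proof. by have [[_ [h _]] _ _ _ _ _] := ax. Qed.
Fact r_add0 : left_id (s2_zero M : K) (@s2_add M).
Proof. by have [[_ [_ [h _]]] _ _ _ _ _] := ax. Qed.
Fact r_addN : left_inverse (s2_zero M : K) (@s2_opp M) (@s2_add M).
Proof. by have [[_ [_ [_ [h _]]]] _ _ _ _ _] := ax. Qed.

HB.instance Definition _ := GRing.isZmodule.Build K r_addA r_addC r_add0 r_addN.

Fact r_mulA : associative (@s2_mul M : K -> K -> K).
Proof. by have [[_ [_ [_ [_ [h _]]]]] _ _ _ _ _] := ax. Qed.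
Fact r_mulC : commutative (@s2_mul M : K -> K -> K).
Proof. by have [[_ [_ [_ [_ [_ [h _]]]]]] _ _ _ _ _] := ax. Qed.
Fact r_mul1 : left_id (s2_one M : K) (@s2_mul M).
Proof. by have [[_ [_ [_ [_ [_ [_ [h _]]]]]]] _ _ _ _ _] := ax. Qed.
Fact r_mulD : left_distributive (@s2_mul M : K -> K -> K) (@s2_add M).
Proof. by have [[_ [_ [_ [_ [_ [_ [_ [h _]]]]]]]] _ _ _ _ _] := ax. Qed.
Fact r_one : (s2_one M : K) != 0.
Proof. by have [[_ [_ [_ [_ [_ [_ [_ [_ [h _]]]]]]]]] _ _ _ _ _] := ax; apply/eqP. Qed.
Fact r_inv_ex (x : K) : exists y : K, (x == 0 -> y = 0) /\ (x != 0 -> s2_mul y x = s2_one M).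
Proof.
have [[_ [_ [_ [_ [_ [_ [_ [_ [_ h]]]]]]]]] _ _ _ _ _] := ax.
case: (h x) => [x0|[y yx]].
  by exists 0; split=> // /eqP; case.
have [x0|x0] := eqVneq x 0; first by exists 0.
by exists y.
Qed.

HB.instance Definition _ := GRing.Zmodule_isComNzRing.Build K r_mulA r_mulC r_mul1 r_mulD r_one.

Definition r_inv (x : K) : K := sval (cid (r_inv_ex x)).

Fact r_mulV (x : K) : x != 0 -> r_inv x * x = 1.
Proof. exact: (svalP (cid (r_inv_ex x))).2. Qed.
Fact r_inv0 : r_inv 0 = 0.
Proof. exact: (svalP (cid (r_inv_ex 0))).1 (eqxx _). Qed.

HB.instance Definition _ := GRing.ComNzRing_isField.Build K r_mulV r_inv0.

Fact r_gaddA : associative (@s2_gadd M : G -> G -> G).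
Proof. by have [_ [h _] _ _ _ _] := ax. Qed.
Fact r_gaddC : commutative (@s2_gadd M : G -> G -> G).
Proof. by have [_ [_ [h _]] _ _ _ _] := ax. Qed.
Fact r_gadd0 : left_id (s2_gzero M : G) (@s2_gadd M).
Proof. by have [_ [_ [_ [h _]]] _ _ _ _] := ax. Qed.
Fact r_gaddN : left_inverse (s2_gzero M : G) (@s2_gopp M) (@s2_gadd M).
Proof. by have [_ [_ [_ [_ [h _]]]] _ _ _ _] := ax. Qed.

HB.instance Definition _ := GRing.isZmodule.Build G r_gaddA r_gaddC r_gadd0 r_gaddN.

Fact r_le_refl : reflexive (@s2_gle M : rel G).
Proof. by have [_ [_ [_ [_ [_ [h _]]]]] _ _ _ _] := ax. Qed.
Fact r_le_anti : antisymmetric (@s2_gle M : rel G).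
Proof.
by have [_ [_ [_ [_ [_ [_ [h _]]]]]] _ _ _ _] := ax => x y /andP[]; apply: h.
Qed.
Fact r_le_trans : transitive (@s2_gle M : rel G).
Proof.
by have [_ [_ [_ [_ [_ [_ [_ [h _]]]]]]] _ _ _ _] := ax => y x z; apply: h.
Qed.

HB.instance Definition _ :=
  Order.Le_isPOrder.Build ring_display G r_le_refl r_le_anti r_le_trans.

Fact r_total : total (<=%R : rel G).
Proof.
have [_ [_ [_ [_ [_ [_ [_ [_ [h _]]]]]]]] _ _ _ _] := ax.
by move=> x y; apply/orP/h.
Qed.
Fact r_leD (x y z : G) : x <= y -> x + z <= y + z.
Proof. by have [_ [_ [_ [_ [_ [_ [_ [_ [_ h]]]]]]]] _ _ _ _] := ax; apply: h. Qed.

Definition r_group : ordGroup := @OrdGroup G r_total r_leD.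

Fact r_char0 : [pchar K] =i pred0.
Proof.
apply/pcharf0P => -[|n]; first by rewrite !eqxx.
have [_ _ _ _ _ /(_ n)] := ax.
have -> : iter n.+1 [eta s2_add (s2_one M)] (s2_zero M) = (n.+1%:R : K).
  by elim: n.+1 => //= m ->; rewrite -nat1r.
by move=> h; apply/negbTE/eqP.
Qed.

Fact r_derD (x y : K) : @s2_der M (x + y) = (s2_der x : K) + s2_der y.
Proof. by have [_ _ [h _] _ _ _] := ax; apply: h. Qed.
Fact r_derM (x y : K) : @s2_der M (x * y) = (s2_der x : K) * y + x * s2_der y.
Proof. by have [_ _ [_ [h _]] _ _ _] := ax; apply: h. Qed.

Definition r_diff : diffField := @DiffField K (@s2_der M) r_char0 r_derD r_derM.

Fact r_val00 : @s2_v M (0 : K) = 0 :> G.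
Proof. by have [_ _ [_ [_ [h _]]] _ _ _] := ax; apply: h. Qed.
Fact r_val0M (x y : K) : x != 0 -> y != 0 -> @s2_v M (x * y) = (s2_v x : G) + s2_v y.
Proof.
by have [_ _ [_ [_ [_ [h _]]]] _ _ _] := ax => /eqP x0 /eqP y0; apply: h.
Qed.
Fact r_val0D (x y : K) : x != 0 -> y != 0 -> x + y != 0 ->
  Num.min (s2_v x : G) (s2_v y) <= s2_v (x + y : K).
Proof.
have [_ _ [_ [_ [_ [_ [h _]]]]] _ _ _] := ax => /eqP x0 /eqP y0 /eqP xy0.
rewrite minEle; case: (boolP ((s2_v x : G) <= s2_v y)) => xy.
  by case: (h x y x0 y0 xy0) => // yz; apply: le_trans xy yz.
have yx : (s2_v y : G) <= s2_v x by have := r_total (s2_v x) (s2_v y); rewrite (negPf xy).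
by case: (h x y x0 y0 xy0) => // xz; apply: le_trans yx xz.
Qed.
Fact r_s_neq0 (g : G) : (s2_s g : K) != 0.
Proof. by have [_ _ _ _ [h _] _] := ax; apply/eqP/h. Qed.
Fact r_sK (g : G) : s2_v (s2_s g : K) = g.
Proof. by have [_ _ _ _ [_ [_ [h _]]] _] := ax; apply: h. Qed.
Fact r_surj (g : G) : exists2 x : K, x != 0 & s2_v x = g.
Proof. by exists (s2_s g); [apply: r_s_neq0 | apply: r_sK]. Qed.

Definition r_V : valDiffField :=
  @ValDiffField r_diff r_group (@s2_v M) r_val00 r_val0M r_val0D r_surj.

Fact r_mono : monotone r_V.
Proof.
by have [_ _ [_ [_ [_ [_ [_ h]]]]] _ _ _] := ax => x /eqP; apply: h.
Qed.

Lemma r_in_O (x : K) : in_O (x : s2_K M) -> (x : r_V) \in @vring_pred r_V.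
Proof. by case=> h; apply/orP; [left; apply/eqP | right]. Qed.

Fact r_kdiv : divring_closed (@s2_k M : {pred r_V}).
Proof.
have [_ _ _ [h1 [h2 [h3 _]]] _ _] := ax; split=> [|x y|x y kx ky].
- exact: h1.
- exact: h2.
- have [->|y0] := eqVneq y 0.
    by rewrite invr0 mulr0; have := h2 _ _ h1 h1; rewrite [s2_add _ _](subrr (1 : r_V)).
  exact: h3 kx ky (divff y0).
Qed.

Lemma r_k_val (x : r_V) : s2_k x -> x != 0 -> dom 1 x.
Proof.
have [_ _ _ [h1 [_ [_ [_ [h5 _]]]]] _ _] := ax => kx x0.
have [_ _ kd] := r_kdiv.
have kV : s2_k (x^-1) by have := kd _ _ h1 kx; rewrite [1 * _]mul1r.
have := r_in_O (h5 _ kV); rewrite -dom1E -[dom _ _](domMr _ _ x0) mulVf // mul1r.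
by [].
Qed.

Fact r_lift : is_lift (@s2_k M : {pred r_V}).
Proof.
have [_ _ _ [h1 [h2 [h3 [h4 [h5 h6]]]]] _ _] := ax; split.
- exact: r_kdiv.
- exact: h4.
- by move=> x /h5; apply: r_in_O.
- move=> x y kx ky /eqP; rewrite -subr_eq0 -rmorphB res_eq0 /= => xy.
  apply: val_inj; apply/eqP; rewrite -subr_eq0; apply: contraTT xy => xy0.
  by rewrite /sdom negbK; apply: r_k_val => //; apply: h2.
- move=> a; have [x <-] : exists x, res x = a by exists (repr a); rewrite /res reprK.
  have xO : in_O (val x : s2_K M).
    by have := valP x; rewrite unfold_in => /orP[/eqP|]; [left | right].
  have [u [ku um]] := h6 _ xO.
  exists (VRing (r_in_O (h5 _ ku))); first exact: ku.
  apply/eqP; rewrite eq_sym -subr_eq0 -rmorphB res_eq0.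
  case: um => [um|[um1 um2]].
    by have -> : val (x - VRing (r_in_O (h5 u ku))) = 0 by []; rewrite sdom0 oner_eq0.
  set z := val _; have {}um1 : 0 <= val0 z := um1; have {}um2 : val0 z <> 0 := um2.
  rewrite /sdom; apply/negP => d; have z0 := dom_neq0 (oner_neq0 _) d.
  rewrite domE ?oner_neq0 // val01 in d.
  by apply: um2; apply/eqP; rewrite eq_le d um1.
Qed.

Fact r_res_char0 : [pchar residue r_V] =i pred0.
Proof.
move=> p; rewrite !inE; apply/negP => /andP[pp /eqP p0].
have kn n : s2_k (n%:R : r_V).
  have [k1 kB _] := r_kdiv; have k0 : s2_k (0 : r_V) by have := kB _ _ k1 k1; rewrite subrr.
  elim: n => [|n IH]; first exact: k0.
  have -> : (n.+1%:R : r_V) = n%:R - (0 - 1) by rewrite sub0r opprK natr1.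
  by apply: kB IH (kB _ _ k0 k1).
have pn0 : (p%:R : r_V) != 0.
  by rewrite (iffLR (pcharf0P _) (@df_char0 r_V)) -lt0n prime_gt0.
have : res (p%:R : vring r_V) == 0 by rewrite rmorph_nat p0.
by rewrite res_eq0 rmorph_nat /sdom r_k_val.
Qed.

Fact r_sD (g h : G) : @s2_s M (g + h) = (s2_s g : K) * s2_s h.
Proof. by have [_ _ _ _ [_ [h' _]] _] := ax; apply: h'. Qed.
Fact r_c_in (g : G) : (s2_c g : r_V) \in (@s2_k M : {pred r_V}).
Proof. by have [_ _ _ _ [_ [_ [_ [h _]]]] _] := ax; apply: h. Qed.
Fact r_cE (g : G) : s2_c g = (der (s2_s g : r_V)) / (s2_s g : r_V) :> r_V.
Proof.
have [_ _ _ _ [_ [_ [_ [_ h]]]] _] := ax.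
apply: (mulIf (r_s_neq0 g)); rewrite divfK ?r_s_neq0 //.
by apply/esym; apply: h.
Qed.

Definition r_model : Mo_model :=
  @MoModel r_V r_res_char0 r_mono (@s2_k M) r_lift (@s2_s M) r_s_neq0 r_sD r_sK
    (@s2_c M) r_c_in r_cE.

End Reconstruction.

(** Carriers and operations of the reconstructed model are those of M up to conversion, so M is
    equal, and not only isomorphic, to the structure of a model. *)
Lemma Mo_ax_model M : Mo_ax M -> exists N : Mo_model, M = L2_of N.
Proof. by case: M => ? ? ? ? ? ? ? ? ? ? ? ? ? ? ? ? ax; exists (r_model ax). Qed.

(** * The axioms for d-henselianity *)

Section Scheme.
Variable M : L2_structure.

Definition msum I (r : seq I) (F : I -> s2_K M) := foldr (fun i x => s2_add (F i) x) (s2_zero M) r.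
Definition mprod I (r : seq I) (F : I -> s2_K M) := foldr (fun i x => s2_mul (F i) x) (s2_one M) r.
Definition mpow (x : s2_K M) k := iter k (s2_mul x) (s2_one M).

Variables n d : nat.

Definition monom (i : 'I_#|{: 'X_{1..n.+1 < d}}|) : 'X_{1..n.+1} := bmnm (enum_val i).

Definition dh_value (x : 'I_#|{: 'X_{1..n.+1 < d}}| -> s2_K M) (y : s2_K M) :=
  msum (enum 'I_#|{: 'X_{1..n.+1 < d}}|) (fun i =>
    s2_mul (x i) (mprod (enum 'I_n.+1) (fun j => mpow (iter j (@s2_der M) y) (monom i j)))).

(* Here x lists the coefficients of a differential polynomial of order at most n
   and degree less than d. *)
Definition dh_axiom := forall x : 'I_#|{: 'X_{1..n.+1 < d}}| -> s2_K M,
  (forall i, in_O (x i)) -> (forall i, (1 < mdeg (monom i))%N -> in_m (x i)) ->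
  (exists i, mdeg (monom i) == 1%N /\ ~ in_m (x i)) ->
  exists y : s2_K M, in_O y /\ dh_value x y = s2_zero M.

End Scheme.

Lemma def_in_O m n (t : kfun m n) : kdef t -> @definable m n (fun M e f => in_O (t M e f)).
Proof.
move=> dt; apply: def_or; first by apply: def_eqK dt (kdef0 _ _).
by apply: def_le (gdef0 _ _) (gdef_v dt).
Qed.

Lemma def_in_m m n (t : kfun m n) : kdef t -> @definable m n (fun M e f => in_m (t M e f)).
Proof.
move=> dt; apply: def_or; first by apply: def_eqK dt (kdef0 _ _).
apply: def_and; first by apply: def_le (gdef0 _ _) (gdef_v dt).
by apply: def_not; apply: def_eqG (gdef_v dt) (gdef0 _ _).
Qed.

Lemma elementary_dh n d : elementary (fun M => dh_axiom M n d).
Proof.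
apply: (@def_closeK _ 0 (fun M x f => (forall i, in_O (x i)) ->
  (forall i, (1 < mdeg (@monom n d i))%N -> in_m (x i)) ->
  (exists i, mdeg (@monom n d i) == 1%N /\ ~ in_m (x i)) ->
  exists y : s2_K M, in_O y /\ dh_value x y = s2_zero M)).
apply: def_imp; first by apply: def_forall => i; apply: def_in_O; apply: kdef_var.
apply: def_imp.
  apply: def_forall => i; apply: def_imp; first exact: def_const.
  by apply: def_in_m; apply: kdef_var.
apply: def_imp.
  apply: def_exists => i; apply: def_and; first exact: def_const.
  by apply: def_not; apply: def_in_m; apply: kdef_var.
apply: def_exK; apply: def_and; first by apply: def_in_O; apply: kdef_var.
apply: def_eqK (kdef0 _ _); rewrite /dh_value.
elim: (enum 'I_#|_|) => [|i r IH] /=; first exact: kdef0.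
apply: kdef_add IH; apply: kdef_mul; first exact: kdef_var.
elim: (enum 'I_n.+1) => [|j q IH] /=; first exact: kdef1.
apply: kdef_mul IH; rewrite /mpow; elim: (monom _ _) => [|k IH] /=; first exact: kdef1.
apply: kdef_mul IH; elim: (j : nat) => [|l IH] /=; first exact: kdef_var.
exact: kdef_der.
Qed.

Section SchemeHolds.
Variable K : Mo_model.

Lemma msum_of I (r : seq I) (F : I -> K) : @msum (L2_of K) I r F = \sum_(i <- r) F i.
Proof. by elim: r => [|i r IH]; rewrite ?big_nil // big_cons -IH. Qed.

Lemma mprod_of I (r : seq I) (F : I -> K) : @mprod (L2_of K) I r F = \prod_(i <- r) F i.
Proof. by elim: r => [|i r IH]; rewrite ?big_nil // big_cons -IH. Qed.

Lemma mpow_of (x : K) k : @mpow (L2_of K) x k = x ^+ k.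
Proof. by elim: k => //= k IH; rewrite exprS -IH. Qed.

Lemma dh_value_of n d (x : 'I_#|{: 'X_{1..n.+1 < d}}| -> K) (y : K) :
  @dh_value (L2_of K) n d x y =
  \sum_(m : 'X_{1..n.+1 < d}) x (enum_rank m) * \prod_(j < n.+1) iter j (@der K) y ^+ m j.
Proof.
rewrite /dh_value msum_of big_enum /=.
rewrite (reindex (@enum_rank 'X_{1..n.+1 < d})) /=; last exact/onW_bij/enum_rank_bij.
apply: eq_bigr => m _; rewrite mprod_of big_enum /= /monom enum_rankK.
by congr (_ * _); apply: eq_bigr => j _; rewrite mpow_of.
Qed.

(** Degree exactly one in terms of coefficients, the form used by the axiom scheme; [msize] is one
    more than the total degree. *)
Lemma msize2P n (R : nzRingType) (Q : {mpoly R[n]}) :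
  msize Q = 2%N <-> (forall m, (1 < mdeg m)%N -> Q@_m = 0) /\
                    exists m, mdeg m == 1%N /\ Q@_m <> 0.
Proof.
split=> [sQ|[h0 [m [/eqP m1 /eqP mQ]]]].
  split=> [m m1|]; first by apply: memN_msupp_eq0; apply: msize_mdeg_ge; rewrite sQ.
  have Q0 : Q != 0 by rewrite -msize_poly_eq0 sQ.
  exists (mlead Q); split; first by rewrite -eqSS mlead_deg // sQ.
  by apply/eqP; rewrite mleadc_eq0.
apply/eqP; rewrite eqn_leq; apply/andP; split.
  rewrite msizeE; apply/bigmax_leqP_seq => m'; rewrite mcoeff_msupp => h _.
  by rewrite ltnS leqNgt; apply: contraNN h => m2; rewrite h0.
by rewrite -m1; apply: msize_mdeg_lt; rewrite mcoeff_msupp.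
Qed.

Lemma res_in_m (x : vring K) : res x = 0 <-> @in_m (L2_of K) (val x).
Proof. by rewrite in_mE -res_eq0; split=> [->|/eqP]. Qed.

(** A polynomial has finitely many coefficients, so it falls under the instance of the scheme for
    its order and for d equal to its [msize], a strict bound on its degree. *)
Lemma d_henselianP : d_henselian K <-> forall n d, dh_axiom (L2_of K) n d.
Proof.
split=> [hK n d x xO xm [i0 [i1 xi0]]|hK n P sP].
  have xO' i : x i \in @vring_pred K by rewrite -dom1E; apply/in_OE.
  pose P : {mpoly (vring K)[n.+1]} :=
    \sum_(m : 'X_{1..n.+1 < d}) VRing (xO' (enum_rank m)) *: 'X_[m].
  have PE (m : 'X_{1..n.+1 < d}) : P@_m = VRing (xO' (enum_rank m)).
    rewrite raddf_sum (bigD1 m) //= mcoeffZ mcoeffX eqxx mulr1 big1 ?addr0 // => m' m'm.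
    by rewrite mcoeffZ mcoeffX (inj_eq val_inj) (negPf m'm) mulr0.
  have Pout m : (d <= mdeg m)%N -> P@_m = 0.
    move=> dm; rewrite raddf_sum big1 //= => m' _; rewrite mcoeffZ mcoeffX.
    case: eqP => [e|]; last by rewrite mulr0.
    by have := bmdeg m'; rewrite e ltnNge dm.
  have sP : msize (map_mpoly (@res K) P) = 2%N.
    apply/msize2P; split=> [m m1|].
      rewrite mcoeff_map_mpoly; have [md|/Pout ->] := ltnP (mdeg m) d; last by rewrite raddf0.
      rewrite -[m]/(bmnm (BMultinom md)) PE; apply/res_in_m; apply: xm.
      by rewrite /monom enum_rankK.
    exists (monom i0); split=> //; rewrite mcoeff_map_mpoly PE => /res_in_m h.
    by apply: xi0; move: h; rewrite /= enum_valK.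
  have [y Py] := hK n P sP; exists (val y); split.
    by apply/in_OE; rewrite dom1E; apply: valP.
  have PV : map_mpoly val P = \sum_(m : 'X_{1..n.+1 < d}) x (enum_rank m) *: 'X_[m].
    by rewrite raddf_sum /=; apply: eq_bigr => m _; rewrite map_mpolyZ map_mpolyX.
  rewrite dh_value_of -[RHS]Py PV raddf_sum /=; apply: eq_bigr => m _.
  by rewrite mevalZ mevalX.
pose d := msize P; pose x (i : 'I_#|{: 'X_{1..n.+1 < d}}|) : K := val P@_(monom i).
have [|||y [yO]] := hK n d x.
- by move=> i; apply/in_OE; rewrite dom1E; apply: valP.
- move=> i i1; apply/res_in_m; rewrite -mcoeff_map_mpoly.
  by apply: (iffLR (msize2P _) sP).1.
- have [m [m1 Pm]] := (iffLR (msize2P _) sP).2; rewrite mcoeff_map_mpoly in Pm.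
  have md : (mdeg m < d)%N.
    rewrite ltnNge; apply/negP => dm; apply: Pm.
    by rewrite memN_msupp_eq0 ?raddf0 //; apply: msize_mdeg_ge.
  exists (enum_rank (BMultinom md)); rewrite /x /monom enum_rankK; split=> //.
  by move/res_in_m.
have yO' : y \in @vring_pred K by rewrite -dom1E; apply/in_OE.
rewrite dh_value_of => h; exists (VRing yO'); rewrite -[RHS]h.
have -> : map_mpoly val P = \sum_(m : 'X_{1..n.+1 < d}) val P@_m *: 'X_[m].
  rewrite [in LHS](mpolywE (leqnn (msize P))) raddf_sum /=; apply: eq_bigr => m _.
  by rewrite map_mpolyZ map_mpolyX.
rewrite raddf_sum /=; apply: eq_bigr => m _.
by rewrite mevalZ mevalX /x /monom enum_rankK.
Qed.

End SchemeHolds.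

Lemma model_of_theory (K : Mo_model) (M : L2_structure) : d_henselian K ->
  L2_models M (L2_Th (L2_of K)) -> exists N : Mo_model, M = L2_of N /\ d_henselian N.
Proof.
move=> hK MK; have [N MN] := Mo_ax_model (Mo_ax_transfer MK (Mo_ax_of K)).
exists N; split=> //; rewrite MN in MK; apply/d_henselianP => n d.
by apply: transfer (elementary_dh n d) MK _; apply: (iffLR (d_henselianP K) hK).
Qed.

(** * Ultrapowers *)

(** An ultrafilter extending the filter of cofinite sets; containing the final segments is what
    yields countable saturation. *)
Lemma ultrafilter_ex : exists2 U : set_system nat, UltraFilter U &
  forall n, U [set i | (n <= i)%N]%classic.
Proof.
have [U [UU sub]] := @ultraFilterLemma nat _ eventually_filter.
by exists U => // n; apply: sub; exists n.
Qed.

Section Ultrapower.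
Variables (U : set_system nat) (UU : UltraFilter U).
Hypothesis U_cofinite : forall n, U [set i | (n <= i)%N]%classic.

Definition ae (P : nat -> Prop) := U (fun i => P i).

Lemma aeS (P Q : nat -> Prop) : (forall i, P i -> Q i) -> ae P -> ae Q.
Proof. by move=> PQ; apply: filterS => i; apply: PQ. Qed.

Lemma aeI (P Q : nat -> Prop) : ae P -> ae Q -> ae (fun i => P i /\ Q i).
Proof. exact: filterI. Qed.

Lemma ae_iff (P Q : nat -> Prop) : (forall i, P i <-> Q i) -> ae P <-> ae Q.
Proof. by move=> PQ; split; apply: aeS => i /PQ. Qed.

Lemma ae_true (P : nat -> Prop) : (forall i, P i) -> ae P.
Proof. by move=> h; apply: (aeS (P := fun=> True)) => //; apply: filterT. Qed.

Lemma ae_ex (P : nat -> Prop) : ae P -> exists i, P i.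
Proof.
move=> h; apply: contrapT => n; apply: (filter_not_empty U).
by apply: aeS h => i Pi; apply: n; exists i.
Qed.

Lemma ae_not (P : nat -> Prop) : ae (fun i => ~ P i) <-> ~ ae P.
Proof.
split=> [h1 h2|h]; first by have [i []] := ae_ex (aeI h1 h2).
by case: (in_ultra_setVsetC P UU).
Qed.

Lemma ae_imp (P Q : nat -> Prop) : ae (fun i => P i -> Q i) <-> (ae P -> ae Q).
Proof.
split=> [h hP|h]; first by apply: aeS (aeI h hP) => i []; apply.
have [hP|/ae_not hP] := pselect (ae P); first by apply: aeS (h hP).
by apply: aeS hP.
Qed.

Section Carrier.
Variable A : Type.

(** Classes are predicates on sequences, so that equality in the ultrapower is genuine equality, as
    the semantics of [Keq] and [Geq] requires. *)
Definition ucls (f : nat -> A) : (nat -> A) -> Prop := fun g => ae (fun i => f i = g i).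
Definition upow := {X : (nat -> A) -> Prop | exists f, X = ucls f}.
Definition upi f : upow := exist _ (ucls f) (ex_intro _ f erefl).
Definition urep (x : upow) : nat -> A := sval (cid (svalP x)).

Lemma urepE x : sval x = ucls (urep x).
Proof. exact: (svalP (cid (svalP x))). Qed.

Lemma urepK x : upi (urep x) = x.
Proof. by apply: eq_sig_hprop => [?|/=]; [apply: Prop_irrelevance | rewrite -urepE]. Qed.

Lemma upi_eq f g : upi f = upi g <-> ae (fun i => f i = g i).
Proof.
split=> [[/(congr1 (fun X => X g))] e|h].
  by have : ucls f g by rewrite e; apply: ae_true.
apply: eq_exist; apply/funext => k; apply/propext; split => h'.
  by apply: aeS (aeI h h') => i [-> ->].
by apply: aeS (aeI h h') => i [-> ->].
Qed.

Lemma urep_upi f : ae (fun i => urep (upi f) i = f i).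
Proof. by apply/upi_eq; rewrite urepK. Qed.

End Carrier.

Lemma scons_upi A n (a : nat -> A) (e : 'I_n -> nat -> A) :
  scons (upi a) (fun j => upi (e j)) = (fun j => upi (scons a e j)).
Proof. by apply/funext => j; rewrite /scons; case: unlift. Qed.

Lemma scons_app A n (a : nat -> A) (e : 'I_n -> nat -> A) i :
  (fun j => scons a e j i) = scons (a i) (fun j => e j i).
Proof. by apply/funext => j; rewrite /scons; case: unlift. Qed.

Variable M : L2_structure.
Local Notation K := (s2_K M).
Local Notation G := (s2_G M).

Definition ulift1 A B (o : A -> B) (x : upow A) : upow B := upi (fun i => o (urep x i)).
Definition ulift2 A B C (o : A -> B -> C) (x : upow A) (y : upow B) : upow C :=
  upi (fun i => o (urep x i) (urep y i)).

Lemma ulift1E A B (o : A -> B) f : ulift1 o (upi f) = upi (fun i => o (f i)).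
Proof. by apply/upi_eq; apply: aeS (urep_upi f) => i ->. Qed.

Lemma ulift2E A B C (o : A -> B -> C) f g :
  ulift2 o (upi f) (upi g) = upi (fun i => o (f i) (g i)).
Proof. by apply/upi_eq; apply: aeS (aeI (urep_upi f) (urep_upi g)) => i [-> ->]. Qed.

Definition ultrapower : L2_structure :=
  @L2Structure (upow K) (upow G) (upi (fun=> s2_zero M)) (upi (fun=> s2_one M))
    (ulift2 (@s2_add M)) (ulift1 (@s2_opp M)) (ulift2 (@s2_mul M)) (ulift1 (@s2_der M))
    (fun x => `[< ae (fun i => s2_k (urep x i)) >])
    (upi (fun=> s2_gzero M)) (ulift2 (@s2_gadd M)) (ulift1 (@s2_gopp M))
    (fun x y => `[< ae (fun i => s2_gle (urep x i) (urep y i)) >])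
    (ulift1 (@s2_v M)) (ulift1 (@s2_s M)) (ulift1 (@s2_c M)).

Scheme L2_kterm_mut := Induction for L2_kterm Sort Prop
with L2_gterm_mut := Induction for L2_gterm Sort Prop.
Combined Scheme L2_term_ind from L2_kterm_mut, L2_gterm_mut.

Lemma ultra_eval m n (e : 'I_m -> nat -> K) (f : 'I_n -> nat -> G) :
  (forall t, @L2_keval ultrapower m n (fun j => upi (e j)) (fun j => upi (f j)) t =
     upi (fun i => @L2_keval M m n (fun j => e j i) (fun j => f j i) t)) /\
  (forall t, @L2_geval ultrapower m n (fun j => upi (e j)) (fun j => upi (f j)) t =
     upi (fun i => @L2_geval M m n (fun j => e j i) (fun j => f j i) t)).
Proof.
by apply: L2_term_ind => //= [t -> u ->|t ->|t -> u ->|t ->|t ->|t ->|t -> u ->|t ->|t ->];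
  rewrite ?ulift1E ?ulift2E.
Qed.

Lemma Los m n (p : formula L2_atom m n) (e : 'I_m -> nat -> K) (f : 'I_n -> nat -> G) :
  holds (@L2_atom_holds ultrapower) p (fun j => upi (e j)) (fun j => upi (f j)) <->
  ae (fun i => holds (@L2_atom_holds M) p (fun j => e j i) (fun j => f j i)).
Proof.
elim: p e f => {m n} [m n a|m n|m n p IHp q IHq|m n p IH|m n p IH] e f /=.
- have [ek eg] := ultra_eval e f.
  case: a => [t u|t|t u|t u] /=; rewrite ?ek ?eg.
  + exact: upi_eq.
  + have E := urep_upi (fun i => @L2_keval M m n (fun j => e j i) (fun j => f j i) t).
    split=> [/asboolP h|h]; first by apply: aeS (aeI h E) => i [+ /= <-].
    by apply/asboolP; apply: aeS (aeI h E) => i [+ /= ->].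
  + exact: upi_eq.
  + have Et := urep_upi (fun i => @L2_geval M m n (fun j => e j i) (fun j => f j i) t).
    have Eu := urep_upi (fun i => @L2_geval M m n (fun j => e j i) (fun j => f j i) u).
    split=> [/asboolP h|h]; first by apply: aeS (aeI h (aeI Et Eu)) => i [+ [/= <- <-]].
    by apply/asboolP; apply: aeS (aeI h (aeI Et Eu)) => i [+ [/= -> ->]].
- by split=> // /ae_ex[].
- by rewrite IHp IHq ae_imp.
- split=> [h|h a].
    apply: contrapT => /ae_not nh.
    (* A counterexample is chosen at every index that has one; the sequence obtained is a
       counterexample in the ultrapower. *)
    have [a aP] := boolp.choice (P := fun i a => (exists a, ~ holds (@L2_atom_holds M) p
        (scons a (fun j => e j i)) (fun j => f j i)) ->
      ~ holds (@L2_atom_holds M) p (scons a (fun j => e j i)) (fun j => f j i))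
      (fun i => match pselect (exists a, ~ holds (@L2_atom_holds M) p
        (scons a (fun j => e j i)) (fun j => f j i)) with
        | left h => match h with ex_intro a ha => ex_intro _ a (fun=> ha) end
        | right h => ex_intro _ (s2_zero M) (fun h' => False_ind _ (h h')) end).
    have := h (upi a); rewrite scons_upi IH => ha.
    have [i [nhi]] := ae_ex (aeI nh ha); rewrite scons_app.
    apply: aP; apply: contrapT => nex; apply: nhi => b; apply: contrapT => nb.
    by apply: nex; exists b.
  rewrite -(urepK a) scons_upi IH; apply: aeS h => i h.
  by rewrite scons_app.
- split=> [h|h a].
    apply: contrapT => /ae_not nh.
    have [a aP] := boolp.choice (P := fun i a => (exists a, ~ holds (@L2_atom_holds M) p
        (fun j => e j i) (scons a (fun j => f j i))) ->
      ~ holds (@L2_atom_holds M) p (fun j => e j i) (scons a (fun j => f j i)))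
      (fun i => match pselect (exists a, ~ holds (@L2_atom_holds M) p
        (fun j => e j i) (scons a (fun j => f j i))) with
        | left h => match h with ex_intro a ha => ex_intro _ a (fun=> ha) end
        | right h => ex_intro _ (s2_gzero M) (fun h' => False_ind _ (h h')) end).
    have := h (upi a); rewrite scons_upi IH => ha.
    have [i [nhi]] := ae_ex (aeI nh ha); rewrite scons_app.
    apply: aP; apply: contrapT => nex; apply: nhi => b; apply: contrapT => nb.
    by apply: nex; exists b.
  rewrite -(urepK a) scons_upi IH; apply: aeS h => i h.
  by rewrite scons_app.
Qed.

Lemma ultra_true (p : L2_sentence) : L2_true ultrapower p <-> L2_true M p.
Proof.
rewrite /L2_true (Los p (fun=> fun=> s2_zero M) (fun=> fun=> s2_gzero M)) /=.
split=> [/ae_ex[]//|h]; exact: ae_true.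
Qed.

(* A set of the ultrapower is internal if it is given by a sequence of sets. *)
Lemma internal_saturation A (D : nat -> nat -> A -> Prop) :
  (forall J, exists x : upow A, forall j, (j < J)%N -> ae (fun i => D j i (urep x i))) ->
  exists x : upow A, forall j, ae (fun i => D j i (urep x i)).
Proof.
move=> fin; have [x xP] := boolp.choice fin.
(* At index i one satisfies as many constraints as some partial solution allows, but at most i of
   them, so that a maximum exists. Each constraint is covered for almost all i because the
   ultrafilter contains the final segments. *)
pose good i J := (J <= i)%N /\ forall j, (j < J)%N -> D j i (urep (x J) i).
have good0 i : exists k, `[< good i k >] by exists 0%N; apply/asboolP.
have bound i k : `[< good i k >] -> (k <= i)%N by move/asboolP => [].
pose top i := ex_maxn (good0 i) (bound i).
exists (upi (fun i => urep (x (top i)) i)) => j.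
have h1 : ae (fun i => forall k, (k < j.+1)%N -> D k i (urep (x j.+1) i)).
  suff h l : (l <= j.+1)%N ->
      ae (fun i => forall k, (k < l)%N -> D k i (urep (x j.+1) i)) by apply: h.
  elim: l => [|l IH] lj; first exact: ae_true.
  apply: aeS (aeI (IH (ltnW lj)) (xP j.+1 l lj)) => i [h hl] k.
  by rewrite ltnS leq_eqVlt => /orP[/eqP ->|/h].
apply: aeS (aeI (aeI h1 (U_cofinite j.+1))
  (urep_upi (fun i => urep (x (top i)) i))) => i [[h ji] ->].
rewrite /top; case: ex_maxnP => J /asboolP[Ji JP] Jmax; apply: JP.
by apply: Jmax; apply/asboolP; split.
Qed.

End Ultrapower.

(** A countable type is a sequence of these, each with its own number of parameters of either
    sort. *)
Record constraintK (M : L2_structure) := ConstraintK {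
  cK_m : nat; cK_n : nat; cK_p : formula L2_atom cK_m.+1 cK_n;
  cK_e : 'I_cK_m -> s2_K M; cK_f : 'I_cK_n -> s2_G M }.

Record constraintG (M : L2_structure) := ConstraintG {
  cG_m : nat; cG_n : nat; cG_p : formula L2_atom cG_m cG_n.+1;
  cG_e : 'I_cG_m -> s2_K M; cG_f : 'I_cG_n -> s2_G M }.

Definition satK M (c : constraintK M) x :=
  holds (@L2_atom_holds M) (cK_p c) (scons x (@cK_e M c)) (@cK_f M c).

Definition satG M (c : constraintG M) x :=
  holds (@L2_atom_holds M) (cG_p c) (@cG_e M c) (scons x (@cG_f M c)).

Definition saturated (M : L2_structure) :=
  (forall C : nat -> constraintK M,
     (forall J, exists x, forall j, (j < J)%N -> satK (C j) x) ->
     exists x, forall j, satK (C j) x) /\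
  (forall C : nat -> constraintG M,
     (forall J, exists x, forall j, (j < J)%N -> satG (C j) x) ->
     exists x, forall j, satG (C j) x).

(** By Los's theorem a constraint with parameters defines an internal set, to which the diagonal
    argument applies. *)
Lemma saturated_extension M : exists2 M', saturated M' &
  forall p, L2_true M' p <-> L2_true M p.
Proof.
have [U UU Uc] := ultrafilter_ex; exists (ultrapower U M); last exact: ultra_true.
split=> C fin.
- have E j x : satK (C j) x <-> ae U (fun i => holds (@L2_atom_holds M) (cK_p (C j))
      (scons (urep x i) (fun l => urep (@cK_e _ (C j) l) i)) (fun l => urep (@cK_f _ (C j) l) i)).
    have := Los UU (cK_p (C j)) (scons (urep x) (fun l => urep (@cK_e _ (C j) l)))
      (fun l => urep (@cK_f _ (C j) l)).
    rewrite -scons_upi urepK.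
    have -> : (fun l => upi U (urep (@cK_e _ (C j) l))) = @cK_e _ (C j).
      by apply/funext => l; rewrite urepK.
    have -> : (fun l => upi U (urep (@cK_f _ (C j) l))) = @cK_f _ (C j).
      by apply/funext => l; rewrite urepK.
    by rewrite /satK => ->; apply: ae_iff => i; rewrite scons_app.
  have [|x xP] := internal_saturation UU Uc (D := fun j i a => holds (@L2_atom_holds M) (cK_p (C j))
      (scons a (fun l => urep (@cK_e _ (C j) l) i)) (fun l => urep (@cK_f _ (C j) l) i)).
    by move=> J; have [x xP] := fin J; exists x => j jJ; apply/E; apply: xP.
  by exists x => j; apply/E.
- have E j x : satG (C j) x <-> ae U (fun i => holds (@L2_atom_holds M) (cG_p (C j))
      (fun l => urep (@cG_e _ (C j) l) i) (scons (urep x i) (fun l => urep (@cG_f _ (C j) l) i))).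
    have := Los UU (cG_p (C j)) (fun l => urep (@cG_e _ (C j) l))
      (scons (urep x) (fun l => urep (@cG_f _ (C j) l))).
    rewrite -scons_upi urepK.
    have -> : (fun l => upi U (urep (@cG_e _ (C j) l))) = @cG_e _ (C j).
      by apply/funext => l; rewrite urepK.
    have -> : (fun l => upi U (urep (@cG_f _ (C j) l))) = @cG_f _ (C j).
      by apply/funext => l; rewrite urepK.
    by rewrite /satG => ->; apply: ae_iff => i; rewrite scons_app.
  have [|x xP] := internal_saturation UU Uc (D := fun j i a => holds (@L2_atom_holds M) (cG_p (C j))
      (fun l => urep (@cG_e _ (C j) l) i) (scons a (fun l => urep (@cG_f _ (C j) l) i))).
    by move=> J; have [x xP] := fin J; exists x => j jJ; apply/E; apply: xP.
  by exists x => j; apply/E.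
Qed.

(** * Countable elementary substructures *)

Section Codes.
Local Notation tree := (GenTree.tree nat).
Local Notation "'leaf'" := (@GenTree.Leaf nat).
Local Notation node := (@GenTree.Node nat).

Section Formulas.
Variables (atom : nat -> nat -> Type) (adec : forall m n, tree -> atom m n).

(** Countability of the language comes from a surjective decoder with a default on malformed trees:
    the indices m and n of the formula are then mere arguments of the recursion. *)
Fixpoint fdec m n (t : tree) {struct t} : formula atom m n :=
  match t with
  | GenTree.Node 0 [:: a] => Atom (adec m n a)
  | GenTree.Node 1 [:: a; b] => Imp (fdec m n a) (fdec m n b)
  | GenTree.Node 2 [:: a] => AllK (fdec m.+1 n a)
  | GenTree.Node 3 [:: a] => AllG (fdec m n.+1 a)
  | _ => Bot atom m n
  end.

Hypothesis adec_surj : forall m n a, exists t, adec m n t = a.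

Lemma fdec_surj m n p : exists t, fdec m n t = p.
Proof.
elim: p => {m n} [m n a|m n|m n p [t <-] q [u <-]|m n p [t <-]|m n p [t <-]].
- by have [t <-] := adec_surj a; exists (node 0 [:: t]).
- by exists (leaf 0%N).
- by exists (node 1 [:: t; u]).
- by exists (node 2 [:: t]).
- by exists (node 3 [:: t]).
Qed.

End Formulas.

Definition vdec (A : Type) m (var : 'I_m -> A) (d : A) (i : nat) : A :=
  if insub i is Some j then var j else d.

Lemma vdec_val (A : Type) m (var : 'I_m -> A) d (i : 'I_m) : vdec var d i = var i.
Proof. by rewrite /vdec valK. Qed.

Fixpoint kdec m n (t : tree) {struct t} : L2_kterm m n :=
  match t with
  | GenTree.Leaf i => vdec (@Kvar m n) (Kzero m n) i
  | GenTree.Node 1 [:: a; b] => Kadd (kdec m n a) (kdec m n b)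
  | GenTree.Node 2 [:: a] => Kopp (kdec m n a)
  | GenTree.Node 3 [:: a; b] => Kmul (kdec m n a) (kdec m n b)
  | GenTree.Node 4 [:: a] => Kder (kdec m n a)
  | GenTree.Node 5 [:: a] => Ks (gdec m n a)
  | GenTree.Node 6 [:: a] => Kc (gdec m n a)
  | GenTree.Node 7 _ => Kone m n
  | _ => Kzero m n
  end
with gdec m n (t : tree) {struct t} : L2_gterm m n :=
  match t with
  | GenTree.Leaf i => vdec (@Gvar m n) (Gzero m n) i
  | GenTree.Node 1 [:: a; b] => Gadd (gdec m n a) (gdec m n b)
  | GenTree.Node 2 [:: a] => Gopp (gdec m n a)
  | GenTree.Node 3 [:: a] => Gv (kdec m n a)
  | _ => Gzero m n
  end.

Lemma kgdec_surj m n :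
  (forall u, exists t, kdec m n t = u) /\ (forall u, exists t, gdec m n t = u).
Proof.
apply: L2_term_ind => [i|||u [t <-] w [r <-]|u [t <-]|u [t <-] w [r <-]|u [t <-]|u [t <-]
  |u [t <-]|i||u [t <-] w [r <-]|u [t <-]|u [t <-]].
- by exists (leaf (val i)); rewrite /= vdec_val.
- by exists (node 0 [::]).
- by exists (node 7 [::]).
- by exists (node 1 [:: t; r]).
- by exists (node 2 [:: t]).
- by exists (node 3 [:: t; r]).
- by exists (node 4 [:: t]).
- by exists (node 5 [:: t]).
- by exists (node 6 [:: t]).
- by exists (leaf (val i)); rewrite /= vdec_val.
- by exists (node 0 [::]).
- by exists (node 1 [:: t; r]).
- by exists (node 2 [:: t]).
- by exists (node 3 [:: t]).
Qed.

Definition L2_adec m n (t : tree) : L2_atom m n :=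
  match t with
  | GenTree.Node 0 [:: a; b] => Keq (kdec m n a) (kdec m n b)
  | GenTree.Node 1 [:: a] => Kpred (kdec m n a)
  | GenTree.Node 2 [:: a; b] => Geq (gdec m n a) (gdec m n b)
  | GenTree.Node 3 [:: a; b] => Gle (gdec m n a) (gdec m n b)
  | _ => Keq (Kzero m n) (Kzero m n)
  end.

Lemma L2_adec_surj m n a : exists t, L2_adec m n t = a.
Proof.
have [ks gs] := kgdec_surj m n; case: a => [u w|u|u w|u w].
- by have [[t <-] [r <-]] := (ks u, ks w); exists (node 0 [:: t; r]).
- by have [t <-] := ks u; exists (node 1 [:: t]).
- by have [[t <-] [r <-]] := (gs u, gs w); exists (node 2 [:: t; r]).
- by have [[t <-] [r <-]] := (gs u, gs w); exists (node 3 [:: t; r]).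
Qed.

Fixpoint cgdec n (t : tree) {struct t} : Lc_gterm n :=
  match t with
  | GenTree.Leaf i => vdec (@cGvar n) (cGzero n) i
  | GenTree.Node 1 [:: a; b] => cGadd (cgdec n a) (cgdec n b)
  | GenTree.Node 2 [:: a] => cGopp (cgdec n a)
  | _ => cGzero n
  end.

Fixpoint ckdec m n (t : tree) {struct t} : Lc_kterm m n :=
  match t with
  | GenTree.Leaf i => vdec (@cKvar m n) (cKzero m n) i
  | GenTree.Node 1 [:: a; b] => cKadd (ckdec m n a) (ckdec m n b)
  | GenTree.Node 2 [:: a] => cKopp (ckdec m n a)
  | GenTree.Node 3 [:: a; b] => cKmul (ckdec m n a) (ckdec m n b)
  | GenTree.Node 4 [:: a] => cKder (ckdec m n a)
  | GenTree.Node 5 [:: a] => cKc m (cgdec n a)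
  | GenTree.Node 6 _ => cKone m n
  | _ => cKzero m n
  end.

Lemma cgdec_surj n u : exists t, cgdec n t = u.
Proof.
elim: u => [i||u [t <-] w [r <-]|u [t <-]].
- by exists (leaf (val i)); rewrite /= vdec_val.
- by exists (node 0 [::]).
- by exists (node 1 [:: t; r]).
- by exists (node 2 [:: t]).
Qed.

Lemma ckdec_surj m n u : exists t, ckdec m n t = u.
Proof.
elim: u => [i|||u [t <-] w [r <-]|u [t <-]|u [t <-] w [r <-]|u [t <-]|g].
- by exists (leaf (val i)); rewrite /= vdec_val.
- by exists (node 0 [::]).
- by exists (node 6 [::]).
- by exists (node 1 [:: t; r]).
- by exists (node 2 [:: t]).
- by exists (node 3 [:: t; r]).
- by exists (node 4 [:: t]).
- by have [t <-] := cgdec_surj g; exists (node 5 [:: t]).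
Qed.

Definition Lc_adec m n (t : tree) : Lc_atom m n :=
  match t with
  | GenTree.Node 0 [:: a; b] => cKeq (ckdec m n a) (ckdec m n b)
  | GenTree.Node 1 [:: a; b] => cGeq m (cgdec n a) (cgdec n b)
  | GenTree.Node 2 [:: a; b] => cGle m (cgdec n a) (cgdec n b)
  | _ => cKeq (cKzero m n) (cKzero m n)
  end.

Lemma Lc_adec_surj m n a : exists t, Lc_adec m n t = a.
Proof.
case: a => u w.
- by have [[t <-] [r <-]] := (ckdec_surj u, ckdec_surj w); exists (node 0 [:: t; r]).
- by have [[t <-] [r <-]] := (cgdec_surj u, cgdec_surj w); exists (node 1 [:: t; r]).
- by have [[t <-] [r <-]] := (cgdec_surj u, cgdec_surj w); exists (node 2 [:: t; r]).
Qed.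

End Codes.

Definition fcode := (nat * nat * GenTree.tree nat * seq nat * seq nat)%type.

Definition wit A (x0 : A) (P : A -> Prop) : A :=
  if pselect (exists a, P a) is left h then sval (cid h) else x0.

Lemma witP A (x0 : A) (P : A -> Prop) : (exists a, P a) -> P (wit x0 P).
Proof. by rewrite /wit; case: pselect => // h _; apply: (svalP (cid h)). Qed.

Lemma list_of_fun m (s : 'I_m -> nat) : exists r : seq nat, forall i : 'I_m, nth 0%N r i = s i.
Proof.
exists [seq s i | i <- enum 'I_m] => i.
by rewrite (nth_map i) ?size_enum_ord // nth_ord_enum.
Qed.

Section LowenheimSkolem.
Variables (M : L2_structure) (SK : nat -> s2_K M) (SG : nat -> s2_G M).
Local Notation holdsM := (holds (@L2_atom_holds M)).

(** A code either keeps an element of the previous level or asks for a Skolem witness of a coded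
    formula with coded parameters. *)
Definition nextK (l : (nat -> s2_K M) * (nat -> s2_G M)) j :=
  match unpickle j : option (nat + fcode) with
  | Some (inl i) => l.1 i
  | Some (inr (m, n, t, r, q)) => wit (s2_zero M) (fun a =>
      holdsM (fdec L2_adec m.+1 n t) (scons a (fun i => l.1 (nth 0%N r i)))
        (fun i => l.2 (nth 0%N q i)))
  | None => s2_zero M
  end.

Definition nextG (l : (nat -> s2_K M) * (nat -> s2_G M)) j :=
  match unpickle j : option (nat + fcode) with
  | Some (inl i) => l.2 i
  | Some (inr (m, n, t, r, q)) => wit (s2_gzero M) (fun a =>
      holdsM (fdec L2_adec m n.+1 t) (fun i => l.1 (nth 0%N r i))
        (scons a (fun i => l.2 (nth 0%N q i))))
  | None => s2_gzero M
  end.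

Definition level k := iter k (fun l => (nextK l, nextG l)) (SK, SG).

Definition hullK x := exists k j, (level k).1 j = x.
Definition hullG g := exists k j, (level k).2 j = g.

Lemma level_mono k l x g : (k <= l)%N ->
  ((exists j, (level k).1 j = x) -> exists j, (level l).1 j = x) /\
  ((exists j, (level k).2 j = g) -> exists j, (level l).2 j = g).
Proof.
move=> /subnK <-; elim: (l - k)%N => [|d [IH1 IH2]] //; rewrite addSn.
split=> [/IH1|/IH2] [j jx]; exists (pickle (inl j : nat + fcode)).
  by rewrite -[LHS]/(nextK (level (d + k)) _) /nextK pickleK.
by rewrite -[LHS]/(nextG (level (d + k)) _) /nextG pickleK.
Qed.

Lemma common_level m n (e : 'I_m -> s2_K M) (f : 'I_n -> s2_G M) :
  (forall i, hullK (e i)) -> (forall i, hullG (f i)) ->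
  exists k s t, (forall i, (level k).1 (s i) = e i) /\ (forall i, (level k).2 (t i) = f i).
Proof.
move=> he hf; have [a aP] := boolp.choice he; have [b bP] := boolp.choice hf.
pose k := maxn (\max_i a i) (\max_i b i).
have hs i : exists j, (level k).1 j = e i.
  apply: (level_mono (e i) (s2_gzero M) _).1 (aP i).
  by apply: leq_trans (leq_maxl _ _); apply: leq_bigmax.
have ht i : exists j, (level k).2 j = f i.
  apply: (level_mono (s2_zero M) (f i) _).2 (bP i).
  by apply: leq_trans (leq_maxr _ _); apply: leq_bigmax.
have [s sP] := boolp.choice hs; have [t tP] := boolp.choice ht.
by exists k, s, t.
Qed.

Lemma hull_witK m n (p : formula L2_atom m.+1 n) e f :
  (forall i, hullK (e i)) -> (forall i, hullG (f i)) ->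
  (exists a, holdsM p (scons a e) f) -> exists2 a, hullK a & holdsM p (scons a e) f.
Proof.
move=> he hf ex; have [k [s [t [sP tP]]]] := common_level he hf.
have [r rP] := list_of_fun s; have [q qP] := list_of_fun t.
have [c cP] := fdec_surj L2_adec_surj p.
pose a := (level k.+1).1 (pickle (inr (m, n, c, r, q) : nat + fcode)).
exists a; first by exists k.+1, (pickle (inr (m, n, c, r, q) : nat + fcode)).
have -> : a = wit (s2_zero M) (fun a => holdsM p (scons a e) f).
  rewrite /a -[LHS]/(nextK (level k) _) /nextK pickleK cP; congr wit; apply/funext => x; congr (holdsM _ (scons _ _) _).
    by apply/funext => i; rewrite rP sP.
  by apply/funext => i; rewrite qP tP.
exact: (@witP _ (s2_zero M) (fun a => holdsM p (scons a e) f) ex).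
Qed.

Lemma hull_witG m n (p : formula L2_atom m n.+1) e f :
  (forall i, hullK (e i)) -> (forall i, hullG (f i)) ->
  (exists a, holdsM p e (scons a f)) -> exists2 a, hullG a & holdsM p e (scons a f).
Proof.
move=> he hf ex; have [k [s [t [sP tP]]]] := common_level he hf.
have [r rP] := list_of_fun s; have [q qP] := list_of_fun t.
have [c cP] := fdec_surj L2_adec_surj p.
pose a := (level k.+1).2 (pickle (inr (m, n, c, r, q) : nat + fcode)).
exists a; first by exists k.+1, (pickle (inr (m, n, c, r, q) : nat + fcode)).
have -> : a = wit (s2_gzero M) (fun a => holdsM p e (scons a f)).
  rewrite /a -[LHS]/(nextG (level k) _) /nextG pickleK cP; congr wit; apply/funext => x; congr (holdsM _ _ (scons _ _)).
    by apply/funext => i; rewrite rP sP.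
  by apply/funext => i; rewrite qP tP.
exact: (@witP _ (s2_gzero M) (fun a => holdsM p e (scons a f)) ex).
Qed.

(** The value of an operation is the only witness of the formula defining its graph, so closure
    under operations follows from closure under witnesses. *)
Lemma hull_kdef m n (t : kfun m n) e f :
  @definable m.+1 n (fun M e f => e ord0 = t M (fun i => e (lift ord0 i)) f) ->
  (forall i, hullK (e i)) -> (forall i, hullG (f i)) -> hullK (t M e f).
Proof.
move=> [p pP] he hf; have [|a ha] := hull_witK (p := p) he hf.
  by exists (t M e f); rewrite pP scons0 scons_lift.
by rewrite pP scons0 scons_lift => <-.
Qed.

Lemma hull_gdef m n (t : gfun m n) e f :
  @definable m n.+1 (fun M e f => f ord0 = t M e (fun i => f (lift ord0 i))) ->
  (forall i, hullK (e i)) -> (forall i, hullG (f i)) -> hullG (t M e f).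
Proof.
move=> [p pP] he hf; have [|a ha] := hull_witG (p := p) he hf.
  by exists (t M e f); rewrite pP scons0 scons_lift.
by rewrite pP scons0 scons_lift => <-.
Qed.

Let noK := fun i : 'I_0 => s2_zero M.
Let noG := fun i : 'I_0 => s2_gzero M.
Fact hull0 : hullK (s2_zero M).
Proof.
by apply: (@hull_kdef 0 0 (fun M e f => s2_zero M) noK noG); [define | case | case].
Qed.
Fact hull1 : hullK (s2_one M).
Proof.
by apply: (@hull_kdef 0 0 (fun M e f => s2_one M) noK noG); [define | case | case].
Qed.
Fact hull_add x y : hullK x -> hullK y -> hullK (s2_add x y).
Proof.
move=> hx hy; apply: (@hull_kdef 2 0 (fun M e f => s2_add (e ord0) (e ord_max))
  (fun i => if i == ord0 then x else y) noG); [define | | by case].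
by move=> i; case: ifP.
Qed.
Fact hull_mul x y : hullK x -> hullK y -> hullK (s2_mul x y).
Proof.
move=> hx hy; apply: (@hull_kdef 2 0 (fun M e f => s2_mul (e ord0) (e ord_max))
  (fun i => if i == ord0 then x else y) noG); [define | | by case].
by move=> i; case: ifP.
Qed.
Fact hull_opp x : hullK x -> hullK (s2_opp x).
Proof.
by move=> hx; apply: (@hull_kdef 1 0 (fun M e f => s2_opp (e ord0)) (fun=> x) noG);
  [define | | case].
Qed.
Fact hull_der x : hullK x -> hullK (s2_der x).
Proof.
by move=> hx; apply: (@hull_kdef 1 0 (fun M e f => s2_der (e ord0)) (fun=> x) noG);
  [define | | case].
Qed.
Fact hull_s g : hullG g -> hullK (s2_s g).
Proof.
by move=> hx; apply: (@hull_kdef 0 1 (fun M e f => s2_s (f ord0)) noK (fun=> g));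
  [define | case | ].
Qed.
Fact hull_c g : hullG g -> hullK (s2_c g).
Proof.
by move=> hx; apply: (@hull_kdef 0 1 (fun M e f => s2_c (f ord0)) noK (fun=> g));
  [define | case | ].
Qed.
Fact hull_g0 : hullG (s2_gzero M).
Proof.
by apply: (@hull_gdef 0 0 (fun M e f => s2_gzero M) noK noG); [define | case | case].
Qed.
Fact hull_gadd x y : hullG x -> hullG y -> hullG (s2_gadd x y).
Proof.
move=> hx hy; apply: (@hull_gdef 0 2 (fun M e f => s2_gadd (f ord0) (f ord_max)) noK
  (fun i => if i == ord0 then x else y)); [define | by case | ].
by move=> i; case: ifP.
Qed.
Fact hull_gopp x : hullG x -> hullG (s2_gopp x).
Proof.
by move=> hx; apply: (@hull_gdef 0 1 (fun M e f => s2_gopp (f ord0)) noK (fun=> x));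
  [define | case | ].
Qed.
Fact hull_v x : hullK x -> hullG (s2_v x).
Proof.
by move=> hx; apply: (@hull_gdef 1 0 (fun M e f => s2_v (e ord0)) (fun=> x) noG);
  [define | | case].
Qed.

Definition hull : L2_structure :=
  @L2Structure {x | hullK x} {g | hullG g} (exist _ _ hull0) (exist _ _ hull1)
    (fun x y => exist _ _ (hull_add (svalP x) (svalP y)))
    (fun x => exist _ _ (hull_opp (svalP x)))
    (fun x y => exist _ _ (hull_mul (svalP x) (svalP y)))
    (fun x => exist _ _ (hull_der (svalP x)))
    (fun x => s2_k (sval x))
    (exist _ _ hull_g0)
    (fun x y => exist _ _ (hull_gadd (svalP x) (svalP y)))
    (fun x => exist _ _ (hull_gopp (svalP x)))
    (fun x y => s2_gle (sval x) (sval y))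
    (fun x => exist _ _ (hull_v (svalP x)))
    (fun x => exist _ _ (hull_s (svalP x)))
    (fun x => exist _ _ (hull_c (svalP x))).

Lemma hull_eval m n (e : 'I_m -> s2_K hull) (f : 'I_n -> s2_G hull) :
  (forall t, sval (@L2_keval hull m n e f t) =
     @L2_keval M m n (fun i => sval (e i)) (fun i => sval (f i)) t) /\
  (forall t, sval (@L2_geval hull m n e f t) =
     @L2_geval M m n (fun i => sval (e i)) (fun i => sval (f i)) t).
Proof.
by apply: L2_term_ind => //= [t -> u ->|t ->|t -> u ->|t ->|t ->|t ->|t -> u ->|t ->|t ->].
Qed.

Lemma sval_eq (A : Type) (P : A -> Prop) (x y : {a | P a}) : sval x = sval y -> x = y.
Proof. by move=> h; apply: eq_sig_hprop h => ? ? ?; apply: Prop_irrelevance. Qed.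

(** The Tarski-Vaught test: a counterexample in M to a universal formula is a witness of the negated
    matrix, and the hull contains one. *)
Lemma hull_elementary m n (p : formula L2_atom m n) e f :
  holds (@L2_atom_holds hull) p e f <->
  holdsM p (fun i => sval (e i)) (fun i => sval (f i)).
Proof.
elim: p e f => {m n} [m n a|m n|m n p IHp q IHq|m n p IH|m n p IH] e f //=.
- have [ek eg] := hull_eval e f.
  by case: a => [t u|t|t u|t u] /=; rewrite -?ek -?eg //; split=> [->|/sval_eq].
- by rewrite IHp IHq.
- split=> [h a|h a]; last by rewrite IH scons_comp.
  apply: contrapT => na; have [b hb] := hull_witK (p := Imp p (Bot _ _ _)) (fun i => svalP (e i))
    (fun i => svalP (f i)) (ex_intro _ a na).
  by apply; have := h (exist _ b hb); rewrite IH scons_comp.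
- split=> [h a|h a]; last by rewrite IH scons_comp.
  apply: contrapT => na; have [b hb] := hull_witG (p := Imp p (Bot _ _ _)) (fun i => svalP (e i))
    (fun i => svalP (f i)) (ex_intro _ a na).
  by apply; have := h (exist _ b hb); rewrite IH scons_comp.
Qed.

Lemma hull_enumK : exists u : nat -> s2_K hull, forall x, exists j, u j = x.
Proof.
pose u i : s2_K hull := match unpickle i with
  | Some (k, j) => exist _ ((level k).1 j) (ex_intro _ k (ex_intro _ j erefl))
  | None => exist _ _ hull0 end.
exists u => -[x [k [j kj]]]; exists (pickle (k, j)); apply: sval_eq.
by rewrite /u pickleK.
Qed.

End LowenheimSkolem.

(** Only the field sort is enumerated and prescribed; in a model the group sort is reached through
    v. *)
Theorem lowenheim_skolem (M : L2_structure) (SK : nat -> s2_K M) :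
  exists (M0 : L2_structure) (hK : s2_K M0 -> s2_K M) (hG : s2_G M0 -> s2_G M),
  [/\ forall m n (p : formula L2_atom m n) e f, holds (@L2_atom_holds M0) p e f <->
        holds (@L2_atom_holds M) p (fun i => hK (e i)) (fun i => hG (f i)),
      exists u : nat -> s2_K M0, forall x, exists j, u j = x &
      forall j, exists x, hK x = SK j].
Proof.
pose SG (_ : nat) := s2_gzero M.
exists (hull SK SG), (fun x => sval x), (fun g => sval g); split.
- by move=> m n p e f; apply: hull_elementary.
- exact: hull_enumK.
- by move=> j; exists (exist _ (SK j) (ex_intro _ 0%N (ex_intro _ j erefl))).
Qed.

(** * The reduct to the lift and the value group *)

Section Relativization.

Fixpoint trg m n (t : Lc_gterm n) : L2_gterm m n :=
  match t with
  | cGvar i => Gvar m i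
  | cGzero => Gzero m n
  | cGadd t u => Gadd (trg m t) (trg m u)
  | cGopp t => Gopp (trg m t)
  end.

Fixpoint trk m n (t : Lc_kterm m n) : L2_kterm m n :=
  match t with
  | cKvar i => Kvar n i
  | cKzero => Kzero m n
  | cKone => Kone m n
  | cKadd t u => Kadd (trk t) (trk u)
  | cKopp t => Kopp (trk t)
  | cKmul t u => Kmul (trk t) (trk u)
  | cKder t => Kder (trk t)
  | cKc g => Kc (trg m g)
  end.

Definition tra m n (a : Lc_atom m n) : L2_atom m n :=
  match a with
  | cKeq t u => Keq (trk t) (trk u)
  | cGeq t u => Geq (trg m t) (trg m u)
  | cGle t u => Gle (trg m t) (trg m u)
  end.

Fixpoint tr m n (p : formula Lc_atom m n) : formula L2_atom m n :=
  match p with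
  | Atom _ _ a => Atom (tra a)
  | Bot m n => Bot L2_atom m n
  | Imp _ _ p q => Imp (tr p) (tr q)
  | AllK m n p => AllK (Imp (Atom (Kpred (Kvar n (@ord0 m)))) (tr p))
  | AllG _ _ p => AllG (tr p)
  end.

Variable N : Mo_model.

Lemma trg_eval m n (e : 'I_m -> N) (f : 'I_n -> vgroup N) t :
  @L2_geval (L2_of N) m n e f (trg m t) = @Lc_geval (kGc_of N) n f t.
Proof. by elim: t => //= [t -> u ->|t ->]. Qed.

Lemma trk_eval m n (e : 'I_m -> mo_ktype N) (f : 'I_n -> vgroup N) t :
  @L2_keval (L2_of N) m n (fun i => sval (e i)) f (trk t) =
  sval (@Lc_keval (kGc_of N) m n e f t).
Proof. by elim: t => //= [t -> u ->|t ->|t -> u ->|t ->|g] //; rewrite trg_eval. Qed.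

Lemma holds_tr m n (p : formula Lc_atom m n) (e : 'I_m -> mo_ktype N) f :
  holds (@Lc_atom_holds (kGc_of N)) p e f <->
  holds (@L2_atom_holds (L2_of N)) (tr p) (fun i => sval (e i)) f.
Proof.
elim: p e f => {m n} [m n a|m n|m n p IHp q IHq|m n p IH|m n p IH] e f //=.
- case: a => t u /=; rewrite ?trk_eval ?trg_eval //.
  by split=> [->|/val_inj].
- by rewrite IHp IHq.
- split=> [h a|h a].
    by rewrite scons0 => ka; have := h (exist _ a ka); rewrite IH scons_comp.
  by rewrite IH scons_comp; apply: h; rewrite scons0; case: a.
- by split=> h a; have := h a; rewrite IH.
Qed.

End Relativization.

(** * Renaming of variables *)

Section Renaming.

Fixpoint cgren n n' (q : 'I_n -> 'I_n') (t : Lc_gterm n) : Lc_gterm n' :=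
  match t with
  | cGvar i => cGvar (q i)
  | cGzero => cGzero n'
  | cGadd t u => cGadd (cgren q t) (cgren q u)
  | cGopp t => cGopp (cgren q t)
  end.

Fixpoint ckren m n m' n' (r : 'I_m -> 'I_m') (q : 'I_n -> 'I_n') (t : Lc_kterm m n) :
    Lc_kterm m' n' :=
  match t with
  | cKvar i => cKvar n' (r i)
  | cKzero => cKzero m' n'
  | cKone => cKone m' n'
  | cKadd t u => cKadd (ckren r q t) (ckren r q u)
  | cKopp t => cKopp (ckren r q t)
  | cKmul t u => cKmul (ckren r q t) (ckren r q u)
  | cKder t => cKder (ckren r q t)
  | cKc g => cKc m' (cgren q g)
  end.

Definition caren m n m' n' (r : 'I_m -> 'I_m') (q : 'I_n -> 'I_n') (a : Lc_atom m n) :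
    Lc_atom m' n' :=
  match a with
  | cKeq t u => cKeq (ckren r q t) (ckren r q u)
  | cGeq t u => cGeq m' (cgren q t) (cgren q u)
  | cGle t u => cGle m' (cgren q t) (cgren q u)
  end.

Definition up m m' (r : 'I_m -> 'I_m') : 'I_m.+1 -> 'I_m'.+1 :=
  scons ord0 (fun i => lift ord0 (r i)).

(** Used to give different formulas disjoint blocks of parameters, and to identify parameters with
    the distinguished variable. *)
Fixpoint cren m n (p : formula Lc_atom m n) :
    forall m' n', ('I_m -> 'I_m') -> ('I_n -> 'I_n') -> formula Lc_atom m' n' :=
  match p with
  | Atom _ _ a => fun m' n' r q => Atom (caren r q a)
  | Bot _ _ => fun m' n' r q => Bot Lc_atom m' n'
  | Imp _ _ p p' => fun m' n' r q => Imp (cren p r q) (cren p' r q)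
  | AllK _ _ p => fun m' n' r q => AllK (cren p (up r) q)
  | AllG _ _ p => fun m' n' r q => AllG (cren p r (up q))
  end.

Variable A : Lc_structure.

Lemma cgren_eval n n' (q : 'I_n -> 'I_n') f t :
  @Lc_geval A n' f (cgren q t) = @Lc_geval A n (fun i => f (q i)) t.
Proof. by elim: t => //= [t -> u ->|t ->]. Qed.

Lemma ckren_eval m n m' n' (r : 'I_m -> 'I_m') (q : 'I_n -> 'I_n') e f t :
  @Lc_keval A m' n' e f (ckren r q t) =
  @Lc_keval A m n (fun i => e (r i)) (fun i => f (q i)) t.
Proof. by elim: t => //= [t -> u ->|t ->|t -> u ->|t ->|g] //; rewrite cgren_eval. Qed.

Lemma scons_up (T : Type) m m' (r : 'I_m -> 'I_m') (a : T) e :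
  (fun i => scons a e (up r i)) = scons a (fun i => e (r i)).
Proof.
rewrite /up (scons_comp (scons a e)) scons0; congr scons.
by apply/funext => i; rewrite sconsS.
Qed.

Lemma holds_ren m n (p : formula Lc_atom m n) m' n' (r : 'I_m -> 'I_m')
    (q : 'I_n -> 'I_n') e f :
  holds (@Lc_atom_holds A) (cren p r q) e f <->
  holds (@Lc_atom_holds A) p (fun i => e (r i)) (fun i => f (q i)).
Proof.
elim: p m' n' r q e f => {m n} [m n a|m n|m n p IHp p' IHp'|m n p IH|m n p IH] m' n' r q e f //=.
- by case: a => t u /=; rewrite ?ckren_eval ?cgren_eval.
- by rewrite IHp IHp'.
- by split=> h a; have := h a; rewrite IH scons_up.
- by split=> h a; have := h a; rewrite IH scons_up.
Qed.

End Renaming.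

(** * Saturation of (k, Gamma; c) *)

Section LcSaturation.
Variable B : Lc_structure.

Record lcK := LcK {
  lK_m : nat; lK_n : nat; lK_p : formula Lc_atom lK_m.+1 lK_n;
  lK_e : 'I_lK_m -> sc_k B; lK_f : 'I_lK_n -> sc_G B }.

Record lcG := LcG {
  lG_m : nat; lG_n : nat; lG_p : formula Lc_atom lG_m lG_n.+1;
  lG_e : 'I_lG_m -> sc_k B; lG_f : 'I_lG_n -> sc_G B }.

Definition lsatK (c : lcK) x :=
  holds (@Lc_atom_holds B) (lK_p c) (scons x (@lK_e c)) (@lK_f c).
Definition lsatG (c : lcG) x :=
  holds (@Lc_atom_holds B) (lG_p c) (@lG_e c) (scons x (@lG_f c)).

Definition lsaturated :=
  (forall C : nat -> lcK, (forall J, exists x, forall j, (j < J)%N -> lsatK (C j) x) ->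
     exists x, forall j, lsatK (C j) x) /\
  (forall C : nat -> lcG, (forall J, exists x, forall j, (j < J)%N -> lsatG (C j) x) ->
     exists x, forall j, lsatG (C j) x).

End LcSaturation.

Lemma saturated_kGc (N : Mo_model) : saturated (L2_of N) -> lsaturated (kGc_of N).
Proof.
move=> [satK' satG']; split=> C fin.
(* Conjoining the predicate for k forces a realization in K to lie in the lift. *)
- pose C' j := @ConstraintK (L2_of N) _ _
    (fAnd (Atom (Kpred (Kvar (lK_n (C j)) (@ord0 (lK_m (C j)))))) (tr (lK_p (C j))))
    (fun i => sval (@lK_e _ (C j) i)) (@lK_f _ (C j)).
  have E j (x : mo_ktype N) : lsatK (C j) x -> satK (C' j) (sval x).
    rewrite /lsatK holds_tr scons_comp => h; apply/holds_And; split=> //=.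
    by rewrite scons0; case: x {h}.
  have [J|x xP] := satK' C'; first by have [x xP] := fin J; exists (sval x) => j /xP /E.
  have kx : x \in mo_k N.
    by have := xP 0%N; rewrite /satK; cbn [cK_p cK_e cK_f cK_m cK_n C'] => /holds_And[+ _]; rewrite /= scons0.
  exists (exist _ x kx) => j; rewrite /lsatK holds_tr scons_comp.
  by have := xP j; rewrite /satK; cbn [cK_p cK_e cK_f cK_m cK_n C'] => /holds_And[].
- pose C' j := @ConstraintG (L2_of N) _ _ (tr (lG_p (C j)))
    (fun i => sval (@lG_e _ (C j) i)) (@lG_f _ (C j)).
  have E j x : lsatG (C j) x <-> satG (C' j) x by rewrite /lsatG holds_tr.
  have [J|x xP] := satG' C'; first by have [x xP] := fin J; exists x => j /xP /E.
  by exists x => j; apply/E.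
Qed.

Definition enumerable (A B : Type) (R : A -> B -> Prop) :=
  exists u : nat -> A * B, (forall j, R (u j).1 (u j).2) /\
                           (forall x y, R x y -> exists j, u j = (x, y)).

Definition add_pair (A B : Type) (R : A -> B -> Prop) a b x y := R x y \/ (x = a /\ y = b).

Lemma enumerable_add (A B : Type) (R : A -> B -> Prop) a b :
  enumerable R -> enumerable (add_pair R a b).
Proof.
move=> [u [uR Ru]]; exists (fun j => if j is j'.+1 then u j' else (a, b)).
split=> [[|j]|x y [/Ru[j uj]|[-> ->]]] /=; [by right | by left | by exists j.+1 | by exists 0%N].
Qed.

(** * Partial elementary maps of (k, Gamma; c) *)

Section PartialElementary.
Variables A B : Lc_structure.
Implicit Types (Rk : sc_k A -> sc_k B -> Prop) (Rg : sc_G A -> sc_G B -> Prop).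
Local Notation holdsA := (holds (@Lc_atom_holds A)).
Local Notation holdsB := (holds (@Lc_atom_holds B)).

(** Functionality and injectivity of the relations are contained here, as the case of formulas that
    are equations. *)
Definition El Rk Rg := forall m n (p : formula Lc_atom m n) e1 e2 f1 f2,
  (forall i, Rk (e1 i) (e2 i)) -> (forall i, Rg (f1 i) (f2 i)) ->
  (holdsA p e1 f1 <-> holdsB p e2 f2).

(** All parameters are 0, so each is removed by the quantifier [forall x, x = 0 -> p], and p becomes
    a sentence. The pairs of zeros are there because [enumerable] requires a nonempty relation. *)
Lemma El_zero : (forall p : Lc_sentence, Lc_true A p <-> Lc_true B p) ->
  El (fun x y => x = sc_zero A /\ y = sc_zero B) (fun g h => g = sc_gzero A /\ h = sc_gzero B).
Proof.
move=> AB m n p e1 e2 f1 f2 he hf.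
have [-> ->] : e1 = (fun=> sc_zero A) /\ e2 = (fun=> sc_zero B).
  by split; apply/funext => i; have [] := he i.
have [-> ->] : f1 = (fun=> sc_gzero A) /\ f2 = (fun=> sc_gzero B).
  by split; apply/funext => i; have [] := hf i.
have constS T l (x : T) : scons x (fun=> x) = (fun _ : 'I_l.+1 => x).
  by apply/funext => i; rewrite /scons; case: unlift.
clear e1 e2 f1 f2 he hf.
have [q [qA qB]] : exists q : Lc_sentence,
    (Lc_true A q <-> holdsA p (fun=> sc_zero A) (fun=> sc_gzero A)) /\
    (Lc_true B q <-> holdsB p (fun=> sc_zero B) (fun=> sc_gzero B)).
  elim: m p => [|m IH] p.
    elim: n p => [|n IH] p; first by exists p.
    have [q [qA qB]] := IH (AllG (Imp (Atom (cGeq 0 (cGvar ord0) (cGzero n.+1))) p)).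
    exists q; split.
      rewrite qA /=; split=> [h|h b]; first by have := h _ (scons0 _ _); rewrite constS.
      by rewrite scons0 => ->; rewrite constS.
    rewrite qB /=; split=> [h|h b]; first by have := h _ (scons0 _ _); rewrite constS.
    by rewrite scons0 => ->; rewrite constS.
  have [q [qA qB]] := IH (AllK (Imp (Atom (cKeq (cKvar n ord0) (cKzero m.+1 n))) p)).
  exists q; split.
    rewrite qA /=; split=> [h|h b]; first by have := h _ (scons0 _ _); rewrite constS.
    by rewrite scons0 => ->; rewrite constS.
  rewrite qB /=; split=> [h|h b]; first by have := h _ (scons0 _ _); rewrite constS.
  by rewrite scons0 => ->; rewrite constS.
by rewrite -qA -qB AB.
Qed.

Hypothesis satB : lsaturated B.

Lemma conj_constraintsK (a : sc_k A) (uk : nat -> sc_k A * sc_k B)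
    (ug : nat -> sc_G A * sc_G B) (mm nn : nat -> nat)
    (pp : forall j, formula Lc_atom (mm j).+1 (nn j))
    (s : forall j, 'I_(mm j) -> nat) (t : forall j, 'I_(nn j) -> nat) J :
  (forall j, holdsA (pp j) (scons a (fun i => (uk (s j i)).1)) (fun i => (ug (t j i)).1)) ->
  exists m n (p : formula Lc_atom m.+1 n) (s' : 'I_m -> nat) (t' : 'I_n -> nat),
    holdsA p (scons a (fun i => (uk (s' i)).1)) (fun i => (ug (t' i)).1) /\
    forall x, holdsB p (scons x (fun i => (uk (s' i)).2)) (fun i => (ug (t' i)).2) ->
    forall j, (j < J)%N ->
      holdsB (pp j) (scons x (fun i => (uk (s j i)).2)) (fun i => (ug (t j i)).2).
Proof.
move=> hA; elim: J => [|J [m [n [p [s' [t' [pA pB]]]]]]].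
  exists 0%N, 0%N, (Imp (Bot Lc_atom _ _) (Bot Lc_atom _ _)), (fun=> 0%N), (fun=> 0%N).
  by split.
pose glue k l (u : 'I_k -> nat) (v : 'I_l -> nat) (i : 'I_(k + l)) :=
  match split i with inl i1 => u i1 | inr i2 => v i2 end.
have glueL k l u v i : @glue k l u v (lshift l i) = u i.
  by rewrite /glue (unsplitK (inl i)).
have glueR k l u v i : @glue k l u v (rshift k i) = v i.
  by rewrite /glue (unsplitK (inr i)).
exists (m + mm J)%N, (n + nn J)%N,
  (fAnd (cren p (up (@lshift m (mm J))) (@lshift n (nn J)))
        (cren (pp J) (up (@rshift m (mm J))) (@rshift n (nn J)))),
  (glue _ _ s' (s J)), (glue _ _ t' (t J)).
split.
  rewrite holds_And !holds_ren !scons_up; split.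
    by under eq_fun do rewrite glueL; under [X in holdsA _ _ X]eq_fun do rewrite glueL.
  by under eq_fun do rewrite glueR; under [X in holdsA _ _ X]eq_fun do rewrite glueR.
move=> x; rewrite holds_And !holds_ren !scons_up => -[h1 h2] j.
rewrite ltnS leq_eqVlt => /orP[/eqP ->|]; last first.
  apply: pB; move: h1.
  by under eq_fun do rewrite glueL; under [X in holdsB _ _ X]eq_fun do rewrite glueL.
move: h2.
by under eq_fun do rewrite glueR; under [X in holdsB _ _ X]eq_fun do rewrite glueR.
Qed.

Lemma conj_constraintsG (a : sc_G A) (uk : nat -> sc_k A * sc_k B)
    (ug : nat -> sc_G A * sc_G B) (mm nn : nat -> nat)
    (pp : forall j, formula Lc_atom (mm j) (nn j).+1)
    (s : forall j, 'I_(mm j) -> nat) (t : forall j, 'I_(nn j) -> nat) J :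
  (forall j, holdsA (pp j) (fun i => (uk (s j i)).1) (scons a (fun i => (ug (t j i)).1))) ->
  exists m n (p : formula Lc_atom m n.+1) (s' : 'I_m -> nat) (t' : 'I_n -> nat),
    holdsA p (fun i => (uk (s' i)).1) (scons a (fun i => (ug (t' i)).1)) /\
    forall x, holdsB p (fun i => (uk (s' i)).2) (scons x (fun i => (ug (t' i)).2)) ->
    forall j, (j < J)%N ->
      holdsB (pp j) (fun i => (uk (s j i)).2) (scons x (fun i => (ug (t j i)).2)).
Proof.
move=> hA; elim: J => [|J [m [n [p [s' [t' [pA pB]]]]]]].
  exists 0%N, 0%N, (Imp (Bot Lc_atom _ _) (Bot Lc_atom _ _)), (fun=> 0%N), (fun=> 0%N).
  by split.
pose glue k l (u : 'I_k -> nat) (v : 'I_l -> nat) (i : 'I_(k + l)) :=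
  match split i with inl i1 => u i1 | inr i2 => v i2 end.
have glueL k l u v i : @glue k l u v (lshift l i) = u i.
  by rewrite /glue (unsplitK (inl i)).
have glueR k l u v i : @glue k l u v (rshift k i) = v i.
  by rewrite /glue (unsplitK (inr i)).
exists (m + mm J)%N, (n + nn J)%N,
  (fAnd (cren p (@lshift m (mm J)) (up (@lshift n (nn J))))
        (cren (pp J) (@rshift m (mm J)) (up (@rshift n (nn J))))),
  (glue _ _ s' (s J)), (glue _ _ t' (t J)).
split.
  rewrite holds_And !holds_ren !scons_up; split.
    by under eq_fun do rewrite glueL; under [X in holdsA _ _ (scons a X)]eq_fun do rewrite glueL.
  by under eq_fun do rewrite glueR; under [X in holdsA _ _ (scons a X)]eq_fun do rewrite glueR.
move=> x; rewrite holds_And !holds_ren !scons_up => -[h1 h2] j.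
rewrite ltnS leq_eqVlt => /orP[/eqP ->|]; last first.
  apply: pB; move: h1.
  by under eq_fun do rewrite glueL; under [X in holdsB _ _ (scons x X)]eq_fun do rewrite glueL.
move: h2.
by under eq_fun do rewrite glueR; under [X in holdsB _ _ (scons x X)]eq_fun do rewrite glueR.
Qed.

(** b realizes in B the image of the type of a over the domain: a countable type, finitely
    satisfiable because the map is elementary. *)
Lemma El_stepK Rk Rg a : El Rk Rg -> enumerable Rk -> enumerable Rg ->
  exists b, El (add_pair Rk a b) Rg.
Proof.
move=> el [uk [ukR Ruk]] [ug [ugR Rug]].
pose c j : fcode := odflt (0%N, 0%N, GenTree.Leaf 0%N, [::], [::]) (unpickle j).
pose mm j := (c j).1.1.1.1; pose nn j := (c j).1.1.1.2.
pose s j (i : 'I_(mm j)) := nth 0%N (c j).1.2 i.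
pose t j (i : 'I_(nn j)) := nth 0%N (c j).2 i.
pose F j := fdec Lc_adec (mm j).+1 (nn j) (c j).1.1.2.
pose hA j := holdsA (F j) (scons a (fun i => (uk (s j i)).1)) (fun i => (ug (t j i)).1).
(* Formulas false of a are replaced by a tautology, so that every constraint holds of a. *)
pose pp j := if pselect (hA j) then F j
  else Imp (Bot Lc_atom (mm j).+1 (nn j)) (Bot Lc_atom (mm j).+1 (nn j)).
have ppA j : holdsA (pp j) (scons a (fun i => (uk (s j i)).1)) (fun i => (ug (t j i)).1).
  by rewrite /pp; case: pselect => //= _; apply.
have [J|b bP] := satB.1 (fun j => @LcK B _ _ (pp j) (fun i => (uk (s j i)).2)
                                      (fun i => (ug (t j i)).2)).
  have [m [n [p [s' [t' [pA pB]]]]]] := @conj_constraintsK a uk ug mm nn pp s t J ppA.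
  have /holds_ExK[x xP] : holdsB (fExK p) (fun i => (uk (s' i)).2) (fun i => (ug (t' i)).2).
    apply/(el _ _ _ (fun i => (uk (s' i)).1) _ (fun i => (ug (t' i)).1)) => //.
    by apply/holds_ExK; exists a.
  by exists x => j /(pB _ xP).
have main m n (p : formula Lc_atom m.+1 n) (s' : 'I_m -> nat) (t' : 'I_n -> nat) :
    holdsA p (scons a (fun i => (uk (s' i)).1)) (fun i => (ug (t' i)).1) ->
    holdsB p (scons b (fun i => (uk (s' i)).2)) (fun i => (ug (t' i)).2).
  have [d dp] := fdec_surj Lc_adec_surj p.
  have [r rs] := list_of_fun s'; have [q qt] := list_of_fun t'.
  have := bP (pickle ((m, n, d, r, q) : fcode)); rewrite /lsatK /= /pp /hA /F /s /t /mm /nn /c.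
  rewrite pickleK /= dp; under [X in scons b X]eq_fun do rewrite rs.
  under [X in holdsB _ _ X]eq_fun do rewrite qt.
  case: pselect => // + _ hp; case.
  under [X in scons a X]eq_fun do rewrite rs.
  by under [X in holdsA _ _ X]eq_fun do rewrite qt.
have imp m n (p : formula Lc_atom m n) e1 e2 f1 f2 :
    (forall i, add_pair Rk a b (e1 i) (e2 i)) -> (forall i, Rg (f1 i) (f2 i)) ->
    holdsA p e1 f1 -> holdsB p e2 f2.
  move=> he hf.
  have /boolp.choice[o oP] : forall i, exists o : option nat,
      if o is Some j then uk j = (e1 i, e2 i) else e1 i = a /\ e2 i = b.
    by move=> i; have [/Ruk[j]|] := he i; [exists (Some j) | exists None].
  have /boolp.choice[t' t'P] : forall i, exists j, ug j = (f1 i, f2 i).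
    by move=> i; apply: Rug.
  (* Parameters that are the new pair are renamed to the distinguished variable; the others are
     shifted past it. *)
  pose r i := if o i is Some _ then lift ord0 i else ord0.
  have := main m n (cren p r id) (fun i => odflt 0%N (o i)) t'; rewrite !holds_ren.
  have -> : (fun i => scons a (fun i => (uk (odflt 0%N (o i))).1) (r i)) = e1.
    apply/funext => i; have := oP i; rewrite /r.
    case oi: (o i) => [j|]; first by rewrite sconsS oi /= => ->.
    by rewrite scons0 => -[-> _].
  have -> : (fun i => scons b (fun i => (uk (odflt 0%N (o i))).2) (r i)) = e2.
    apply/funext => i; have := oP i; rewrite /r.
    case oi: (o i) => [j|]; first by rewrite sconsS oi /= => ->.
    by rewrite scons0 => -[_ ->].
  have -> : (fun i => (ug (t' i)).1) = f1 by apply/funext => i; rewrite t'P.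
  by have -> : (fun i => (ug (t' i)).2) = f2 by apply/funext => i; rewrite t'P.
exists b => m n p e1 e2 f1 f2 he hf; split; first exact: imp.
(* The converse is the implication just proved, applied to the negation. *)
move=> pB; apply: contrapT => npA.
by apply: (imp _ _ (Imp p (Bot Lc_atom m n)) e1 e2 f1 f2).
Qed.

Lemma El_stepG Rk Rg a : El Rk Rg -> enumerable Rk -> enumerable Rg ->
  exists b, El Rk (add_pair Rg a b).
Proof.
move=> el [uk [ukR Ruk]] [ug [ugR Rug]].
pose c j : fcode := odflt (0%N, 0%N, GenTree.Leaf 0%N, [::], [::]) (unpickle j).
pose mm j := (c j).1.1.1.1; pose nn j := (c j).1.1.1.2.
pose s j (i : 'I_(mm j)) := nth 0%N (c j).1.2 i.
pose t j (i : 'I_(nn j)) := nth 0%N (c j).2 i.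
pose F j := fdec Lc_adec (mm j) (nn j).+1 (c j).1.1.2.
pose hA j := holdsA (F j) (fun i => (uk (s j i)).1) (scons a (fun i => (ug (t j i)).1)).
pose pp j := if pselect (hA j) then F j
  else Imp (Bot Lc_atom (mm j) (nn j).+1) (Bot Lc_atom (mm j) (nn j).+1).
have ppA j : holdsA (pp j) (fun i => (uk (s j i)).1) (scons a (fun i => (ug (t j i)).1)).
  by rewrite /pp; case: pselect => //= _; apply.
have [J|b bP] := satB.2 (fun j => @LcG B _ _ (pp j) (fun i => (uk (s j i)).2)
                                      (fun i => (ug (t j i)).2)).
  have [m [n [p [s' [t' [pA pB]]]]]] := @conj_constraintsG a uk ug mm nn pp s t J ppA.
  have /holds_ExG[x xP] : holdsB (fExG p) (fun i => (uk (s' i)).2) (fun i => (ug (t' i)).2).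
    apply/(el _ _ _ (fun i => (uk (s' i)).1) _ (fun i => (ug (t' i)).1)) => //.
    by apply/holds_ExG; exists a.
  by exists x => j /(pB _ xP).
have main m n (p : formula Lc_atom m n.+1) (s' : 'I_m -> nat) (t' : 'I_n -> nat) :
    holdsA p (fun i => (uk (s' i)).1) (scons a (fun i => (ug (t' i)).1)) ->
    holdsB p (fun i => (uk (s' i)).2) (scons b (fun i => (ug (t' i)).2)).
  have [d dp] := fdec_surj Lc_adec_surj p.
  have [r rs] := list_of_fun s'; have [q qt] := list_of_fun t'.
  have := bP (pickle ((m, n, d, r, q) : fcode)); rewrite /lsatG /= /pp /hA /F /s /t /mm /nn /c.
  rewrite pickleK /= dp; under [X in scons b X]eq_fun do rewrite qt.
  under [X in holdsB _ X]eq_fun do rewrite rs.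
  case: pselect => // + _ hp; case.
  under [X in scons a X]eq_fun do rewrite qt.
  by under [X in holdsA _ X]eq_fun do rewrite rs.
have imp m n (p : formula Lc_atom m n) e1 e2 f1 f2 :
    (forall i, Rk (e1 i) (e2 i)) -> (forall i, add_pair Rg a b (f1 i) (f2 i)) ->
    holdsA p e1 f1 -> holdsB p e2 f2.
  move=> he hf.
  have /boolp.choice[o oP] : forall i, exists o : option nat,
      if o is Some j then ug j = (f1 i, f2 i) else f1 i = a /\ f2 i = b.
    by move=> i; have [/Rug[j]|] := hf i; [exists (Some j) | exists None].
  have /boolp.choice[s' s'P] : forall i, exists j, uk j = (e1 i, e2 i).
    by move=> i; apply: Ruk.
  pose r i := if o i is Some _ then lift ord0 i else ord0.
  have := main m n (cren p id r) s' (fun i => odflt 0%N (o i)); rewrite !holds_ren.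
  have -> : (fun i => scons a (fun i => (ug (odflt 0%N (o i))).1) (r i)) = f1.
    apply/funext => i; have := oP i; rewrite /r.
    case oi: (o i) => [j|]; first by rewrite sconsS oi /= => ->.
    by rewrite scons0 => -[-> _].
  have -> : (fun i => scons b (fun i => (ug (odflt 0%N (o i))).2) (r i)) = f2.
    apply/funext => i; have := oP i; rewrite /r.
    case oi: (o i) => [j|]; first by rewrite sconsS oi /= => ->.
    by rewrite scons0 => -[_ ->].
  have -> : (fun i => (uk (s' i)).1) = e1 by apply/funext => i; rewrite s'P.
  by have -> : (fun i => (uk (s' i)).2) = e2 by apply/funext => i; rewrite s'P.
exists b => m n p e1 e2 f1 f2 he hf; split; first exact: imp.
move=> pB; apply: contrapT => npA.
by apply: (imp _ _ (Imp p (Bot Lc_atom m n)) e1 e2 f1 f2).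
Qed.

End PartialElementary.

(** The one-element steps are iterated along both sequences; a formula meets finitely many
    parameters, so the union of the chain is still elementary. *)
Lemma El_extend (A B : Lc_structure) Rk Rg (a : nat -> sc_k A) (g : nat -> sc_G A) :
  lsaturated B -> El Rk Rg -> enumerable Rk -> enumerable Rg ->
  exists (Pk : sc_k A -> sc_k B -> Prop) (Pg : sc_G A -> sc_G B -> Prop),
  [/\ El Pk Pg, forall x y, Rk x y -> Pk x y, forall x y, Rg x y -> Pg x y,
      forall j, exists b, Pk (a j) b & forall j, exists h, Pg (g j) h].
Proof.
move=> satB el0 ek0 eg0.
pose ok (S : (sc_k A -> sc_k B -> Prop) * (sc_G A -> sc_G B -> Prop)) :=
  [/\ El S.1 S.2, enumerable S.1 & enumerable S.2].
pose le (S S' : (sc_k A -> sc_k B -> Prop) * (sc_G A -> sc_G B -> Prop)) :=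
  (forall x y, S.1 x y -> S'.1 x y) /\ (forall x y, S.2 x y -> S'.2 x y).
have step (S : {S | ok S}) j : exists S' : {S | ok S},
    [/\ le (sval S) (sval S'), exists b, (sval S').1 (a j) b &
        exists h, (sval S').2 (g j) h].
  case: S => -[Sk Sg] /= [el ek eg].
  have [b elb] := El_stepK satB (a j) el ek eg.
  have ekb := enumerable_add (a j) b ek.
  have [h elh] := El_stepG satB (g j) elb ekb eg.
  have okS : ok (add_pair Sk (a j) b, add_pair Sg (g j) h).
    by split=> //; apply: enumerable_add.
  exists (exist _ _ okS); split=> /=; first by split=> x y; left.
    by exists b; right.
  by exists h; right.
have /boolp.choice[f fP] : forall S : {S | ok S}, exists f : nat -> {S | ok S},
    forall j, [/\ le (sval S) (sval (f j)), exists b, (sval (f j)).1 (a j) b &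
        exists h, (sval (f j)).2 (g j) h].
  by move=> S; have [f fP] := boolp.choice (step S); exists f.
have ok0 : ok (Rk, Rg) by [].
pose X := fix X n : {S | ok S} := if n is n'.+1 then f (X n') n' else exist _ _ ok0.
have mono n l : le (sval (X n)) (sval (X (n + l)%N)).
  elim: l => [|l [IH1 IH2]]; first by rewrite addn0; split.
  rewrite addnS; have [[h1 h2] _ _] := fP (X (n + l)%N) (n + l)%N.
  by split=> x y h; [apply/h1/IH1 | apply/h2/IH2].
have mono' n l : (n <= l)%N -> le (sval (X n)) (sval (X l)).
  by move=> nl; rewrite -(subnKC nl).
exists (fun x y => exists n, (sval (X n)).1 x y), (fun x y => exists n, (sval (X n)).2 x y).
split.
- move=> m n p e1 e2 f1 f2 he hf.
  have [s sP] := boolp.choice he; have [t tP] := boolp.choice hf.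
  pose N := maxn (\max_i s i) (\max_i t i); have [el _ _] := svalP (X N).
  apply: el => i.
    have /mono'[h _] : (s i <= N)%N by rewrite leq_max leq_bigmax.
    exact: h.
  have /mono'[_ h] : (t i <= N)%N by rewrite leq_max leq_bigmax orbT.
  exact: h.
- by move=> x y h; exists 0%N.
- by move=> x y h; exists 0%N.
- by move=> j; have [_ [b hb] _] := fP (X j) j; exists b, j.+1.
- by move=> j; have [_ _ [b hb]] := fP (X j) j; exists b, j.+1.
Qed.

(** Indices whose pair does not come from A' and B' are filled with a pair that is already known to
    be related. *)
Lemma enumerable_pull (A B A' B' : Type) (R : A -> B -> Prop) (i : A' -> A) (j : B' -> B) x0 y0 :
  injective i -> injective j -> R (i x0) (j y0) -> enumerable R ->
  enumerable (fun x y => R (i x) (j y)).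
Proof.
move=> inj_i inj_j R0 [u [uR Ru]].
have /boolp.choice[w wP] : forall n, exists z : A' * B', R (i z.1) (j z.2) /\
    forall z', u n = (i z'.1, j z'.2) -> z = z'.
  move=> n; have [[z zn]|h] := pselect (exists z : A' * B', u n = (i z.1, j z.2)).
    exists z; split=> [|[x y]]; first by have := uR n; rewrite zn.
    by rewrite zn => -[/inj_i /= <- /inj_j /= <-]; case: (z).
  by exists (x0, y0); split=> // z' zn; case: h; exists z'.
exists w; split=> [n|x y /Ru[n un]]; first by have [] := wP n.
by exists n; have [_ h] := wP n; apply: (h (x, y)).
Qed.

Lemma definable_atdom : exists p : formula L2_atom 3 0, forall (K : Mo_model) (x c r : K) f,
  holds (@L2_atom_holds (L2_of K)) p (scons x (fun i : 'I_2 => nth 0 [:: c; r] i)) f <->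
  dom (x - c) r.
Proof.
pose i0 : 'I_3 := ord0; pose i1 : 'I_3 := lift ord0 ord0; pose i2 : 'I_3 := lift ord0 (lift ord0 ord0).
have [p hp] : @definable 3 0 (fun M e f => e i0 = e i1 \/ (e i2 <> s2_zero M /\
    s2_gle (s2_v (e i2)) (s2_v (s2_add (e i0) (s2_opp (e i1)))))) by define.
exists p => K x c r f; rewrite hp /i0 /i1 /i2 !scons0 !sconsS /= /dom subr_eq0.
split=> [[->|[/eqP -> ->]]|/orP[/eqP ->|/andP[/eqP h1 h2]]]; rewrite ?eqxx ?orbT //.
  by left.
by right.
Qed.

Lemma saturated_ball_complete (K : Mo_model) : saturated (L2_of K) -> ball_complete K.
Proof.
move=> [satK' _] c r fin; have [p hp] := definable_atdom.
have [J|x xP] := satK' (fun j => @ConstraintK (L2_of K) _ _ p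
    (fun i : 'I_2 => nth 0 [:: c j; r j] i) (fun=> 0)).
  by have [x xP] := fin J; exists x => j /xP h; apply/hp.
by exists x => j; apply/hp/(xP j).
Qed.

(** * Elementary embeddings preserve the structure *)

Section ElementaryEmbedding.
Variables (F K : Mo_model) (hK : F -> K) (hG : vgroup F -> vgroup K).
Hypothesis elem : forall m n (p : formula L2_atom m n) e f,
  holds (@L2_atom_holds (L2_of F)) p e f <->
  holds (@L2_atom_holds (L2_of K)) p (fun i => hK (e i)) (fun i => hG (f i)).

Lemma elem_def m n (P : pfun m n) : definable P -> forall e f,
  P (L2_of F) e f <-> P (L2_of K) (fun i => hK (e i)) (fun i => hG (f i)).
Proof. by move=> [p hp] e f; rewrite -!hp elem. Qed.

Let i0 m : 'I_m.+1 := ord0.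
Let i1 m : 'I_m.+2 := lift ord0 ord0.
Let i2 m : 'I_m.+3 := lift ord0 (lift ord0 ord0).

Lemma elem_eq x y : x = y <-> hK x = hK y.
Proof.
have d : @definable 2 0 (fun M e f => e (i0 _) = e (i1 _)) by define.
exact: (elem_def d (fun i => nth 0 [:: x; y] i) (fun=> 0)).
Qed.

Lemma elem0 : hK 0 = 0.
Proof.
have d : @definable 1 0 (fun M e f => e (i0 _) = s2_zero M) by define.
exact: (iffLR (elem_def d (fun i => nth 0 [:: 0] i) (fun=> 0))).
Qed.

Lemma elem1 : hK 1 = 1.
Proof.
have d : @definable 1 0 (fun M e f => e (i0 _) = s2_one M) by define.
exact: (iffLR (elem_def d (fun i => nth 0 [:: 1] i) (fun=> 0))).
Qed.

Lemma elemB x y : hK (x - y) = hK x - hK y.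
Proof.
have d : @definable 3 0 (fun M e f => e (i0 _) = s2_add (e (i1 _)) (s2_opp (e (i2 _)))) by define.
exact: (iffLR (elem_def d (fun i => nth 0 [:: x - y; x; y] i) (fun=> 0))).
Qed.

Lemma elemM x y : hK (x * y) = hK x * hK y.
Proof.
have d : @definable 3 0 (fun M e f => e (i0 _) = s2_mul (e (i1 _)) (e (i2 _))) by define.
exact: (iffLR (elem_def d (fun i => nth 0 [:: x * y; x; y] i) (fun=> 0))).
Qed.

Lemma elemV x : hK x^-1 = (hK x)^-1.
Proof.
have [->|x0] := eqVneq x 0; first by rewrite invr0 elem0 invr0.
have hx0 : hK x != 0 by apply/eqP => h; move: x0 => /eqP; apply; apply/elem_eq; rewrite elem0.
by apply: (mulfI hx0); rewrite -elemM !divff // elem1.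
Qed.

Lemma elem_der x : hK (der x) = der (hK x).
Proof.
have d : @definable 2 0 (fun M e f => e (i0 _) = s2_der (e (i1 _))) by define.
exact: (iffLR (elem_def d (fun i => nth 0 [:: der x; x] i) (fun=> 0))).
Qed.

Lemma elem_s g : hK (mo_s g) = mo_s (hG g).
Proof.
have d : @definable 1 1 (fun M e f => e (i0 _) = s2_s (f (i0 _))) by define.
exact: (iffLR (elem_def d (fun i => nth 0 [:: mo_s g] i) (fun=> g))).
Qed.

Lemma elem_c g : hK (mo_c g) = mo_c (hG g).
Proof.
have d : @definable 1 1 (fun M e f => e (i0 _) = s2_c (f (i0 _))) by define.
exact: (iffLR (elem_def d (fun i => nth 0 [:: mo_c g] i) (fun=> g))).
Qed.

Lemma elem_v x : hG (val0 x) = val0 (hK x).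
Proof.
have d : @definable 1 1 (fun M e f => f (i0 _) = s2_v (e (i0 _))) by define.
exact: (iffLR (elem_def d (fun i => nth 0 [:: x] i) (fun=> val0 x))).
Qed.

Lemma elem_le g h : (g <= h) = (hG g <= hG h).
Proof.
have d : @definable 0 2 (fun M e f => s2_gle (f (i0 _)) (f (i1 _))) by define.
by apply/idP/idP => /(elem_def d (fun=> 0) (fun i => nth 0 [:: g; h] i)).
Qed.

Lemma elemD_G g h : hG (g + h) = hG g + hG h.
Proof.
have d : @definable 0 3 (fun M e f => f (i0 _) = s2_gadd (f (i1 _)) (f (i2 _))) by define.
exact: (iffLR (elem_def d (fun=> 0) (fun i => nth 0 [:: g + h; g; h] i))).
Qed.

Lemma elem0_G : hG 0 = 0.
Proof. by apply: (addrI (hG 0)); rewrite -elemD_G !addr0. Qed.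

Lemma elemN_G g : hG (- g) = - hG g.
Proof. by apply: (addrI (hG g)); rewrite -elemD_G !subrr elem0_G. Qed.

Lemma elem_k x : (x \in mo_k F) = (hK x \in mo_k K).
Proof.
have d : @definable 1 0 (fun M e f => s2_k (e (i0 _))) by define.
by apply/idP/idP => /(elem_def d (fun i => nth 0 [:: x] i) (fun=> 0)).
Qed.

Lemma elem_dom x y : dom x y = dom (hK x) (hK y).
Proof.
have E z : (hK z == 0) = (z == 0).
  by apply/eqP/eqP => [|->]; rewrite ?elem0 // -elem0 => /elem_eq.
by rewrite /dom !E elem_le !elem_v.
Qed.

Lemma elem_sdom x y : sdom x y = sdom (hK x) (hK y).
Proof. by rewrite /sdom elem_dom. Qed.

End ElementaryEmbedding.

Section ElTerms.
Variables (A B : Lc_structure) (Rk : sc_k A -> sc_k B -> Prop) (Rg : sc_G A -> sc_G B -> Prop).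
Hypothesis el : El Rk Rg.

(** The equation between a variable and a term is a formula; so once the value of a term has an
    image, this image is the value of the term at the images. *)
Lemma El_kterm m n (t : Lc_kterm m n) e1 e2 f1 f2 :
  (forall i, Rk (e1 i) (e2 i)) -> (forall i, Rg (f1 i) (f2 i)) ->
  (exists b, Rk (Lc_keval e1 f1 t) b) -> Rk (Lc_keval e1 f1 t) (Lc_keval e2 f2 t).
Proof.
move=> he hf [b hb].
have := el (Atom (cKeq (cKvar n ord0) (ckren (lift ord0) id t)))
  (e1 := scons (Lc_keval e1 f1 t) e1) (e2 := scons b e2) (f1 := f1) (f2 := f2).
rewrite /= !ckren_eval !scons0 !scons_lift => -[] //.
  by move=> i; case: (unliftP ord0 i) => [j|] ->; rewrite ?sconsS ?scons0.
by move=> /(_ erefl) <-.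
Qed.

Lemma El_gterm n (t : Lc_gterm n) f1 f2 : (forall i, Rg (f1 i) (f2 i)) ->
  (exists b, Rg (Lc_geval f1 t) b) -> Rg (Lc_geval f1 t) (Lc_geval f2 t).
Proof.
move=> hf [b hb].
have := el (Atom (cGeq 0 (cGvar ord0) (cgren (lift ord0) t)))
  (e1 := fun=> sc_zero A) (e2 := fun=> sc_zero B)
  (f1 := scons (Lc_geval f1 t) f1) (f2 := scons b f2).
rewrite /= !cgren_eval !scons0 !scons_lift => -[] //; first by case.
  by move=> i; case: (unliftP ord0 i) => [j|] ->; rewrite ?sconsS ?scons0.
by move=> /(_ erefl) <-.
Qed.

Lemma El_inj x y x' y' : Rk x y -> Rk x' y' -> x = x' <-> y = y'.
Proof.
move=> h h'.
apply: (el (Atom (cKeq (cKvar 0 ord0) (cKvar 0 (lift ord0 ord0))))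
  (e1 := fun i : 'I_2 => nth x [:: x; x'] i) (e2 := fun i : 'I_2 => nth y [:: y; y'] i)
  (f1 := fun=> sc_gzero A) (f2 := fun=> sc_gzero B)); last by case.
by move=> [[|[|i]] hi].
Qed.

Lemma El_injG g h g' h' : Rg g h -> Rg g' h' -> g = g' <-> h = h'.
Proof.
move=> r r'.
apply: (el (Atom (cGeq 0 (cGvar ord0) (cGvar (lift ord0 ord0))))
  (e1 := fun=> sc_zero A) (e2 := fun=> sc_zero B)
  (f1 := fun i : 'I_2 => nth g [:: g; g'] i) (f2 := fun i : 'I_2 => nth h [:: h; h'] i)).
  by case.
by move=> [[|[|i]] hi].
Qed.

Lemma El_le g h g' h' : Rg g h -> Rg g' h' -> sc_gle g g' = sc_gle h h'.
Proof.
move=> r r'.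
have E := el (Atom (cGle 0 (cGvar ord0) (cGvar (lift ord0 ord0))))
  (e1 := fun=> sc_zero A) (e2 := fun=> sc_zero B)
  (f1 := fun i : 'I_2 => nth g [:: g; g'] i) (f2 := fun i : 'I_2 => nth h [:: h; h'] i).
by apply/idP/idP; apply E; by [case | move=> [[|[|i]] hi]].
Qed.

End ElTerms.

Definition kelt (K : Mo_model) (x : K) (kx : x \in mo_k K) : mo_ktype K :=
  exist (fun x => x \in mo_k K) x kx.

(** * The embedding of lift and value group given by an elementary map *)

Section Core.
Variables (K1 K2 F : Mo_model) (hK : F -> K1) (hG : vgroup F -> vgroup K1).
Hypothesis elem : forall m n (p : formula L2_atom m n) e f,
  holds (@L2_atom_holds (L2_of F)) p e f <->
  holds (@L2_atom_holds (L2_of K1)) p (fun i => hK (e i)) (fun i => hG (f i)).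
Variables (Pk : mo_ktype K1 -> mo_ktype K2 -> Prop) (Pg : vgroup K1 -> vgroup K2 -> Prop).
Hypothesis el : @El (kGc_of K1) (kGc_of K2) Pk Pg.
Hypothesis totk : forall (a : mo_ktype K1) x, sval a = hK x -> exists b, Pk a b.
Hypothesis totg : forall g, exists h, Pg (hG g) h.

Definition coreK (x : F) (y : K2) :=
  exists a b, [/\ sval a = hK x, sval b = y & Pk a b].
Definition coreG (g : vgroup F) (h : vgroup K2) := Pg (hG g) h.

Lemma coreK_term m n (t : Lc_kterm m n) e1 e2 f1 f2 z :
  (forall i, Pk (e1 i) (e2 i)) -> (forall i, Pg (f1 i) (f2 i)) ->
  sval (@Lc_keval (kGc_of K1) m n e1 f1 t) = hK z ->
  coreK z (sval (@Lc_keval (kGc_of K2) m n e2 f2 t)).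
Proof.
move=> he hf hz; exists (@Lc_keval (kGc_of K1) m n e1 f1 t), (@Lc_keval (kGc_of K2) m n e2 f2 t).
by split=> //; apply: (El_kterm el) => //; apply: totk hz.
Qed.

Lemma coreG_term n (t : Lc_gterm n) f1 f2 g :
  (forall i, Pg (f1 i) (f2 i)) -> @Lc_geval (kGc_of K1) n f1 t = hG g ->
  coreG g (@Lc_geval (kGc_of K2) n f2 t).
Proof.
move=> hf hg; rewrite /coreG -hg; apply: (El_gterm el) => //.
by have [h gh] := totg g; exists h; rewrite hg.
Qed.

Lemma coreK_inj x y x' y' : coreK x y -> coreK x' y' -> x = x' <-> y = y'.
Proof.
move=> [a [b [ax <- ab]]] [a' [b' [ax' <- ab']]].
have -> : x = x' <-> a = a'.
  rewrite (elem_eq elem) -ax -ax'; split=> [|->] //; exact: val_inj.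
rewrite (El_inj el ab ab'); split=> [->|] //; exact: val_inj.
Qed.

Lemma coreK1 : coreK 1 1.
Proof.
apply: (@coreK_term 0 0 (cKone _ _) (fun=> exist _ 0 (mo_k0 _)) (fun=> exist _ 0 (mo_k0 _))
  (fun=> 0) (fun=> 0)) => [[]|[]|] //.
by rewrite /= (elem1 elem).
Qed.

Lemma coreK0 : coreK 0 0.
Proof.
apply: (@coreK_term 0 0 (cKzero _ _) (fun=> exist _ 0 (mo_k0 _)) (fun=> exist _ 0 (mo_k0 _))
  (fun=> 0) (fun=> 0)) => [[]|[]|] //.
by rewrite /= (elem0 elem).
Qed.

Lemma coreK_eq0 x y : coreK x y -> (x == 0) = (y == 0).
Proof. by move=> xy; apply/eqP/eqP => /(coreK_inj xy coreK0). Qed.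

Lemma coreKM x y x' y' : coreK x y -> coreK x' y' -> coreK (x * x') (y * y').
Proof.
move=> [a [b [ax <- ab]]] [a' [b' [ax' <- ab']]].
apply: (@coreK_term 2 0 (cKmul (cKvar _ ord0) (cKvar _ (lift ord0 ord0)))
  (fun i => nth a [:: a; a'] i) (fun i => nth b [:: b; b'] i) (fun=> 0) (fun=> 0)).
- by move=> [[|[|i]] hi].
- by case.
- by rewrite /= ax ax' (elemM elem).
Qed.

Lemma core_embedding : kG_embedding coreK coreG.
Proof.
split.
- move=> x y [a [b [ax <- ab]]]; rewrite (elem_k elem) -ax.
  by split; [case: (a) | case: (b)].
- move=> x; rewrite (elem_k elem) => kx.
  have [b hb] := totk (erefl : sval (kelt kx) = hK x).
  by exists (sval b), (kelt kx), b.
- exact: coreK1.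
- move=> x y x' y' [a [b [ax <- ab]]] [a' [b' [ax' <- ab']]].
  apply: (@coreK_term 2 0 (cKadd (cKvar _ ord0) (cKopp (cKvar _ (lift ord0 ord0))))
    (fun i => nth a [:: a; a'] i) (fun i => nth b [:: b; b'] i) (fun=> 0) (fun=> 0)).
  + by move=> [[|[|i]] hi].
  + by case.
  + by rewrite /= ax ax' (elemB elem).
- exact: coreKM.
(* Inversion is not in the language; the image of the inverse is identified by its product with
   y. *)
- move=> x y xy; have [x0|x0] := eqVneq x 0.
    have y0 : y = 0 by apply/eqP; rewrite -(coreK_eq0 xy) x0.
    by rewrite x0 y0 !invr0; apply: coreK0.
  have kx : hK x^-1 \in mo_k K1.
    by have [a [b [ax _ _]]] := xy; rewrite (elemV elem) -ax mo_kV //; case: (a).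
  have [b' hb'] := totk (erefl : sval (kelt kx) = hK x^-1).
  have x'y' : coreK x^-1 (sval b') by exists (kelt kx), b'.
  have y0 : y != 0 by rewrite -(coreK_eq0 xy).
  suff -> : y^-1 = sval b' by [].
  apply: (mulIf y0); rewrite mulVf //; apply/(coreK_inj coreK1 (coreKM x'y' xy)).
  by rewrite mulVf.
- move=> x y [a [b [ax <- ab]]].
  apply: (@coreK_term 1 0 (cKder (cKvar _ ord0)) (fun=> a) (fun=> b) (fun=> 0) (fun=> 0)) => //.
    by case.
  by rewrite /= ax (elem_der elem).
- exact: coreK_eq0.
- exact: totg.
- apply: (@coreG_term 0 (cGzero _) (fun=> 0) (fun=> 0)) => [[]|] //=.
  by rewrite (elem0_G elem).
- move=> g h g' h' gh gh'.
  apply: (@coreG_term 2 (cGadd (cGvar ord0) (cGvar (lift ord0 ord0)))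
    (fun i => nth 0 [:: hG g; hG g'] i) (fun i => nth 0 [:: h; h'] i)).
    by move=> [[|[|i]] hi].
  by rewrite /= (elemD_G elem).
- move=> g h gh; apply: (@coreG_term 1 (cGopp (cGvar ord0)) (fun=> hG g) (fun=> h)) => //=.
  by rewrite (elemN_G elem).
- by move=> g h g' h' gh gh'; rewrite (elem_le elem); apply: (El_le el gh gh').
- move=> g h gh; apply: (@coreK_term 0 1 (cKc 0 (cGvar ord0)) (fun=> exist _ 0 (mo_k0 _))
    (fun=> exist _ 0 (mo_k0 _)) (fun=> hG g) (fun=> h)) => //=; first by case.
  by rewrite (elem_c elem).
Qed.

End Core.

Lemma val0_lead (K : Mo_model) (z u : K) g : u \in mo_k K ->
  sdom (z - u * mo_s g) (u * mo_s g) -> val0 z = g.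
Proof.
move=> ku l; have z0 := sim_neq0 l; have us0 := sdom_neq0 l.
have [] := sdom_sub l; rewrite !domE // => h1 h2.
have -> : val0 z = val0 (u * mo_s g) by apply/eqP; rewrite eq_le h1 h2.
have u0 : u != 0 by apply: contraNneq us0 => ->; rewrite mul0r.
by rewrite val0M ?mo_s_neq0 // mo_k_val0 // add0r mo_sK.
Qed.

(** * Back and forth *)

Section BackAndForthSystem.
Variables (K1 K2 : Mo_model) (R : K1 -> K2 -> Prop).

Definition relK (a : mo_ktype K1) (b : mo_ktype K2) := R (sval a) (sval b).
(** The value group part of R is read through the cross-section, so that one relation between the
    fields carries both sorts. *)
Definition relG (g : vgroup K1) (h : vgroup K2) := R (mo_s g) (mo_s h).

Record bf : Prop := BF {
  bf1 : R 1 1;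
  bfB : forall x y x' y', R x y -> R x' y' -> R (x - x') (y - y');
  bfM : forall x y x' y', R x y -> R x' y' -> R (x * x') (y * y');
  bfV : forall x y, R x y -> R x^-1 y^-1;
  bf_der : forall x y, R x y -> R (der x) (der y);
  bf_lead : forall x y, R x y -> (x = 0 /\ y = 0) \/ exists u w g h,
    [/\ u \in mo_k K1 /\ w \in mo_k K2, R u w, relG g h,
        sdom (x - u * mo_s g) (u * mo_s g) & sdom (y - w * mo_s h) (w * mo_s h)];
  bf_El : @El (kGc_of K1) (kGc_of K2) relK relG;
  bf_enum : enumerable R }.

Hypothesis b : bf.

Lemma bf0 : R 0 0.
Proof. by have := bfB b (bf1 b) (bf1 b); rewrite !subrr. Qed.

Lemma bfN x y : R x y -> R (- x) (- y).
Proof. by move=> h; have := bfB b bf0 h; rewrite !sub0r. Qed.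

Lemma bfD x y x' y' : R x y -> R x' y' -> R (x + x') (y + y').
Proof. by move=> h /bfN h'; have := bfB b h h'; rewrite !opprK. Qed.

(** The difference of two related pairs is 0 on both sides or has leading terms on both. *)
Lemma bf_inj x y x' y' : R x y -> R x' y' -> x = x' <-> y = y'.
Proof.
move=> h h'; have := bf_lead b (bfB b h h').
case=> [[/eqP + /eqP]|[u [w [g [k [_ _ _ /sim_neq0 + /sim_neq0]]]]]].
  by rewrite !subr_eq0 => /eqP -> /eqP ->.
by rewrite !subr_eq0 => /eqP h1 /eqP h2; split=> e; [case: (h1 e) | case: (h2 e)].
Qed.

Lemma bf_v x y : R x y -> relG (val0 x) (val0 y).
Proof.
move=> xy; have [[-> ->]|[u [w [g [h [[ku kw] _ gh l l']]]]]] := bf_lead b xy.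
  by rewrite !val00 /relG !mo_s0; apply: bf1.
by rewrite (val0_lead ku l) (val0_lead kw l').
Qed.

Lemma relG0 : relG 0 0.
Proof. by rewrite /relG !mo_s0; apply: bf1. Qed.

Lemma relGD g h g' h' : relG g h -> relG g' h' -> relG (g + g') (h + h').
Proof. by rewrite /relG !mo_sD; apply: bfM. Qed.

Lemma relGN g h : relG g h -> relG (- g) (- h).
Proof. by rewrite /relG !mo_sN; apply: bfV. Qed.

Lemma relG_c g h : relG g h -> R (mo_c g) (mo_c h).
Proof. by move=> gh; rewrite !mo_cE; apply: (bfM b (bf_der b gh) (bfV b gh)). Qed.

End BackAndForthSystem.

(** An element of the lift is its own leading coefficient, so its partner is the corresponding
    leading coefficient, which lies in the lift. *)
Lemma bf_k_sub (K1 K2 : Mo_model) (R : K1 -> K2 -> Prop) : bf R ->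
  forall x y, R x y -> x \in mo_k K1 -> y \in mo_k K2.
Proof.
move=> b x y xy kx.
have [[_ ->]|[u [w [g [h [[ku kw] uw gh l l']]]]]] := bf_lead b xy; first exact: mo_k0.
have g0 : g = 0 by rewrite -(val0_lead ku l) mo_k_val0.
have h0 : h = 0 by apply/(El_injG (bf_El b) gh (relG0 b)).
rewrite h0 mo_s0 mulr1 in l'; rewrite g0 mo_s0 mulr1 in l.
have xu : x = u by apply: mo_k_sdom => //; apply: sdom_dom_trans l _; apply: mo_k_dom1.
by rewrite (iffLR (bf_inj b xy uw) xu).
Qed.

(** Symmetry of the conditions; it turns the forth step into the back step. *)
Lemma bf_flip (K1 K2 : Mo_model) (R : K1 -> K2 -> Prop) : bf R -> bf (fun y x => R x y).
Proof.
move=> b; split.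
- exact: bf1 b.
- by move=> x y x' y'; apply: (bfB b).
- by move=> x y x' y'; apply: (bfM b).
- by move=> x y; apply: (bfV b).
- by move=> x y; apply: (bf_der b).
- move=> x y /(bf_lead b)[[-> ->]|[u [w [g [h [[ku kw] uw gh l l']]]]]]; first by left.
  by right; exists w, u, h, g.
- by move=> m n p e1 e2 f1 f2 he hf; rewrite (bf_El b p he hf).
- have [u [uR Ru]] := bf_enum b; exists (fun j => ((u j).2, (u j).1)); split=> [j|y x /Ru[j uj]].
    exact: uR.
  by exists j; rewrite uj.
Qed.

Lemma bf_k (K1 K2 : Mo_model) (R : K1 -> K2 -> Prop) : bf R ->
  forall x y, R x y -> (x \in mo_k K1) = (y \in mo_k K2).
Proof.
by move=> b x y xy; apply/idP/idP; [exact: (bf_k_sub b xy) | exact: (bf_k_sub (bf_flip b) xy)].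
Qed.

Lemma bf_eval (K1 K2 : Mo_model) (R : K1 -> K2 -> Prop) m n e1 e2 f1 f2 : bf R ->
  (forall i, R (e1 i) (e2 i)) -> (forall i, relG R (f1 i) (f2 i)) ->
  (forall t, R (@L2_keval (L2_of K1) m n e1 f1 t) (@L2_keval (L2_of K2) m n e2 f2 t)) /\
  (forall t, relG R (@L2_geval (L2_of K1) m n e1 f1 t) (@L2_geval (L2_of K2) m n e2 f2 t)).
Proof.
move=> b he hf; apply: L2_term_ind => //=.
- exact: bf0.
- exact: bf1.
- by move=> t ht u hu; apply: bfD.
- by move=> t ht; apply: bfN.
- by move=> t ht u hu; apply: bfM.
- by move=> t ht; apply: bf_der.
- by move=> t ht; apply: relG_c.
- exact: relG0.
- by move=> t ht u hu; apply: relGD.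
- by move=> t ht; apply: relGN.
- by move=> t ht; apply: bf_v.
Qed.

(** * Extending a position to a countable elementary submodel *)

Section CoreExtension.
Variables (K1 K2 F : Mo_model) (hK : F -> K1) (hG : vgroup F -> vgroup K1).
Hypothesis elem : forall m n (p : formula L2_atom m n) e f,
  holds (@L2_atom_holds (L2_of F)) p e f <->
  holds (@L2_atom_holds (L2_of K1)) p (fun i => hK (e i)) (fun i => hG (f i)).
Variables (Pk : mo_ktype K1 -> mo_ktype K2 -> Prop) (Pg : vgroup K1 -> vgroup K2 -> Prop).
Hypothesis el : @El (kGc_of K1) (kGc_of K2) Pk Pg.
Hypothesis totk : forall (a : mo_ktype K1) x, sval a = hK x -> exists b, Pk a b.
Hypothesis totg : forall g, exists h, Pg (hG g) h.
Hypotheses (hF : d_henselian F) (h2 : d_henselian K2) (sat2 : saturated (L2_of K2)).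
Variables (u : nat -> F) (u_surj : forall x, exists j, u j = x).
Variable R0 : F -> K2 -> Prop.
Local Notation Psi := (coreK hK Pk).
Local Notation iota := (coreG hG Pg).
Hypothesis R01 : R0 1 1.
Hypothesis R0B : forall x y x' y', R0 x y -> R0 x' y' -> R0 (x - x') (y - y').
Hypothesis R0M : forall x y x' y', R0 x y -> R0 x' y' -> R0 (x * x') (y * y').
Hypothesis R0V : forall x y, R0 x y -> R0 x^-1 y^-1.
Hypothesis R0_der : forall x y, R0 x y -> R0 (der x) (der y).
Hypothesis R0_LT : forall x y, R0 x y -> (x = 0 /\ y = 0) \/ exists u w g h,
  [/\ leads Psi iota x y u w g h, R0 u w & R0 (mo_s g) (mo_s h)].

Lemma bf_exists : exists R, [/\ bf R, forall x y, R0 x y -> R (hK x) y &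
  forall x, exists y, R (hK x) y].
Proof.
have emb := core_embedding elem el totk totg.
have [R1 [g1 R01' R1Psi R1iota]] := giso_base emb R01 R0B R0M R0V R0_der R0_LT.
have [R2 [g2 R12 R2tot]] :=
  giso_total emb hF h2 (saturated_ball_complete sat2) u_surj g1 R1Psi R1iota.
have R2Psi x y : Psi x y -> R2 x y by move=> /R1Psi /R12.
have R2iota g h : iota g h -> R2 (mo_s g) (mo_s h) by move=> /R1iota /R12.
exists (fun x y => exists2 z, x = hK z & R2 z y); split; last first.
- by move=> x; have [y xy] := R2tot x; exists y, x.
- by move=> x y xy; exists x => //; apply/R12/R01'.
split.
- by exists 1; [rewrite (elem1 elem) | apply: giso1 g2].
- move=> _ y _ y' [z -> zy] [z' -> zy']; exists (z - z'); first by rewrite (elemB elem).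
  exact: (gisoB g2).
- move=> _ y _ y' [z -> zy] [z' -> zy']; exists (z * z'); first by rewrite (elemM elem).
  exact: (gisoM g2).
- by move=> _ y [z -> zy]; exists z^-1; [rewrite (elemV elem) | apply: (gisoV g2)].
- by move=> _ y [z -> zy]; exists (der z); [rewrite (elem_der elem) | apply: (giso_der g2)].
- move=> _ y [z -> /(giso_LT g2)[[-> ->]|[v [w [g [h [vw v0 gh l l']]]]]]].
    by left; rewrite (elem0 elem).
  have [kv kw] := Psi_k emb vw.
  right; exists (hK v), w, (hG g), h; split=> //.
  + by rewrite -(elem_k elem).
  + by exists v => //; apply: R2Psi.
  + by exists (mo_s g); [rewrite (elem_s elem) | apply: R2iota].
  + by rewrite -(elem_s elem) -(elemM elem) -(elemB elem) -(elem_sdom elem).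
(* On lifts and values the new relation is contained in [Pk] and [Pg], because the embedding is
   functional and extends [Psi] and [iota]. *)
- move=> m n p e1 e2 f1 f2 he hf; apply: el => i.
    have [z ez zy] := he i; have [w ezw] := totk ez.
    have zw : R2 z (sval w) by apply: R2Psi; exists (e1 i), w.
    by rewrite (val_inj (giso_fun g2 zy zw) : e2 i = w).
  have [z fz zy] := hf i; have [h hh] := totg (val0 z).
  have fz' : f1 i = hG (val0 z) by rewrite (elem_v elem) -fz mo_sK.
  have zs : z = mo_s (val0 z).
    by apply/(elem_eq elem); rewrite (elem_s elem) -fz' fz.
  rewrite fz'; suff -> : f2 i = h by [].
  rewrite zs in zy; have := giso_fun g2 zy (R2iota _ _ hh).
  by move/(congr1 (@val0 K2)); rewrite !mo_sK.
- have /boolp.choice[f fP] := R2tot; exists (fun j => (hK (u j), f (u j))).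
  split=> [j|_ y [z -> zy]]; first by exists (u j).
  by have [j uj] := u_surj z; exists j; rewrite uj (giso_fun g2 zy (fP z)).
Qed.

End CoreExtension.

Section Forth.
Variables (K1 K2 : Mo_model).
Hypotheses (h1 : d_henselian K1) (h2 : d_henselian K2) (sat2 : saturated (L2_of K2)).

Lemma countable_extension (Rk : mo_ktype K1 -> mo_ktype K2 -> Prop)
    (Rg : vgroup K1 -> vgroup K2 -> Prop) (SK : nat -> K1) :
  @El (kGc_of K1) (kGc_of K2) Rk Rg -> enumerable Rk -> enumerable Rg ->
  exists (F : Mo_model) (hK : F -> K1) (hG : vgroup F -> vgroup K1) Pk Pg,
  [/\ (forall m n (p : formula L2_atom m n) e f,
        holds (@L2_atom_holds (L2_of F)) p e f <->
        holds (@L2_atom_holds (L2_of K1)) p (fun i => hK (e i)) (fun i => hG (f i))),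
      d_henselian F /\ (exists u : nat -> F, forall x, exists j, u j = x),
      forall j, exists x, hK x = SK j,
      [/\ @El (kGc_of K1) (kGc_of K2) Pk Pg,
          forall a b, Rk a b -> Pk a b & forall g h, Rg g h -> Pg g h] &
      (forall (a : mo_ktype K1) x, sval a = hK x -> exists b, Pk a b) /\
      (forall g, exists h, Pg (hG g) h)].
Proof.
move=> el ek eg.
have [M0 [hK [hG [elem [u u_surj] hSK]]]] := @lowenheim_skolem (L2_of K1) SK.
have [p|F [M0F hF]] := model_of_theory h1 (M := M0).
  rewrite /L2_true elem; rewrite /L2_Th /L2_true.
  by rewrite (ord0_fun (fun i => hK _) (fun=> s2_zero (L2_of K1)))
             (ord0_fun (fun i => hG _) (fun=> s2_gzero (L2_of K1))).
subst M0.
have kz : 0 \in mo_k K1 := mo_k0 K1.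
(* The elements of the lift among the [hK (u j)], with 0 in place of the others. *)
pose a j : mo_ktype K1 := insubd (kelt kz) (hK (u j)).
have sat2' := saturated_kGc sat2.
have [Pk [Pg [elP RPk RPg Pka Pgg]]] :=
  El_extend (A := kGc_of K1) a (fun j => hG (val0 (u j))) sat2' el ek eg.
exists F, hK, hG, Pk, Pg; split=> //; first by split=> //; exists u.
split=> [c x cx|g].
  have [j uj] := u_surj x; have [b ab] := Pka j; exists b.
  suff <- : a j = c by [].
  by apply: val_inj; rewrite /a val_insubd uj -cx /=; case: ifP => //; case: c {cx} => y /= ->.
have [j uj] := u_surj (mo_s g); have [h gh] := Pgg j; exists h.
by rewrite uj mo_sK in gh.
Qed.

Lemma bf_forth (R : K1 -> K2 -> Prop) x : bf R ->
  exists2 R', bf R' & (forall x y, R x y -> R' x y) /\ exists y, R' x y.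
Proof.
move=> b; have [u [uR Ru]] := bf_enum b.
have sv (K : Mo_model) : injective (fun a : mo_ktype K => sval a) by exact: val_inj.
have sI (K : Mo_model) : injective (@mo_s K) by move=> g h /(congr1 (@val0 K)); rewrite !mo_sK.
have ek : enumerable (relK R).
  apply: (@enumerable_pull _ _ _ _ _ _ _ (kelt (mo_k0 K1)) (kelt (mo_k0 K2))
    (@sv K1) (@sv K2) (bf0 b) (bf_enum b)).
have eg : enumerable (relG R).
  exact: (@enumerable_pull _ _ _ _ _ _ _ 0 0 (@sI K1) (@sI K2) (relG0 b) (bf_enum b)).
(* F is made to contain the new element x, at index 0, and the domain of R. *)
pose SK j := if j is j'.+1 then (u j').1 else x.
have [F [hK [hG [Pk [Pg [elem [hF [uF uF_surj]] hSK [el RPk RPg] [totk totg]]]]]]] :=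
  countable_extension SK (bf_El b) ek eg.
have [||||||R' [b' RR' R'tot]] := bf_exists elem el totk totg hF h2 sat2 uF_surj
    (R0 := fun z y => R (hK z) y).
- by rewrite (elem1 elem); apply: bf1.
- by move=> z y z' y'; rewrite (elemB elem); apply: bfB.
- by move=> z y z' y'; rewrite (elemM elem); apply: bfM.
- by move=> z y; rewrite (elemV elem); apply: bfV.
- by move=> z y; rewrite (elem_der elem); apply: bf_der.
(* R provides leading terms with factors in K1, and these must be recovered in F. The element z has
   a leading coefficient v' in F, and by uniqueness of leading coefficients its image is v. *)
- move=> z y zy; have [[z0 y0]|[v [w [g [h [[kv kw] vw gh l l']]]]]] := bf_lead b zy.
    by left; split=> //; apply/(elem_eq elem); rewrite z0 (elem0 elem).
  right; have z0 : z != 0.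
    by apply: contraNneq (sim_neq0 l) => ->; rewrite (elem0 elem).
  have [v' kv' [v'0 lv']] := leading_coef z0.
  have gz : g = hG (val0 z) by rewrite (elem_v elem) (val0_lead kv l).
  have vv' : v = hK v'.
    have lv : sdom (hK z - hK v' * mo_s g) (hK z).
      by rewrite gz -(elem_s elem) -(elemM elem) -(elemB elem) -(elem_sdom elem).
    have kv'' : hK v' \in mo_k K1 by rewrite -(elem_k elem).
    have hz0 := sdom_neq0 lv; have [zg _] := asymp_s hz0.
    rewrite -(elem_v elem) -gz in zg.
    apply: mo_k_sdom => //; rewrite -(sdomMr _ _ (mo_s_neq0 g)) mul1r mulrBl.
    have -> : v * mo_s g - hK v' * mo_s g =
        (hK z - hK v' * mo_s g) - (hK z - v * mo_s g) by ring.
    apply: sdomB; first exact: sdom_dom_trans lv zg.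
    apply: sdom_dom_trans l _; rewrite -[X in dom _ X]mul1r domMr ?mo_s_neq0 //.
    exact: mo_k_dom1.
  exists v', w, (val0 z), h; split; last 2 first.
  + by rewrite -vv'.
  + by rewrite (elem_s elem) -gz.
  split=> //.
  + by exists (kelt kv), (kelt kw); split=> //; apply: RPk.
  + by rewrite /coreG -gz; apply: RPg.
  + by apply: sim_sym; rewrite -sdomNl opprB.
exists R'; first exact: b'.
split=> [x' y' xy|]; last first.
  by have [z zx] : exists z, hK z = x := hSK 0%N; rewrite -zx; apply: R'tot.
have [j uj] := Ru _ _ xy; have [z zj] := hSK j.+1.
by have := RR' z y'; rewrite zj /= uj; apply.
Qed.

(** Nonzero elements of the lift are their own leading terms, with value 0, so the embedded lift of
    a countable submodel is a base to which [bf_exists] applies. *)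
Lemma bf_start : (forall p, Lc_true (kGc_of K1) p <-> Lc_true (kGc_of K2) p) ->
  exists R : K1 -> K2 -> Prop, bf R.
Proof.
move=> eqv.
have one A B (x : A) (y : B) : enumerable (fun x' y' => x' = x /\ y' = y).
  by exists (fun=> (x, y)); split=> // x' y' [-> ->]; exists 0%N.
have [F [hK [hG [Pk [Pg [elem [hF [uF uF_surj]] _ [el _ RPg] [totk totg]]]]]]] :=
  countable_extension (fun=> 0) (El_zero eqv) (one _ _ _ _) (one _ _ _ _).
have emb := core_embedding elem el totk totg.
have [||||||R [b _ _]] := bf_exists elem el totk totg hF h2 sat2 uF_surj
    (R0 := coreK hK Pk); last by exists R.
- exact: Psi1 emb.
- exact: PsiB emb.
- exact: PsiM emb.
- exact: PsiV emb.
- exact: Psi_der emb.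
move=> x y xy; have := Psi_eq0 emb xy; have [-> /esym/eqP ->|x0 /esym/negbT y0] := eqVneq x 0.
  by left.
right; exists x, y, 0, 0; rewrite !mo_s0; split=> //; last exact: Psi1 emb.
by split=> //; [apply: iota0 emb | |]; rewrite mo_s0 mulr1 subrr sdom0.
Qed.

End Forth.

Lemma iff_of_eq (b c : bool) : b = c -> b <-> c.
Proof. by move=> ->. Qed.

Lemma bf_holds (K1 K2 : Mo_model) : d_henselian K1 -> saturated (L2_of K1) ->
  d_henselian K2 -> saturated (L2_of K2) ->
  forall m n (p : formula L2_atom m n) (R : K1 -> K2 -> Prop) e1 e2 f1 f2, bf R ->
  (forall i, R (e1 i) (e2 i)) -> (forall i, relG R (f1 i) (f2 i)) ->
  holds (@L2_atom_holds (L2_of K1)) p e1 f1 <-> holds (@L2_atom_holds (L2_of K2)) p e2 f2.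
Proof.
move=> h1 sat1 h2 sat2 m n p.
have sP A B (R : A -> B -> Prop) l (a : A) (b : B) (e1 : 'I_l -> A) e2 : R a b ->
    (forall i, R (e1 i) (e2 i)) -> forall i, R (scons a e1 i) (scons b e2 i).
  by move=> ab he i; case: (unliftP ord0 i) => [j|] ->; rewrite ?sconsS ?scons0.
elim: p => {m n} [m n a|m n|m n p IHp q IHq|m n p IH|m n p IH] R e1 e2 f1 f2 b he hf //=.
- have [evK evG] := bf_eval b he hf; case: a => [t u|t|t u|t u] /=.
  + exact: (bf_inj b).
  + exact: (iff_of_eq (bf_k b (evK t))).
  + exact: (El_injG (bf_El b)).
  + exact: (iff_of_eq (El_le (bf_El b) (evG t) (evG u))).
- by rewrite (IHp R e1 e2 f1 f2 b he hf) (IHq R e1 e2 f1 f2 b he hf).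
- split=> h a.
    have [R' b' [RR' [x ax]]] := bf_forth h2 h1 sat1 a (bf_flip b).
    have he' := sP _ _ (fun x y => R' y x) _ _ _ _ _ ax (fun i => RR' _ _ (he i)).
    apply: (iffLR (IH _ _ _ _ _ (bf_flip b') he' (fun i => RR' _ _ (hf i)))).
    exact: h.
  have [R' b' [RR' [y ay]]] := bf_forth h1 h2 sat2 a b.
  have he' := sP _ _ _ _ _ _ _ _ ay (fun i => RR' _ _ (he i)).
  by apply: (iffRL (IH _ _ _ _ _ b' he' (fun i => RR' _ _ (hf i)))); apply: h.
(* A group element a is played as the field element s(a), and its partner is the value of the
   answer. *)
- split=> h a.
    have [R' b' [RR' [x ax]]] := bf_forth h2 h1 sat1 (mo_s a) (bf_flip b).
    have xa : relG (fun x y => R' y x) (val0 x) a.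
      by have := bf_v (bf_flip b') ax; rewrite mo_sK.
    have hf' := sP _ _ (relG (fun x y => R' y x)) _ _ _ _ _ xa (fun i => RR' _ _ (hf i)).
    by apply: (iffLR (IH _ _ _ _ _ (bf_flip b') (fun i => RR' _ _ (he i)) hf')); apply: h.
  have [R' b' [RR' [y ay]]] := bf_forth h1 h2 sat2 (mo_s a) b.
  have ay' : relG R' a (val0 y) by have := bf_v b' ay; rewrite mo_sK.
  have hf' := sP _ _ (relG R') _ _ _ _ _ ay' (fun i => RR' _ _ (hf i)).
  by apply: (iffRL (IH _ _ _ _ _ b' (fun i => RR' _ _ (he i)) hf')); apply: h.
Qed.

Lemma tr_true (N : Mo_model) p : Lc_true (kGc_of N) p <-> L2_true (L2_of N) (tr p).
Proof. exact: holds_tr. Qed.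

Lemma ax_kochen_ershov (K1 K2 : Mo_model) : d_henselian K1 -> d_henselian K2 ->
  (forall p, Lc_true (kGc_of K1) p <-> Lc_true (kGc_of K2) p) ->
  forall p, L2_true (L2_of K1) p <-> L2_true (L2_of K2) p.
Proof.
have satur (K : Mo_model) : d_henselian K -> exists N : Mo_model,
    [/\ d_henselian N, saturated (L2_of N) &
        forall p, L2_true (L2_of N) p <-> L2_true (L2_of K) p].
  move=> hK; have [M satM MK] := saturated_extension (L2_of K).
  have [p|N [MN hN]] := model_of_theory hK (M := M); first by rewrite MK.
  by exists N; rewrite -MN.
move=> h1 h2 eqv p.
have [[N1 [hN1 sat1 N1K]] [N2 [hN2 sat2 N2K]]] := (satur _ h1, satur _ h2).
(* Sentences about (k, Gamma; c) are translated into sentences about the whole structure, whose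
   truth passes to the saturated extensions and back. *)
have [q|R b] := bf_start hN1 hN2 sat2; first by rewrite !tr_true N1K N2K -!tr_true.
rewrite -N1K -N2K; apply: (bf_holds hN1 sat1 hN2 sat2 p b) => i; last exact: relG0.
exact: bf0.
Qed.

Theorem theorem2p1 (K : Mo_model) (hK : d_henselian K) :
  axiomatized_by (L2_Th (L2_of K))
    (fun M : L2_structure =>
       exists N : Mo_model,
         M = L2_of N /\
         d_henselian N /\
         Lc_models (kGc_of N) (Lc_Th (kGc_of K))).
Proof.
move=> M; split=> [MK|[N [-> [hN NK]]] p Kp].
  have [N [MN hN]] := model_of_theory hK MK; exists N; split=> //; split=> // p Kp.
  by apply/tr_true; rewrite -MN; apply: MK; apply/tr_true.
apply/(ax_kochen_ershov hN hK) => // q; split=> [Nq|]; last exact: NK.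
(* Th(k, Gamma; c) is complete: if q failed in K, its negation would be an axiom and would hold in
   N. *)
apply: contrapT => nKq.
exact: (NK (Imp q (Bot _ _ _)) nKq).
Qed.
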